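(* Let $M=S^2(\alpha)\times S^4(\beta)$ be a Riemannian product of a round 2-sphere and a round 4-sphere ($\alpha,\beta>0$). Then no orthogonal almost complex structure on $M$ is integrable.
   Context: A round $m$-sphere $S^m(\kappa)$ is an oriented $m$-dimensional sphere with a Riemannian metric of constant sectional curvature $\kappa>0$. Everything is smooth. An almost complex structure on a Riemannian manifold $(M,\langle\cdot,\cdot\rangle)$ is an endomorphism field $J$ of $TM$ with $J^2=-\mathrm{id}$; it is orthogonal if $\langle JX,JY\rangle=\langle X,Y\rangle$ for all vector fields $X,Y$. It is integrable if it is induced by a complex manifold structure; equivalently (Newlander–Nirenberg) its Nijenhuis tensor $N(X,Y)=[JX,JY]-[X,Y]-J[JX,Y]-J[X,JY]$ vanishes everywhere on $M$. *)

(* Defs.v *)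
From HB Require Import structures.
From mathcomp Require Import all_boot all_order all_algebra.
From mathcomp Require Import all_classical all_reals all_analysis.

Set Implicit Arguments.
Unset Strict Implicit.
Unset Printing Implicit Defensive.

Import Order.TTheory GRing.Theory Num.Theory.
Import numFieldNormedType.Exports.

Local Open Scope classical_set_scope.
Local Open Scope ring_scope.

(* Manifolds are embedded submanifolds M of a normed space V, always used with *)
(* V finite-dimensional.  A tensor field or vector field on M is represented   *)
(* by a function on the whole of V, of which only the values at points of M    *)
(* (and at vectors tangent to M) are ever constrained or used.                 *)

Section Submanifolds.
Variable R : realType.
Implicit Types V W : normedModType R.

(* 'D_v1 ('D_v2 (... f)) for vs = [:: v1; v2; ...] *)
Definition iter_derive V W (vs : seq V) (f : V -> W) : V -> W :=
  foldr (fun v (h : V -> W) => fun x => 'D_v h x) f vs.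

(* C^oo on the open set U: all iterated directional derivatives are            *)
(* differentiable (hence continuous).  Meaningful for finite-dimensional V.    *)
Definition smooth_on V W (U : set V) (f : V -> W) : Prop :=
  open U /\ forall (vs : seq V) x, U x -> differentiable (iter_derive vs f) x.

Definition local_extension V W (M : set V) (f : V -> W) (p : V) (F : V -> W)
    : Prop :=
  exists U : set V, [/\ U p, smooth_on U F & forall q, U q -> M q -> F q = f q].

Definition smooth V W (M : set V) (f : V -> W) : Prop :=
  forall p, M p -> exists F, local_extension M f p F.

Definition tangent V (M : set V) (p v : V) : Prop :=
  exists c : R^o -> V,
    [/\ smooth_on setT c, forall t, M (c t), c 0 = p & derive1 c 0 = v].

(* The differential of f : M -> W at p in the direction v: the directional     *)
(* derivative of a smooth local extension of f.  For v tangent to M at p the   *)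
(* result does not depend on the extension chosen by xget.                     *)
Definition mdiff V W (M : set V) (f : V -> W) (p v : V) : W :=
  'D_v (xget f [set F | local_extension M f p F]) p.

Definition vector_field V (M : set V) (X : V -> V) : Prop :=
  smooth M X /\ forall p, M p -> tangent M p (X p).

(* For ambient extensions of X and Y, the Lie bracket on the vector space V is *)
(* DY(X) - DX(Y), and its restriction to M is the Lie bracket on M.            *)
Definition bracket V (M : set V) (X Y : V -> V) : V -> V :=
  fun p => mdiff M Y p (X p) - mdiff M X p (Y p).

Record riemannian_metric V (M : set V) (g : V -> V -> V -> R) : Prop := {
  metric_linear : forall p u v w (a : R), M p ->
    tangent M p u -> tangent M p v -> tangent M p w ->
    g p (a *: u + v) w = a * g p u w + g p v w;
  metric_sym : forall p u v, M p -> tangent M p u -> tangent M p v ->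
    g p u v = g p v u;
  metric_pos : forall p u, M p -> tangent M p u -> u != 0 -> 0 < g p u u;
  metric_smooth : forall X Y, vector_field M X -> vector_field M Y ->
    smooth M (fun p => g p (X p) (Y p) : R^o) }.

Record affine_connection V (M : set V)
    (nabla : (V -> V) -> (V -> V) -> V -> V) : Prop := {
  connection_field : forall X Y, vector_field M X -> vector_field M Y ->
    vector_field M (nabla X Y);
  connection_addl : forall X X' Y p,
    vector_field M X -> vector_field M X' -> vector_field M Y -> M p ->
    nabla (fun q => X q + X' q) Y p = nabla X Y p + nabla X' Y p;
  connection_scalel : forall (f : V -> R^o) X Y p,
    smooth M f -> vector_field M X -> vector_field M Y -> M p ->
    nabla (fun q => f q *: X q) Y p = f p *: nabla X Y p;
  connection_addr : forall X Y Y' p,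
    vector_field M X -> vector_field M Y -> vector_field M Y' -> M p ->
    nabla X (fun q => Y q + Y' q) p = nabla X Y p + nabla X Y' p;
  connection_leibniz : forall (f : V -> R^o) X Y p,
    smooth M f -> vector_field M X -> vector_field M Y -> M p ->
    nabla X (fun q => f q *: Y q) p =
      mdiff M f p (X p) *: Y p + f p *: nabla X Y p }.

Record levi_civita V (M : set V) (g : V -> V -> V -> R)
    (nabla : (V -> V) -> (V -> V) -> V -> V) : Prop := {
  levi_civita_connection : affine_connection M nabla;
  levi_civita_torsion_free : forall X Y p,
    vector_field M X -> vector_field M Y -> M p ->
    nabla X Y p - nabla Y X p = bracket M X Y p;
  levi_civita_metric : forall X Y Z p,
    vector_field M X -> vector_field M Y -> vector_field M Z -> M p ->
    mdiff M (fun q => g q (Y q) (Z q) : R^o) p (X p) =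
      g p (nabla X Y p) (Z p) + g p (Y p) (nabla X Z p) }.

Definition curvature V (M : set V) (nabla : (V -> V) -> (V -> V) -> V -> V)
    (X Y Z : V -> V) : V -> V :=
  fun p => nabla X (nabla Y Z) p - nabla Y (nabla X Z) p
           - nabla (bracket M X Y) Z p.

Definition sectional_curvature V (M : set V) (g : V -> V -> V -> R)
    (nabla : (V -> V) -> (V -> V) -> V -> V) (X Y : V -> V) (p : V) : R :=
  g p (curvature M nabla X Y Y p) (X p) /
  (g p (X p) (X p) * g p (Y p) (Y p) - g p (X p) (Y p) ^+ 2).

(* nabla is the Levi-Civita connection of g, which exists and is unique on     *)
(* vector fields along M.                                                      *)
Definition constant_curvature V (M : set V) (g : V -> V -> V -> R) (kappa : R)
    : Prop :=
  exists2 nabla, levi_civita M g nabla &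
    forall X Y p, vector_field M X -> vector_field M Y -> M p ->
      (forall a b : R, a *: X p + b *: Y p = 0 -> a = 0 /\ b = 0) ->
      sectional_curvature M g nabla X Y p = kappa.

Record almost_complex V (M : set V) (J : V -> V -> V) : Prop := {
  almost_complex_tangent : forall p v, M p -> tangent M p v ->
    tangent M p (J p v);
  almost_complex_linear : forall p u v (a : R), M p ->
    tangent M p u -> tangent M p v ->
    J p (a *: u + v) = a *: J p u + J p v;
  almost_complex_smooth : forall X, vector_field M X ->
    smooth M (fun p => J p (X p));
  almost_complex_square : forall p v, M p -> tangent M p v ->
    J p (J p v) = - v }.

Definition orthogonal_structure V (M : set V) (g : V -> V -> V -> R) (J : V -> V -> V)
    : Prop :=
  forall p u v, M p -> tangent M p u -> tangent M p v ->
    g p (J p u) (J p v) = g p u v.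

Definition nijenhuis V (M : set V) (J : V -> V -> V) (X Y : V -> V) : V -> V :=
  let JX := fun p => J p (X p) in
  let JY := fun p => J p (Y p) in
  fun p => bracket M JX JY p - bracket M X Y p
           - J p (bracket M JX Y p) - J p (bracket M X JY p).

Definition integrable_structure V (M : set V) (J : V -> V -> V) : Prop :=
  forall X Y p, vector_field M X -> vector_field M Y -> M p ->
    nijenhuis M J X Y p = 0.

Definition product_metric V W (g : V -> V -> V -> R) (h : W -> W -> W -> R)
    : V * W -> V * W -> V * W -> R :=
  fun p u v => g p.1 u.1 v.1 + h p.2 u.2 v.2.

(* The norm of 'rV[R]_n in the library is the sup norm, hence the explicit sum. *)
Definition sphere (m : nat) : set 'rV[R]_m.+1 :=
  [set x : 'rV[R]_m.+1 | \sum_(i < m.+1) x 0 i ^+ 2 = 1].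

Definition round_metric (m : nat) (kappa : R)
    (g : 'rV[R]_m.+1 -> 'rV[R]_m.+1 -> 'rV[R]_m.+1 -> R) : Prop :=
  [/\ 0 < kappa, riemannian_metric (@sphere m) g
    & constant_curvature (@sphere m) g kappa].

End Submanifolds.

Arguments sphere R m : clear implicits.

(* Main.v *)
From HB Require Import structures.
Require Import Defs.
From mathcomp Require Import all_boot all_order all_algebra.
From mathcomp Require Import all_classical all_reals all_analysis.
From mathcomp Require Import ring lra.
Import Order.TTheory GRing.Theory Num.Theory.
Import numFieldNormedType.Exports.
Local Open Scope classical_set_scope.
Local Open Scope ring_scope.

Set Implicit Arguments.
Unset Strict Implicit.
Unset Printing Implicit Defensive.

Section SmoothOn.
Variable R : realType.
Implicit Types V W : normedModType R.

Lemma near0_differentiable V W (h : V -> W) x :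
  (\near x, h x = 0) -> differentiable h x.
Proof.
move=> h0.
have h0x : h x = 0 by exact: nbhs_singleton h0.
have E : h \o shift x = cst (h x) + (\0 : V -> W) +o_ 0 id.
  apply: eqaddoE; apply/eqaddoP => e e0.
  have : \forall y \near 0, h (y + x) = 0.
    by move: h0; rewrite (near_shift 0) subr0.
  apply: filterS => y /= hy.
  by rewrite !fctE /= hy h0x addr0 subrr normr0 mulr_ge0// ltW.
have c0 : continuous (\0 : V -> W) by move=> y; exact: cst_continuous.
have dE := @diff_unique _ _ _ h (\0 : {linear V -> W}) x c0 E.
by apply/diff_locallyP; rewrite dE.
Qed.

Lemma near_eq_differentiable V W (f g : V -> W) x :
  (\near x, f x = g x) -> differentiable f x -> differentiable g x.
Proof.
move=> fg df; have -> : g = f + (g - f) by rewrite addrC subrK.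
apply: differentiableD => //; apply: near0_differentiable.
by apply: filterS fg => y /= fgy; rewrite !fctE fgy subrr.
Qed.

Lemma open_near V (U : set V) (P : V -> Prop) x :
  open U -> U x -> (forall y, U y -> P y) -> \near x, P x.
Proof.
move=> oU Ux UP; have : nbhs x U by exact: open_nbhs_nbhs.
by apply: filterS.
Qed.

Lemma smooth_on_open V W (U : set V) (f : V -> W) : smooth_on U f -> open U.
Proof. by case. Qed.

Lemma smooth_on_diff V W (U : set V) (f : V -> W) x :
  smooth_on U f -> U x -> differentiable f x.
Proof. by move=> [_ /(_ [::])]; apply. Qed.

Lemma smooth_on_derivable V W (U : set V) (f : V -> W) x v :
  smooth_on U f -> U x -> derivable f x v.
Proof. by move=> sf Ux; apply: diff_derivable; exact: smooth_on_diff sf Ux. Qed.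

Lemma smooth_onD V W (U : set V) (f : V -> W) v :
  smooth_on U f -> smooth_on U ('D_v f).
Proof.
move=> [oU sf]; split=> // vs x Ux.
by have := sf (rcons vs v) x Ux; rewrite /iter_derive -cats1 foldr_cat.
Qed.

(** Coinduction: [smooth_on U] is the greatest class of functions that are
    differentiable on [U] and stable, up to equality on [U], by derivation. *)
Lemma smooth_on_coind V W (U : set V) (P : (V -> W) -> Prop) :
  open U ->
  (forall f, P f -> (forall x, U x -> differentiable f x) /\
    forall v, exists2 f', P f' & forall x, U x -> 'D_v f x = f' x) ->
  forall f, P f -> smooth_on U f.
Proof.
move=> oU PP f Pf; split=> // vs.
suff [g [Pg gE]] : exists g, P g /\ forall x, U x -> iter_derive vs f x = g x.
  move=> x Ux; apply: (near_eq_differentiable (f := g)); last first.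
    by have [dg _] := PP _ Pg; exact: dg.
  by apply: (open_near oU Ux) => y Uy; rewrite gE.
elim: vs => [|v vs [g [Pg gE]]]; first by exists f.
have [_ /(_ v) [g' Pg' g'E]] := PP _ Pg; exists g'; split=> // x Ux.
rewrite /= -g'E//; apply: near_eq_derive.
by apply: (open_near oU Ux) => y Uy; rewrite gE.
Qed.

Lemma smooth_on_sub V W (U U' : set V) (f : V -> W) :
  open U' -> U' `<=` U -> smooth_on U f -> smooth_on U' f.
Proof. by move=> oU' U'U [_ sf]; split=> // vs x U'x; apply: sf; exact: U'U. Qed.

Lemma smooth_on_cst V W (U : set V) (w : W) : open U -> smooth_on U (cst w).
Proof.
move=> oU; apply: (smooth_on_coind (P := fun h => exists w, h = cst w)) => //.
  move=> {w} _ [w ->]; split=> [x _|v]; first exact: differentiable_cst.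
  by exists (cst 0) => [|x _]; [exists 0|rewrite derive_cst].
by exists w.
Qed.

Lemma smooth_on_lin V W (U : set V) (f : {linear V -> W}) :
  open U -> continuous f -> smooth_on U f.
Proof.
move=> oU cf; apply: (smooth_on_coind
  (P := fun h => h = f \/ exists w, h = cst w)) => //; last by left.
move=> h [->|[w ->]]; split=> [x _|v].
- exact: linear_differentiable.
- exists (cst (f v)); first by right; exists (f v).
  by move=> x _; rewrite deriveE ?diff_lin//; exact: linear_differentiable.
- exact: differentiable_cst.
- by exists (cst 0) => [|x _]; [right; exists 0|rewrite derive_cst].
Qed.

Lemma smooth_onDD V W (U : set V) (f g : V -> W) :
  smooth_on U f -> smooth_on U g -> smooth_on U (f + g).
Proof.
move=> sf sg; have oU := smooth_on_open sf.
apply: (smooth_on_coind (P := fun h => exists f g,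
  [/\ smooth_on U f, smooth_on U g & h = f + g])) => //; last by exists f, g.
move=> _ {f g sf sg} [f [g [sf sg ->]]]; split=> [x Ux|v].
  by apply: differentiableD; [exact: smooth_on_diff sf Ux|exact: smooth_on_diff sg Ux].
exists ('D_v f + 'D_v g).
  by exists ('D_v f), ('D_v g); split=> //; exact: smooth_onD.
move=> x Ux; rewrite deriveD//.
  exact: smooth_on_derivable sf Ux.
exact: smooth_on_derivable sg Ux.
Qed.

Lemma smooth_on_comp_lin V W W' (U : set V) (f : V -> W) (l : {linear W -> W'}) :
  continuous l -> smooth_on U f -> smooth_on U (l \o f).
Proof.
move=> cl sf; have oU := smooth_on_open sf.
apply: (smooth_on_coind (P := fun h => exists2 f,
  smooth_on U f & h = l \o f)) => //; last by exists f.
move=> _ {f sf} [f sf ->]; split=> [x Ux|v].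
  apply: differentiable_comp; first exact: smooth_on_diff sf Ux.
  exact: linear_differentiable.
exists (l \o 'D_v f); first by exists ('D_v f) => //; exact: smooth_onD.
move=> x Ux; have dfx := smooth_on_diff sf Ux.
rewrite deriveE; last by apply: differentiable_comp => //; exact: linear_differentiable.
rewrite diff_comp//; last exact: linear_differentiable.
by rewrite /= diff_lin//= deriveE.
Qed.

Lemma scale_differentiable V W (f : V -> R^o) (g : V -> W) x :
  differentiable f x -> differentiable g x ->
  differentiable (fun y => f y *: g y) x /\
  forall v, 'D_v (fun y => f y *: g y) x = 'D_v f x *: g x + f x *: 'D_v g x.
Proof.
move=> df dg.
have bil : bilinear_for (GRing.Scale.Law.clone _ _ *:%R _)
    (GRing.Scale.Law.clone _ _ *:%R _) (fun (k : R^o) (w : W) => k *: w).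
  split=> [w|k] a y z /=; first by rewrite scalerDl scalerA.
  by rewrite scalerDr !scalerA mulrC.
pose bM := bilinear_isBilinear.Build R R^o W W _ _ _ bil.
pose bL : {bilinear R^o -> W -> W} := HB.pack (fun (k : R^o) (w : W) => k *: w) bM.
have cb : continuous (fun p : R^o * W => bL p.1 p.2) by exact: scale_continuous.
have dp : differentiable (fun y => (f y, g y)) x by exact: differentiable_pair.
have db := differentiable_bilin (f x, g x) cb.
have -> : (fun y => f y *: g y) =
  (fun p : R^o * W => bL p.1 p.2) \o (fun y => (f y, g y)) by [].
split=> [|v]; first exact: differentiable_comp.
rewrite deriveE; last exact: differentiable_comp.
rewrite diff_comp//.
change ('d (fun p : R^o * W => bL p.1 p.2) (f x, g x)
  ('d (fun y => (f y, g y)) x v) = 'D_v f x *: g x + f x *: 'D_v g x).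
by rewrite (diff_bilin (f x, g x) cb) diff_pair//= !deriveE// addrC.
Qed.

Inductive scale_span V W (U : set V) : (V -> W) -> Prop :=
| scale_span_gen (f : V -> R^o) g : smooth_on U f -> smooth_on U g ->
    scale_span U (fun y => f y *: g y)
| scale_span_add h h' : scale_span U h -> scale_span U h' -> scale_span U (h + h').

Lemma smooth_on_scale V W (U : set V) (f : V -> R^o) (g : V -> W) :
  smooth_on U f -> smooth_on U g -> smooth_on U (fun y => f y *: g y).
Proof.
move=> sf sg; have oU := smooth_on_open sf.
apply: (smooth_on_coind (P := scale_span U)) => //; last exact: scale_span_gen.
move=> h; elim=> {sf sg f g h} [f g sf sg|h h' _ [dh Dh] _ [dh' Dh']].
  split=> [x Ux|v].
    have df := smooth_on_diff sf Ux; have dg := smooth_on_diff sg Ux.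
    by have [] := scale_differentiable df dg.
  exists ((fun y => 'D_v f y *: g y) + (fun y => f y *: 'D_v g y)).
    by apply: scale_span_add; apply: scale_span_gen => //; exact: smooth_onD.
  move=> x Ux; have df := smooth_on_diff sf Ux; have dg := smooth_on_diff sg Ux.
  by have [_ ->] := scale_differentiable df dg.
split=> [x Ux|v]; first by apply: differentiableD; [exact: dh|exact: dh'].
  have [k sk kE] := Dh v; have [k' sk' k'E] := Dh' v.
  exists (k + k'); first exact: scale_span_add.
  move=> x Ux; rewrite deriveD ?kE ?k'E//.
    by apply: diff_derivable; exact: dh.
  by apply: diff_derivable; exact: dh'.
Qed.

Lemma smooth_on_sum V W (U : set V) n (f : 'I_n -> V -> W) :
  open U -> (forall i, smooth_on U (f i)) -> smooth_on U (\sum_i f i).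
Proof.
move=> oU sf; elim/big_ind : _ => // [|g h].
- exact: (smooth_on_cst 0 oU).
- exact: smooth_onDD.
Qed.

Lemma smooth_on_pair V W W' (U : set V) (f : V -> W) (g : V -> W') :
  smooth_on U f -> smooth_on U g -> smooth_on U (fun x => (f x, g x)).
Proof.
move=> sf sg; have oU := smooth_on_open sf.
apply: (smooth_on_coind (P := fun h => exists f g,
  [/\ smooth_on U f, smooth_on U g & h = fun x => (f x, g x)])) => //; last by exists f, g.
move=> _ {f g sf sg} [f [g [sf sg ->]]].
have df x : U x -> differentiable f x by exact: smooth_on_diff.
have dg x : U x -> differentiable g x by exact: smooth_on_diff.
split=> [x Ux|v]; first by apply: differentiable_pair; [exact: df|exact: dg].
exists (fun x => ('D_v f x, 'D_v g x)).
  by exists ('D_v f), ('D_v g); split=> //; exact: smooth_onD.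
move=> x Ux; have dfx := df _ Ux; have dgx := dg _ Ux.
by rewrite !deriveE ?diff_pair//; exact: differentiable_pair.
Qed.

Lemma derive_comp_affine V V' W (f : V -> W) (c : V) (l : {linear V' -> V}) x v :
  continuous l -> differentiable f (c + l x) ->
  differentiable (fun y => f (c + l y)) x /\
  'D_v (fun y => f (c + l y)) x = 'D_(l v) f (c + l x).
Proof.
move=> cl df; have dl : differentiable l x by exact: linear_differentiable.
have da : differentiable (cst c + l) x.
  by apply: differentiableD => //; exact: differentiable_cst.
have dc : differentiable (f \o (cst c + l)) x by exact: differentiable_comp.
split=> //; rewrite (deriveE v dc) deriveE// diff_comp//=.
by rewrite diffD//= fctE diff_cst add0r diff_lin.
Qed.

Lemma smooth_on_comp_affine V V' W (U : set V) (f : V -> W) (c : V)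
    (l : {linear V' -> V}) : continuous l -> smooth_on U f ->
  smooth_on [set x | U (c + l x)] (fun y => f (c + l y)).
Proof.
move=> cl sf; have oU := smooth_on_open sf.
apply: (smooth_on_coind (P := fun h => exists2 f, smooth_on U f &
  h = fun y => f (c + l y))); last by exists f.
  rewrite -[X in open X]/((fun x => c + l x) @^-1` U).
  apply: open_comp => // x _; apply: cvgD; first exact: cvg_cst.
  exact: cl.
move=> _ {f sf} [f sf ->].
have dfl x : U (c + l x) -> differentiable f (c + l x) by exact: smooth_on_diff.
split=> [x Ux|v]; first by have [] := derive_comp_affine 0 cl (dfl _ Ux).
exists (fun y => 'D_(l v) f (c + l y)); first by exists ('D_(l v) f) => //; exact: smooth_onD.
by move=> x Ux; have [_ ->] := derive_comp_affine v cl (dfl _ Ux).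
Qed.

Lemma mean_value_segment V (f : V -> R^o) (x u : V) (s : R) : 0 < s ->
  (forall t : R, 0 <= t <= s -> differentiable f (x + t *: u)) ->
  exists2 t, 0 <= t <= s & f (x + s *: u) - f x = s * 'D_u f (x + t *: u).
Proof.
move=> s0 df.
have ll : linear (fun t : R^o => t *: u : V).
  by move=> k a b; rewrite scalerDl scalerA.
pose lM := GRing.isLinear.Build R R^o V _ _ ll.
pose l : {linear R^o -> V} := HB.pack (fun t : R^o => t *: u : V) lM.
have cl : continuous l by exact: scalel_continuous.
pose g (t : R) : R := f (x + t *: u).
have dg t : 0 <= t <= s -> is_derive t 1 g ('D_u f (x + t *: u)).
  move=> /df dft; have [dgt Dgt] := @derive_comp_affine _ _ _ f x l t 1 cl dft.
  apply: DeriveDef; first exact: diff_derivable.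
  by rewrite [LHS]Dgt /= scale1r.
have [|t] := @MVT R g (fun t => 'D_u f (x + t *: u)) 0 s s0
    (fun t ht => dg t (subset_itv_oo_cc ht)).
  apply: derivable_within_continuous => t; rewrite in_itv/= => ht.
  by have [] := dg t ht.
rewrite in_itv/= => /andP[t0 ts]; rewrite /g scale0r addr0 subr0 mulrC => E.
by exists t; rewrite ?(ltW t0) ?(ltW ts).
Qed.

(** Both mixed derivatives at nearby points equal the same second difference
    quotient, by applying the mean value theorem twice. *)
Lemma derive_comm V (U : set V) (f : V -> R^o) x u v : smooth_on U f -> U x ->
  'D_u ('D_v f) x = 'D_v ('D_u f) x.
Proof.
move=> sf Ux; have oU := smooth_on_open sf.
have cD a b : {for x, continuous ('D_a ('D_b f))}.
  apply: differentiable_continuous; apply: smooth_on_diff Ux.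
  by do 2 apply: smooth_onD.
have second_difference a b (e : R) : 0 < e -> \forall s \near (0 : R)^'+,
    exists2 c, `|c - 'D_b ('D_a f) x| < e &
    f (x + s *: a + s *: b) - f (x + s *: a) - (f (x + s *: b) - f x) =
    s * (s * c).
  move=> e0; have : nbhs x (U `&` [set y | `|'D_b ('D_a f) y - 'D_b ('D_a f) x| < e]).
    apply: filterI; first exact: open_nbhs_nbhs.
    have /cvgrPdist_lt/(_ _ e0) := cD b a.
    by apply: filterS => y /= hy; rewrite distrC; exact: hy.
  move=> /nbhs_ballP[r /= r0 rU].
  have n0 : 0 < `|a| + `|b| + 1 by rewrite ltr_wpDl// addr_ge0.
  near=> s.
  have s0 : 0 < s by near: s; exact: nbhs_right_gt.
  have sr : s < r / (`|a| + `|b| + 1).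
    by near: s; apply: nbhs_right_lt; rewrite divr_gt0.
  have inball t t' : 0 <= t <= s -> 0 <= t' <= s -> ball x r (x + t *: a + t' *: b).
    move=> /andP[t0 ts] /andP[t0' ts']; rewrite -ball_normE /ball_/=.
    rewrite -addrA opprD addNKr normrN (le_lt_trans (ler_normD _ _))//.
    rewrite !normrZ !ger0_norm//.
    apply: (@le_lt_trans _ _ (s * (`|a| + `|b| + 1))); last by rewrite -ltr_pdivlMr.
    by rewrite !mulrDr mulr1 ler_wpDr ?(ltW s0)// lerD// ler_wpM2r.
  have diffU y : ball x r y -> differentiable f y.
    by move=> /rU[Uy _]; exact: smooth_on_diff sf Uy.
  have dsh y : differentiable f (s *: b + y) ->
      differentiable (fun y => f (s *: b + y)) y /\
      'D_a (fun y => f (s *: b + y)) y = 'D_a f (s *: b + y).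
    exact: (@derive_comp_affine _ _ _ f (s *: b) idfun y a (fun y => cvg_id)).
  have ss : 0 <= s <= s by apply/andP; split=> //; exact: ltW.
  have s00 : 0 <= (0 : R) <= s by apply/andP; split=> //; exact: ltW.
  have dh t : 0 <= t <= s -> differentiable f (s *: b + (x + t *: a)) /\
      differentiable f (x + t *: a).
    move=> ht; split; apply: diffU; first by rewrite addrC; exact: inball.
    by have := inball t 0 ht s00; rewrite scale0r addr0.
  have [|t ht E] := @mean_value_segment V (fun y => f (s *: b + y) - f y) x a s s0.
    move=> t /dh[d1 d2]; apply: differentiableB => //.
    by have [] := dsh _ d1.
  have [d1 d2] := dh t ht; have [d3 d4] := dsh _ d1.
  have [|t' ht' E'] := @mean_value_segment V ('D_a f) (x + t *: a) b s s0.
    move=> t' ht'; have [Uy _] := rU _ (inball _ _ ht ht').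
    by apply: smooth_on_diff Uy; exact: smooth_onD.
  exists ('D_b ('D_a f) (x + t *: a + t' *: b)).
    by have [_] := rU _ (inball _ _ ht ht').
  rewrite -E' -[x + t *: a + s *: b]addrC -d4.
  rewrite -[x + s *: a + s *: b]addrC -[x + s *: b]addrC E.
  congr (_ * _); rewrite deriveB//; exact: diff_derivable.
apply/eqP; rewrite -subr_eq0; apply/negPn/negP; rewrite -normr_gt0.
set e := `|_| => e0.
have e2 : 0 < e / 2 by rewrite divr_gt0.
near (0 : R)^'+ => s.
have [c ce cE] : exists2 c, `|c - 'D_v ('D_u f) x| < e / 2 &
    f (x + s *: u + s *: v) - f (x + s *: u) - (f (x + s *: v) - f x) =
    s * (s * c).
  by near: s; exact: second_difference.
have [c' ce' cE'] : exists2 c, `|c - 'D_u ('D_v f) x| < e / 2 &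
    f (x + s *: v + s *: u) - f (x + s *: v) - (f (x + s *: u) - f x) =
    s * (s * c).
  by near: s; exact: second_difference.
have s0 : s != 0 by rewrite gt_eqF//; near: s; exact: nbhs_right_gt.
have cc : c = c'.
  apply: (mulfI s0); apply: (mulfI s0); rewrite -cE -cE' (addrAC x); ring.
rewrite -cc in ce'.
have close (A B : R) : `|c - A| < `|B - A| / 2 -> `|c - B| < `|B - A| / 2 -> False.
  rewrite (distrC c B) => cA cB.
  by have := le_lt_trans (ler_distD c B A) (ltrD cB cA); rewrite -splitr ltxx.
exact: close ce ce'.
Unshelve. all: by end_near. Qed.

End SmoothOn.

Section Mdiff.
Variable R : realType.
Implicit Types V W : normedModType R.

Lemma tangent_chain V W (M : set V) (f F : V -> W) p (c : R^o -> V) :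
  local_extension M f p F -> smooth_on setT c -> (forall t, M (c t)) ->
  c 0 = p -> is_derive (0 : R^o) 1 (f \o c) ('D_(derive1 c 0) F p).
Proof.
move=> [U [Up sF Ff]] sc Mc c0.
have dc : differentiable c 0 by exact: smooth_on_diff sc I.
have dF : differentiable F (c 0) by rewrite c0; exact: smooth_on_diff sF Up.
have near_eq : \forall t \near (0 : R^o), (F \o c) t = (f \o c) t.
  have : nbhs (0 : R^o) (c @^-1` U).
    apply: (differentiable_continuous dc); rewrite c0; apply: open_nbhs_nbhs.
    by split=> //; exact: smooth_on_open sF.
  by apply: filterS => t Ut /=; rewrite Ff.
apply: (near_eq_is_derive near_eq).
have dFc : differentiable (F \o c) 0 by exact: differentiable_comp.
apply: DeriveDef; first exact: diff_derivable.
by rewrite deriveE// diff_comp//= derive1E -c0 (deriveE _ dF) (deriveE _ dc).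
Qed.

(** Two extensions agree along a curve in [M] with the given velocity. *)
Lemma mdiffE V W (M : set V) (f F : V -> W) p v :
  tangent M p v -> local_extension M f p F -> mdiff M f p v = 'D_v F p.
Proof.
move=> [c [sc Mc c0 <-]] FE.
have GE : local_extension M f p (xget f [set F | local_extension M f p F]).
  by apply: (xgetPex f); exists F.
have [_ e1] := tangent_chain FE sc Mc c0.
by have [_ e2] := tangent_chain GE sc Mc c0; rewrite /mdiff -e2 e1.
Qed.

Lemma local_extension_smooth V W (M : set V) (f : V -> W) p F :
  local_extension M f p F -> exists2 U : set V, U p & smooth_on U F.
Proof. by move=> [U [Up sF _]]; exists U. Qed.

Lemma local_extension_diff V W (M : set V) (f : V -> W) p F :
  local_extension M f p F -> differentiable F p.
Proof. by move=> [U [Up sF _]]; exact: smooth_on_diff sF Up. Qed.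

Lemma local_extension_at V W (M : set V) (f : V -> W) p F :
  M p -> local_extension M f p F -> F p = f p.
Proof. by move=> Mp [U [Up _ FE]]; exact: FE. Qed.

Lemma local_extension_eq V W (M : set V) (f g : V -> W) p F :
  (forall q, M q -> f q = g q) -> local_extension M f p F ->
  local_extension M g p F.
Proof.
by move=> fg [U [Up sF FE]]; exists U; split=> // q Uq Mq; rewrite FE// fg.
Qed.

Lemma eq_smooth V W (M : set V) (f g : V -> W) :
  (forall q, M q -> f q = g q) -> smooth M f -> smooth M g.
Proof.
by move=> fg sf p /sf[F FE]; exists F; exact: local_extension_eq FE.
Qed.

Lemma eq_mdiff V W (M : set V) (f g : V -> W) p v :
  (forall q, M q -> f q = g q) -> smooth M f -> M p -> tangent M p v ->
  mdiff M f p v = mdiff M g p v.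
Proof.
move=> fg sf Mp Tv; have [F FE] := sf _ Mp.
by rewrite (mdiffE Tv FE) (mdiffE Tv (local_extension_eq fg FE)).
Qed.

Lemma local_extension2 V W W' W2 (M : set V) (f : V -> W) (g : V -> W') p F G
    (op : W -> W' -> W2) :
  (forall (U : set V) f g, smooth_on U f -> smooth_on U g ->
     smooth_on U (fun x => op (f x) (g x))) ->
  local_extension M f p F -> local_extension M g p G ->
  local_extension M (fun x => op (f x) (g x)) p (fun x => op (F x) (G x)).
Proof.
move=> sop [U [Up sF FE]] [U' [U'p sG GE]].
have oI : open (U `&` U') by apply: openI; [exact: smooth_on_open sF|exact: smooth_on_open sG].
exists (U `&` U'); split=> //.
  by apply: sop; [apply: smooth_on_sub sF|apply: smooth_on_sub sG]; try by move=> ? [].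
by move=> q [Uq U'q] Mq; rewrite FE// GE.
Qed.

Lemma local_extensionD V W (M : set V) (f g : V -> W) p F G :
  local_extension M f p F -> local_extension M g p G ->
  local_extension M (fun x => f x + g x) p (fun x => F x + G x).
Proof. by apply: local_extension2 => U ? ?; exact: smooth_onDD. Qed.

Lemma local_extension_scale V W (M : set V) (f : V -> R^o) (g : V -> W) p F G :
  local_extension M f p F -> local_extension M g p G ->
  local_extension M (fun x => f x *: g x) p (fun x => F x *: G x).
Proof. by apply: local_extension2 => U ? ?; exact: smooth_on_scale. Qed.

Lemma local_extension_pair V W W' (M : set V) (f : V -> W) (g : V -> W') p F G :
  local_extension M f p F -> local_extension M g p G ->
  local_extension M (fun x => (f x, g x)) p (fun x => (F x, G x)).
Proof. by apply: local_extension2 => U ? ?; exact: smooth_on_pair. Qed.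

Lemma local_extension_lin V W W' (M : set V) (f : V -> W) p F
    (l : {linear W -> W'}) : continuous l ->
  local_extension M f p F -> local_extension M (l \o f) p (l \o F).
Proof.
move=> cl [U [Up sF FE]]; exists U; split=> //; first exact: smooth_on_comp_lin.
by move=> q Uq Mq /=; rewrite FE.
Qed.

Lemma smoothD V W (M : set V) (f g : V -> W) :
  smooth M f -> smooth M g -> smooth M (fun x => f x + g x).
Proof.
move=> sf sg p Mp; have [F FE] := sf _ Mp; have [G GE] := sg _ Mp.
by exists (fun x => F x + G x); exact: local_extensionD.
Qed.

Lemma smooth_scale V W (M : set V) (f : V -> R^o) (g : V -> W) :
  smooth M f -> smooth M g -> smooth M (fun x => f x *: g x).
Proof.
move=> sf sg p Mp; have [F FE] := sf _ Mp; have [G GE] := sg _ Mp.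
by exists (fun x => F x *: G x); exact: local_extension_scale.
Qed.

Lemma smooth_pair V W W' (M : set V) (f : V -> W) (g : V -> W') :
  smooth M f -> smooth M g -> smooth M (fun x => (f x, g x)).
Proof.
move=> sf sg p Mp; have [F FE] := sf _ Mp; have [G GE] := sg _ Mp.
by exists (fun x => (F x, G x)); exact: local_extension_pair.
Qed.

Lemma smooth_comp_lin V W W' (M : set V) (f : V -> W) (l : {linear W -> W'}) :
  continuous l -> smooth M f -> smooth M (l \o f).
Proof.
move=> cl sf p Mp; have [F FE] := sf _ Mp.
by exists (l \o F); exact: local_extension_lin.
Qed.

Lemma smooth_cst V W (M : set V) (w : W) : smooth M (cst w).
Proof.
move=> p Mp; exists (cst w); exists setT; split=> //.
by apply: smooth_on_cst; exact: openT.
Qed.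

Lemma smooth_lin V W (M : set V) (l : {linear V -> W}) :
  continuous l -> smooth M l.
Proof.
move=> cl p Mp; exists l; exists setT; split=> //.
by apply: smooth_on_lin => //; exact: openT.
Qed.

Lemma smooth_sum V W (M : set V) n (f : 'I_n -> V -> W) :
  (forall i, smooth M (f i)) -> smooth M (fun x => \sum_i f i x).
Proof.
move=> sf; have -> : (fun x => \sum_i f i x) = \sum_i f i.
  by apply/funext => x; rewrite fct_sumE.
elim/big_ind : _ => // [|g h]; first exact: smooth_cst.
exact: smoothD.
Qed.

Section Rules.
Variables (V W : normedModType R) (M : set V) (p v : V).
Hypotheses (Mp : M p) (Tv : tangent M p v).

Lemma mdiffD (f g : V -> W) : smooth M f -> smooth M g ->
  mdiff M (fun x => f x + g x) p v = mdiff M f p v + mdiff M g p v.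
Proof.
move=> sf sg; have [F FE] := sf _ Mp; have [G GE] := sg _ Mp.
rewrite (mdiffE Tv FE) (mdiffE Tv GE) (mdiffE Tv (local_extensionD FE GE)).
rewrite -[fun x => _]/(F + G) deriveD//; apply: diff_derivable.
  exact: local_extension_diff FE.
exact: local_extension_diff GE.
Qed.

Lemma mdiff_scale (f : V -> R^o) (g : V -> W) : smooth M f -> smooth M g ->
  mdiff M (fun x => f x *: g x) p v = mdiff M f p v *: g p + f p *: mdiff M g p v.
Proof.
move=> sf sg; have [F FE] := sf _ Mp; have [G GE] := sg _ Mp.
rewrite (mdiffE Tv FE) (mdiffE Tv GE) (mdiffE Tv (local_extension_scale FE GE)).
rewrite -(local_extension_at Mp FE) -(local_extension_at Mp GE).
by have [_ ->] := scale_differentiable (local_extension_diff FE)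
  (local_extension_diff GE).
Qed.

Lemma mdiff_comp_lin W' (f : V -> W) (l : {linear W -> W'}) : continuous l ->
  smooth M f -> mdiff M (l \o f) p v = l (mdiff M f p v).
Proof.
move=> cl sf; have [F FE] := sf _ Mp.
rewrite (mdiffE Tv FE) (mdiffE Tv (local_extension_lin cl FE)).
have dF := local_extension_diff FE.
have dl : differentiable l (F p) by exact: linear_differentiable.
rewrite deriveE; last exact: differentiable_comp.
by rewrite diff_comp//= diff_lin// deriveE.
Qed.

Lemma mdiff_cst (w : W) : mdiff M (cst w) p v = 0.
Proof.
have E : local_extension M (cst w) p (cst w).
  by exists setT; split=> //; apply: smooth_on_cst; exact: openT.
by rewrite (mdiffE Tv E) derive_cst.
Qed.

Lemma mdiff_lin (l : {linear V -> W}) : continuous l -> mdiff M l p v = l v.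
Proof.
move=> cl; have E : local_extension M l p l.
  by exists setT; split=> //; apply: smooth_on_lin => //; exact: openT.
rewrite (mdiffE Tv E) deriveE ?diff_lin//; exact: linear_differentiable.
Qed.

Lemma mdiff_sum n (f : 'I_n -> V -> W) : (forall i, smooth M (f i)) ->
  mdiff M (fun x => \sum_i f i x) p v = \sum_i mdiff M (f i) p v.
Proof.
elim: n f => [|n IH] f sf.
  have -> : (fun x => \sum_i f i x) = cst 0 by apply/funext => x; rewrite big_ord0.
  by rewrite mdiff_cst big_ord0.
have -> : (fun x => \sum_i f i x) =
    fun x => f ord0 x + \sum_(i < n) f (lift ord0 i) x.
  by apply/funext => x; rewrite big_ord_recl.
rewrite mdiffD//; last exact: smooth_sum.
by rewrite IH// big_ord_recl.
Qed.

Lemma mdiff_pair W' (f : V -> W) (g : V -> W') : smooth M f -> smooth M g ->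
  mdiff M (fun x => (f x, g x)) p v = (mdiff M f p v, mdiff M g p v).
Proof.
move=> sf sg; have [F FE] := sf _ Mp; have [G GE] := sg _ Mp.
rewrite (mdiffE Tv FE) (mdiffE Tv GE) (mdiffE Tv (local_extension_pair FE GE)).
have dF := local_extension_diff FE; have dG := local_extension_diff GE.
by rewrite !deriveE ?diff_pair//; exact: differentiable_pair.
Qed.

Lemma mdiff_dirP (f : V -> W) u (a : R) : smooth M f -> tangent M p u ->
  tangent M p (a *: v + u) ->
  mdiff M f p (a *: v + u) = a *: mdiff M f p v + mdiff M f p u.
Proof.
move=> sf Tu Tvu; have [F FE] := sf _ Mp.
rewrite (mdiffE Tv FE) (mdiffE Tu FE) (mdiffE Tvu FE).
by have dF := local_extension_diff FE; rewrite !deriveE// linearP.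
Qed.

End Rules.
End Mdiff.

Section Frame.
Variable R : realType.

(** A subset of a normed space with coordinates [feps] in a basis [fe], whose
    tangent spaces are spanned by global vector fields [fE] in such a way that
    the coordinates of a tangent vector are also its coefficients on [fE]. *)
Record frame (V : normedModType R) (M : set V) := Frame {
  fdim : nat;
  fe : 'I_fdim -> V;
  feps : 'I_fdim -> {linear V -> R^o};
  fE : 'I_fdim -> V -> V;
  feps_continuous : forall i, continuous (feps i);
  fe_basis : forall v, v = \sum_i feps i v *: fe i;
  fE_field : forall i, vector_field M (fE i);
  fE_span : forall p v, M p -> tangent M p v -> v = \sum_i feps i v *: fE i p;
  frame_tangent : forall p a u v, M p -> tangent M p u -> tangent M p v ->
    tangent M p (a *: u + v);
  fE_bracket : forall i j p, M p -> tangent M p (bracket M (fE i) (fE j) p) }.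

Arguments fe {V M} _ _.
Arguments feps {V M} _ _.
Arguments fE {V M} _ _ _.
Arguments fE_span {V M} _ {p v} _ _.
Arguments fE_field {V M} _ _.

Variables (V : normedModType R) (M : set V) (F : frame M).
Implicit Types (W : normedModType R) (X Y : V -> V).

Lemma tangent0 p : M p -> tangent M p 0.
Proof.
move=> Mp; exists (cst p); split=> //.
  by apply: smooth_on_cst; exact: openT.
by rewrite derive1_cst.
Qed.

Lemma frame_tangentD p u v : M p -> tangent M p u -> tangent M p v ->
  tangent M p (u + v).
Proof. by move=> Mp Tu Tv; rewrite -[u]scale1r; exact: frame_tangent. Qed.

Lemma frame_tangentZ p a u : M p -> tangent M p u -> tangent M p (a *: u).
Proof.
by move=> Mp Tu; rewrite -[_ *: _]addr0; apply: frame_tangent => //; exact: tangent0.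
Qed.

Lemma frame_tangent_sum n p (v : 'I_n -> V) : M p ->
  (forall i, tangent M p (v i)) -> tangent M p (\sum_i v i).
Proof.
move=> Mp Tv; elim/big_ind : _ => //; first exact: tangent0.
by move=> a b; exact: frame_tangentD.
Qed.

Lemma mdiff_dir_sum W (f : V -> W) n p (a : 'I_n -> R) (v : 'I_n -> V) : M p ->
  smooth M f -> (forall i, tangent M p (v i)) ->
  mdiff M f p (\sum_i a i *: v i) = \sum_i a i *: mdiff M f p (v i).
Proof.
move=> Mp sf Tv; have [f' fE] := sf _ Mp; have df := local_extension_diff fE.
have Ts : tangent M p (\sum_i a i *: v i).
  by apply: frame_tangent_sum => // i; exact: frame_tangentZ.
rewrite (mdiffE Ts fE) deriveE// linear_sum; apply: eq_bigr => i _.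
by rewrite linearZ (mdiffE (Tv i) fE) deriveE.
Qed.

Lemma mdiff_field X Y p : vector_field M X -> vector_field M Y -> M p ->
  mdiff M Y p (X p) =
  \sum_j mdiff M (feps F j \o Y) p (X p) *: fE F j p +
  \sum_j \sum_i (feps F j (Y p) * feps F i (X p)) *:
    mdiff M (fE F j) p (fE F i p).
Proof.
move=> vX vY Mp; have TX := vX.2 _ Mp.
have TE i : tangent M p (fE F i p) by exact: (fE_field F i).2.
have sY j : smooth M (feps F j \o Y).
  by apply: smooth_comp_lin; [exact: feps_continuous|exact: vY.1].
have sE j : smooth M (fE F j) by exact: (fE_field F j).1.
rewrite (@eq_mdiff _ _ _ _ _
  (fun q => \sum_j (feps F j \o Y) q *: fE F j q) _ _ _ vY.1 Mp TX); last first.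
  by move=> q Mq; rewrite {1}(fE_span F Mq (vY.2 _ Mq)).
rewrite (mdiff_sum Mp TX); last by move=> j; exact: smooth_scale.
rewrite -big_split /=; apply: eq_bigr => j _.
rewrite (mdiff_scale Mp TX (sY j) (sE j)); congr (_ + _).
rewrite {1}(fE_span F Mp TX) mdiff_dir_sum// scaler_sumr.
by apply: eq_bigr => i _; rewrite scalerA.
Qed.

Lemma frame_bracket X Y p : vector_field M X -> vector_field M Y -> M p ->
  tangent M p (bracket M X Y p).
Proof.
move=> vX vY Mp; rewrite /bracket (mdiff_field vX vY Mp) (mdiff_field vY vX Mp).
have TE i : tangent M p (fE F i p) by exact: (fE_field F i).2.
rewrite opprD addrACA; apply: frame_tangentD => //.
  rewrite -sumrB; apply: frame_tangent_sum => // i; rewrite -scalerBl.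
  exact: frame_tangentZ.
rewrite [X in X - _]exchange_big -sumrB; apply: frame_tangent_sum => // i.
rewrite -sumrB; apply: frame_tangent_sum => // j.
rewrite mulrC -scalerBr; apply: frame_tangentZ => //; exact: fE_bracket.
Qed.

Lemma derive_frame W (f : V -> W) q v : differentiable f q ->
  'D_v f q = \sum_i feps F i v *: 'D_(fe F i) f q.
Proof.
move=> df; rewrite deriveE// {1}(fe_basis F v) linear_sum.
by apply: eq_bigr => i _; rewrite linearZ deriveE.
Qed.

Lemma local_extension_der W (f : V -> W) X p f' X' : vector_field M X ->
  local_extension M f p f' -> local_extension M X p X' ->
  local_extension M (fun q => mdiff M f q (X q)) p
    (fun q => \sum_i feps F i (X' q) *: 'D_(fe F i) f' q).
Proof.
move=> [_ TX] [U [Up sf fE]] [U' [U'p sX XE]].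
have oU := smooth_on_open sf.
have oI : open (U `&` U') by apply: openI => //; exact: smooth_on_open sX.
have UI : U `&` U' `<=` U by move=> ? [].
have UI' : U `&` U' `<=` U' by move=> ? [].
exists (U `&` U'); split=> //.
  rewrite (_ : (fun _ => _) =
      \sum_i (fun q => feps F i (X' q) *: 'D_(fe F i) f' q)); last first.
    by apply/funext => q; rewrite fct_sumE.
  apply: smooth_on_sum => // i; apply: smooth_on_scale.
    apply: smooth_on_comp_lin; first exact: feps_continuous.
    exact: smooth_on_sub sX.
  by apply: smooth_onD; exact: smooth_on_sub sf.
move=> q [Uq U'q] Mq; rewrite XE// -derive_frame; last exact: smooth_on_diff sf Uq.
by rewrite (@mdiffE _ _ _ _ _ f')//; [exact: TX|exists U].
Qed.

Lemma smooth_der W (f : V -> W) X : smooth M f -> vector_field M X ->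
  smooth M (fun q => mdiff M f q (X q)).
Proof.
move=> sf vX p Mp; have [f' fE] := sf _ Mp; have [X' XE] := vX.1 _ Mp.
by eexists; apply: local_extension_der; eassumption.
Qed.

(** The second-order terms are equal, since mixed derivatives commute. *)
Lemma bracket_der (f : V -> R^o) X Y p : smooth M f -> vector_field M X ->
  vector_field M Y -> M p ->
  mdiff M (fun q => mdiff M f q (Y q)) p (X p) -
  mdiff M (fun q => mdiff M f q (X q)) p (Y p) = mdiff M f p (bracket M X Y p).
Proof.
move=> sf vX vY Mp; have [f' fE] := sf _ Mp.
have [X' XE] := vX.1 _ Mp; have [Y' YE] := vY.1 _ Mp.
have TX := vX.2 _ Mp; have TY := vY.2 _ Mp.
have [U Up sf'] := local_extension_smooth fE.
have df x : U x -> differentiable f' x by exact: smooth_on_diff.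
have second A A' v : vector_field M A -> local_extension M A p A' ->
    tangent M p v -> mdiff M (fun q => mdiff M f q (A q)) p v =
    'D_('D_v A' p) f' p + 'D_v ('D_(A p) f') p.
  move=> vA AE Tv; rewrite (mdiffE Tv (local_extension_der vA fE AE)).
  have dA := local_extension_diff AE.
  have Dscale i : differentiable (fun q => feps F i (A' q)) p /\
      'D_v (fun q => feps F i (A' q)) p = feps F i ('D_v A' p).
    have dl x : differentiable (feps F i) x.
      by apply: linear_differentiable; exact: feps_continuous.
    have dc : differentiable (feps F i \o A') p by exact: differentiable_comp.
    split=> //; rewrite (deriveE v dc) diff_comp// deriveE//=.
    by rewrite diff_lin//; exact: feps_continuous.
  have dDf i : differentiable ('D_(fe F i) f') p.
    by apply: smooth_on_diff Up; exact: smooth_onD.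
  have term i := scale_differentiable (Dscale i).1 (dDf i).
  rewrite (_ : (fun _ => _) =
      \sum_i (fun q => feps F i (A' q) *: 'D_(fe F i) f' q)); last first.
    by apply/funext => q; rewrite fct_sumE.
  rewrite derive_sum; last by move=> i; apply: diff_derivable; exact: (term i).1.
  under eq_bigr => i _ do rewrite (term i).2 (Dscale i).2.
  rewrite big_split/= -(derive_frame _ (df _ Up)); congr (_ + _).
  rewrite (derive_comm _ _ sf' Up) derive_frame.
    apply: eq_bigr => i _.
    by rewrite (derive_comm v _ sf' Up) (local_extension_at Mp AE).
  by apply: smooth_on_diff Up; exact: smooth_onD.
rewrite (second _ _ _ vY YE TX) (second _ _ _ vX XE TY).
rewrite (mdiffE (frame_bracket vX vY Mp) fE) /bracket.
rewrite (mdiffE TX YE) (mdiffE TY XE).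
rewrite (derive_comm (X p) (Y p) sf' Up) opprD addrACA subrr addr0.
by rewrite !(deriveE _ (df _ Up)) linearB.
Qed.

End Frame.

Arguments fe {R V M} _ _.
Arguments feps {R V M} _ _.
Arguments fE {R V M} _ _ _.
Arguments fE_span {R V M} _ {p v} _ _.
Arguments fE_field {R V M} _ _.

Section Fields.
Variables (R : realType) (V : normedModType R) (M : set V).
Implicit Type F : frame M.

Lemma vector_field0 : vector_field M (0 : V -> V).
Proof. by split=> [|p Mp]; [exact: (smooth_cst (0 : V))|exact: tangent0]. Qed.

Lemma vector_fieldD F X Y : vector_field M X -> vector_field M Y ->
  vector_field M (fun p => X p + Y p).
Proof.
move=> [sX TX] [sY TY]; split=> [|p Mp]; first exact: smoothD.
by apply: (frame_tangentD F) => //; [exact: TX|exact: TY].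
Qed.

Lemma vector_field_scale F (f : V -> R^o) X : smooth M f -> vector_field M X ->
  vector_field M (fun p => f p *: X p).
Proof.
move=> sf [sX TX]; split=> [|p Mp]; first exact: smooth_scale.
by apply: (frame_tangentZ F) => //; exact: TX.
Qed.

Lemma eq_vector_field X Y : (forall p, M p -> X p = Y p) ->
  vector_field M X -> vector_field M Y.
Proof.
move=> XY [sX TX]; split; first exact: eq_smooth sX.
by move=> p Mp; rewrite -XY//; exact: TX.
Qed.

(** Vector fields are normalized to vanish off [M], so that equality of fields
    is Leibniz equality. *)
Definition vf_pred F : {pred V -> V} :=
  fun X => `[< vector_field M X /\ forall p, ~ M p -> X p = 0 >].

Lemma vf_submod F : submod_closed (vf_pred F).
Proof.
split=> [|a X Y]; first by apply/asboolP; split=> //; exact: vector_field0.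
rewrite !unfold_in => /asboolP[vX X0] /asboolP[vY Y0]; apply/asboolP; split.
  apply: (vector_fieldD F) => //.
  exact: (vector_field_scale F (smooth_cst (a : R^o)) vX).
by move=> p Mp; rewrite !fctE X0// Y0// scaler0 addr0.
Qed.

HB.instance Definition _ F := GRing.isSubmodClosed.Build R (V -> V) (vf_pred F)
  (vf_submod F).

Record vfield F := VField { vfun :> V -> V; _ : vfun \in vf_pred F }.

HB.instance Definition _ F := [isSub for @vfun F].
HB.instance Definition _ F := [Choice of vfield F by <:].
HB.instance Definition _ F := [SubChoice_isSubLmodule of vfield F by <:].

Variable F : frame M.
Local Notation vf := (vfield F).

Lemma vfieldP (X : vf) : vector_field M X.
Proof. by case: X => X /= /asboolP[]. Qed.

Lemma vfield_off (X : vf) p : ~ M p -> X p = 0.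
Proof. by case: X => X /= /asboolP[_]; apply. Qed.

Lemma vfield_eq (X Y : vf) : (forall p, M p -> X p = Y p) -> X = Y.
Proof.
move=> XY; apply: val_inj; apply/funext => p /=.
by have [/XY//|nMp] := pselect (M p); rewrite !vfield_off.
Qed.

Lemma vfieldDE (X Y : vf) p : (X + Y) p = X p + Y p. Proof. by []. Qed.
Lemma vfieldNE (X : vf) p : (- X) p = - X p. Proof. by []. Qed.
Lemma vfieldZE a (X : vf) p : (a *: X) p = a *: X p. Proof. by []. Qed.
Lemma vfield0E p : (0 : vf) p = 0. Proof. by []. Qed.

Lemma vfield_sumE n (X : 'I_n -> vf) p : (\sum_i X i) p = \sum_i X i p.
Proof.
elim: n X => [|n IH] X; first by rewrite !big_ord0.
by rewrite !big_ord_recl vfieldDE IH.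
Qed.

(** [mkvf] and [der] below are sealed behind opaque witnesses: conversion must
    not compare the underlying limits. *)
Lemma mkvf_sig : {f : (V -> V) -> vf | forall X p,
  vector_field M X -> M p -> f X p = X p}.
Proof.
exists (fun X => insubd (0 : vf) (fun p => if `[< M p >] then X p else 0)).
move=> X p vX Mp; rewrite insubdK ?asboolT//; apply/asboolP; split.
  by apply: eq_vector_field vX => q Mq; rewrite asboolT.
by move=> q nMq; rewrite asboolF.
Qed.

Definition mkvf (X : V -> V) : vf := sval mkvf_sig X.

Lemma mkvfE X p : vector_field M X -> M p -> mkvf X p = X p.
Proof. exact: (svalP mkvf_sig X p). Qed.

Definition fscale (f : V -> R^o) (X : vf) : vf := mkvf (fun p => f p *: X p).

Lemma fscaleE f X p : smooth M f -> M p -> fscale f X p = f p *: X p.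
Proof.
move=> sf Mp; rewrite mkvfE//; apply: (vector_field_scale F) => //.
exact: vfieldP.
Qed.

Definition frame_field i : vf := mkvf (fE F i).
Definition coord (X : vf) i : V -> R^o := feps F i \o X.

Lemma frame_fieldE i p : M p -> frame_field i p = fE F i p.
Proof. by move=> Mp; rewrite mkvfE//; exact: fE_field. Qed.

Lemma coord_smooth X i : smooth M (coord X i).
Proof.
by apply: smooth_comp_lin; [exact: feps_continuous|exact: (vfieldP X).1].
Qed.

Lemma vfield_decomp (X : vf) : X = \sum_i fscale (coord X i) (frame_field i).
Proof.
apply: vfield_eq => p Mp; rewrite vfield_sumE.
rewrite {1}[X p](fE_span F Mp ((vfieldP X).2 _ Mp)).
by apply: eq_bigr => i _; rewrite fscaleE ?frame_fieldE//; exact: coord_smooth.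
Qed.

Definition field_of (v : V) : vf := \sum_i feps F i v *: frame_field i.

Lemma field_ofE v p : M p -> tangent M p v -> field_of v p = v.
Proof.
move=> Mp Tv; rewrite vfield_sumE {2}[v](fE_span F Mp Tv).
by apply: eq_bigr => i _; rewrite vfieldZE frame_fieldE.
Qed.

Implicit Types f g : V -> R^o.

Lemma der_sig : {d : vf -> (V -> R^o) -> V -> R^o | forall X f p,
  d X f p = if `[< M p >] then mdiff M f p (X p) else 0}.
Proof.
by exists (fun X f p => if `[< M p >] then mdiff M f p (X p) else 0).
Qed.

Definition der (X : vf) f : V -> R^o := sval der_sig X f.

Lemma derE X f p : M p -> der X f p = mdiff M f p (X p).
Proof. by move=> Mp; rewrite /der (svalP der_sig) asboolT. Qed.

Lemma der_smooth X f : smooth M f -> smooth M (der X f).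
Proof.
move=> sf; apply: (eq_smooth (f := fun p => mdiff M f p (X p))).
  by move=> p Mp; rewrite derE.
by apply: (smooth_der F) => //; exact: vfieldP.
Qed.

Lemma der_eq X f g : (forall p, M p -> f p = g p) -> smooth M f ->
  der X f = der X g.
Proof.
move=> fg sf; apply/funext => p; rewrite /der !(svalP der_sig); case: asboolP => // Mp.
by apply: eq_mdiff => //; exact: (vfieldP X).2.
Qed.

Lemma derD X f g p : smooth M f -> smooth M g -> M p ->
  der X (fun q => f q + g q) p = der X f p + der X g p.
Proof.
by move=> sf sg Mp; rewrite !derE//; apply: mdiffD => //; exact: (vfieldP X).2.
Qed.

Lemma derM X f g p : smooth M f -> smooth M g -> M p ->
  der X (fun q => f q * g q) p = der X f p * g p + f p * der X g p.
Proof.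
by move=> sf sg Mp; rewrite !derE//; apply: mdiff_scale => //; exact: (vfieldP X).2.
Qed.

Lemma der_cst X (a : R^o) p : M p -> der X (fun=> a) p = 0.
Proof. by move=> Mp; rewrite derE//; apply: mdiff_cst; exact: (vfieldP X).2. Qed.

Lemma smooth_fun_cst (a : R^o) : smooth M (fun=> a).
Proof. exact: smooth_cst. Qed.

Lemma derN X f p : smooth M f -> M p -> der X (fun q => - f q) p = - der X f p.
Proof.
move=> sf Mp; have -> : (fun q => - f q) = (fun q => (-1) * f q).
  by apply/funext => q; rewrite mulN1r.
by rewrite derM ?der_cst ?mul0r ?add0r ?mulN1r//; exact: smooth_fun_cst.
Qed.

Lemma bracket_field X Y : vector_field M X -> vector_field M Y ->
  vector_field M (bracket M X Y).
Proof.
move=> vX vY; split=> [|p Mp]; last exact: (frame_bracket F).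
apply: (smoothD (f := fun p => mdiff M Y p (X p))).
  by apply: (smooth_der F) => //; exact: vY.1.
have -> : (fun p => - mdiff M X p (Y p)) = fun p => (-1 : R^o) *: mdiff M X p (Y p).
  by apply/funext => q; rewrite scaleN1r.
apply: smooth_scale; first exact: smooth_fun_cst.
by apply: (smooth_der F) => //; exact: vX.1.
Qed.

Lemma vbracket_sig : {br : vf -> vf -> vf | forall X Y p, M p ->
  br X Y p = bracket M X Y p}.
Proof.
exists (fun X Y => mkvf (bracket M X Y)) => X Y p Mp.
by rewrite mkvfE//; apply: bracket_field; exact: vfieldP.
Qed.

Definition vbracket (X Y : vf) : vf := sval vbracket_sig X Y.

Lemma vbracketE X Y p : M p -> vbracket X Y p = bracket M X Y p.
Proof. exact: (svalP vbracket_sig). Qed.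

Lemma der_bracket X Y f p : smooth M f -> M p ->
  der (vbracket X Y) f p = der X (der Y f) p - der Y (der X f) p.
Proof.
move=> sf Mp; rewrite !derE// vbracketE//.
rewrite -(bracket_der F sf (vfieldP X) (vfieldP Y) Mp); congr (_ - _).
  apply: eq_mdiff => //; last exact: (vfieldP X).2.
  - by move=> q Mq; rewrite derE.
  - by apply: (smooth_der F) => //; exact: vfieldP.
apply: eq_mdiff => //; last exact: (vfieldP Y).2.
- by move=> q Mq; rewrite derE.
- by apply: (smooth_der F) => //; exact: vfieldP.
Qed.

(** A field is determined by the derivatives of the coordinate functions. *)
Lemma der_coord (X : vf) i p : M p -> der X (feps F i) p = coord X i p.
Proof.
move=> Mp; rewrite derE// mdiff_lin//; last exact: feps_continuous.
exact: (vfieldP X).2.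
Qed.

Lemma vfield_der_eq (X Y : vf) : (forall f p, smooth M f -> M p ->
  der X f p = der Y f p) -> X = Y.
Proof.
move=> XY; apply: vfield_eq => p Mp.
rewrite [X p](fe_basis F) [Y p](fe_basis F); apply: eq_bigr => i _; congr (_ *: _).
have E (Z : vf) : feps F i (Z p) = der Z (feps F i) p by rewrite der_coord.
rewrite (E X) (E Y); apply: XY => //.
by apply: smooth_lin; exact: feps_continuous.
Qed.

Lemma der_fieldD X Y f p : smooth M f -> M p ->
  der (X + Y) f p = der X f p + der Y f p.
Proof.
move=> sf Mp; rewrite !derE// vfieldDE -[X p]scale1r.
rewrite mdiff_dirP ?scale1r//; try exact: (vfieldP _).2.
by have := (vfieldP (X + Y)).2 p Mp.
Qed.

Lemma jacobi X Y Z : vbracket X (vbracket Y Z) + vbracket Y (vbracket Z X)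
  + vbracket Z (vbracket X Y) = 0.
Proof.
apply: vfield_der_eq => f p sf Mp.
have d0 : der 0 f p = 0 by have := der_fieldD 0 0 sf Mp; rewrite addr0 => h; lra.
have sN g : smooth M g -> smooth M (fun q => - g q).
  move=> sg; have -> : (fun q => - g q) = (fun q => (-1 : R^o) *: g q).
    by apply/funext => q; rewrite scaleN1r.
  by apply: smooth_scale => //; exact: smooth_fun_cst.
have br A B C : der (vbracket A (vbracket B C)) f p =
  der A (der B (der C f)) p - der A (der C (der B f)) p
  - (der B (der C (der A f)) p - der C (der B (der A f)) p).
  have s1 := der_smooth B (der_smooth C sf).
  have s2 := der_smooth C (der_smooth B sf).
  have h : der A (der (vbracket B C) f) =
      der A (fun q => der B (der C f) q + - der C (der B f) q).
    apply: der_eq; last exact: der_smooth.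
    by move=> q Mq; exact: der_bracket.
  have e1 := der_bracket A (vbracket B C) sf Mp.
  have e2 : der A (der (vbracket B C) f) p =
      der A (der B (der C f)) p + - der A (der C (der B f)) p.
    rewrite h; apply: (etrans (derD A s1 (sN _ s2) Mp)).
    by congr (_ + _); exact: derN.
  have e3 := der_bracket B C (der_smooth A sf) Mp.
  exact: (etrans e1 (congr2 (fun x y => x - y) e2 e3)).
rewrite (der_fieldD _ _ sf Mp).
rewrite (der_fieldD _ (vbracket Y _) sf Mp).
rewrite d0.
rewrite (br X Y Z).
rewrite (br Y Z X).
rewrite (br Z X Y).
ring.
Qed.

End Fields.

Arguments frame_field {R V M} F i.
Arguments field_of {R V M} F v.

Fact tensor_key : unit. Proof. exact: tt. Qed.

Section Hermitian.
Variables (R : realFieldType) (X : zmodType) (T : Type) (M : T -> Prop).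
Variables (ip : T -> X -> X -> R) (nab : X -> X -> X) (J : X -> X).

(** These three are locked: unification would otherwise unfold them whenever a
    difference of fields is expected. *)
Definition lie (U V : X) : X := locked_with tensor_key (nab U V - nab V U).

Definition riem (U V W : X) : X :=
  locked_with tensor_key (nab U (nab V W) - nab V (nab U W) - nab (lie U V) W).

Definition covJ (U V : X) : X := locked_with tensor_key (nab U (J V) - J (nab U V)).

Record metric_connection : Prop := {
  ipDl : forall p U V W, M p -> ip p (U + V) W = ip p U W + ip p V W;
  ipC : forall p U V, M p -> ip p U V = ip p V U;
  ip_sep : forall U V, (forall p W, M p -> ip p U W = ip p V W) -> U = V;
  nabDl : forall U V W, nab (U + V) W = nab U W + nab V W;
  nabDr : forall U V W, nab U (V + W) = nab U V + nab U W;
  nab_point : forall p U V W, M p -> (forall U', ip p U U' = 0) ->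
    ip p (nab U V) W = 0;
  nab_ip : forall U Y Z Y' Z', (forall p, M p -> ip p Y Z = ip p Y' Z') ->
    forall p, M p -> ip p (nab U Y) Z + ip p Y (nab U Z) =
                     ip p (nab U Y') Z' + ip p Y' (nab U Z') }.

Record hermitian : Prop := {
  JD : forall U V, J (U + V) = J U + J V;
  JJ : forall U, J (J U) = - U;
  J_ip : forall p U V, M p -> ip p (J U) (J V) = ip p U V;
  J_integrable : forall U V,
    lie (J U) (J V) - lie U V - J (lie (J U) V) - J (lie U (J V)) = 0 }.

Lemma lieE U V : lie U V = nab U V - nab V U.
Proof. by rewrite /lie locked_withE. Qed.

Lemma riemE U V W :
  riem U V W = nab U (nab V W) - nab V (nab U W) - nab (lie U V) W.
Proof. by rewrite /riem locked_withE. Qed.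

Lemma covJE U V : covJ U V = nab U (J V) - J (nab U V).
Proof. by rewrite /covJ locked_withE. Qed.

Hypotheses (HC : metric_connection) (HJ : hermitian).

Lemma additiveN (f : X -> X) : (forall U V, f (U + V) = f U + f V) ->
  forall U, f (- U) = - f U.
Proof.
move=> fD U; have f0 : f 0 = 0 by apply: (addrI (f 0)); rewrite -fD !addr0.
by apply: (addrI (f U)); rewrite -fD !subrr f0.
Qed.

Lemma ip0l p W : M p -> ip p 0 W = 0.
Proof. by move=> Mp; apply: (addrI (ip p 0 W)); rewrite -(ipDl HC)// !addr0. Qed.

Lemma ipNl p U W : M p -> ip p (- U) W = - ip p U W.
Proof.
move=> Mp; apply: (addrI (ip p U W)).
by rewrite -(ipDl HC)// !subrr ip0l.
Qed.

Lemma ipBl p U V W : M p -> ip p (U - V) W = ip p U W - ip p V W.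
Proof. by move=> Mp; rewrite (ipDl HC)// ipNl. Qed.

Lemma ipDr p U V W : M p -> ip p W (U + V) = ip p W U + ip p W V.
Proof. by move=> Mp; rewrite (ipC HC)// (ipDl HC)// !(ipC HC _ W). Qed.

Lemma ipNr p U W : M p -> ip p W (- U) = - ip p W U.
Proof. by move=> Mp; rewrite (ipC HC)// ipNl// (ipC HC). Qed.

Lemma nabNl U W : nab (- U) W = - nab U W.
Proof. by apply: (additiveN (f := nab^~ W)) => A B; exact: (nabDl HC). Qed.

Lemma nabNr U W : nab U (- W) = - nab U W.
Proof. by apply: (additiveN (f := nab U)) => A B; exact: (nabDr HC). Qed.

Lemma JN U : J (- U) = - J U.
Proof. by apply: additiveN; exact: (JD HJ). Qed.

Lemma covJDl U V W : covJ (U + V) W = covJ U W + covJ V W.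
Proof. by rewrite !covJE !(nabDl HC) (JD HJ) opprD addrACA. Qed.

Lemma covJDr U V W : covJ W (U + V) = covJ W U + covJ W V.
Proof. by rewrite !covJE (JD HJ) !(nabDr HC) (JD HJ) opprD addrACA. Qed.

Lemma covJNr U W : covJ W (- U) = - covJ W U.
Proof. by apply: (additiveN (f := covJ W)) => A B; exact: covJDr. Qed.

Lemma nabJ U V : nab U (J V) = J (nab U V) + covJ U V.
Proof. by rewrite !covJE addrC subrK. Qed.

Lemma J_skew p U V : M p -> ip p (J U) V = - ip p U (J V).
Proof. by move=> Mp; rewrite -(J_ip HJ)// (JJ HJ) ipNl. Qed.

Lemma covJ_J U V : covJ U (J V) = - J (covJ U V).
Proof. by rewrite !covJE (JJ HJ) nabNr (JD HJ) JN (JJ HJ) !opprD !opprK addrC. Qed.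

Lemma covJ_skew p U V W : M p -> ip p (covJ U V) W = - ip p V (covJ U W).
Proof.
move=> Mp.
have /(nab_ip HC U)/(_ _ Mp) : forall q, M q -> ip q (J V) W = ip q (- V) (J W).
  by move=> q Mq; rewrite J_skew// ipNl.
rewrite !covJE !ipDr// !ipNr// !ipBl// nabNr !ipNl// !(J_skew _ _ Mp).
by move=> h; lra.
Qed.

Lemma integrable_covJ U V :
  covJ (J U) V - J (covJ U V) = covJ (J V) U - J (covJ V U).
Proof.
apply: (ip_sep HC) => p W Mp.
have := congr1 (fun x => ip p x W) (J_integrable HJ U V).
rewrite ip0l// !lieE !nabJ !(JD HJ, JN, JJ HJ) !(ipDl HC, ipNl)//.
by move=> h; lra.
Qed.

(** The tensor [covJ (J U) V - J (covJ U V)] is symmetric in its two arguments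
    by integrability and skew-adjoint in the last one, hence zero. *)
Lemma covJ_Jl U V : covJ (J U) V = J (covJ U V).
Proof.
pose B U V := covJ (J U) V - J (covJ U V).
have BC U' V' : B U' V' = B V' U' by exact: integrable_covJ.
have Bs p U' V' W : M p -> ip p (B U' V') W = - ip p (B U' W) V'.
  move=> Mp; rewrite /B !ipBl// !J_skew//.
  have h1 := covJ_skew (J U') V' W Mp.
  have h2 := covJ_skew U' V' (J W) Mp.
  have h3 := J_skew (covJ U' W) V' Mp.
  rewrite covJ_J ipNr// (ipC HC V')// in h2; rewrite (ipC HC V')// in h1; lra.
suff : B U V = 0 by move=> /eqP; rewrite subr_eq0 => /eqP.
apply: (ip_sep HC) => p W Mp.
rewrite ip0l//.
have h1 := Bs p U V W Mp; have h2 := Bs p W U V Mp; have h3 := Bs p V W U Mp.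
rewrite (BC U W) in h1; rewrite (BC W V) in h2; rewrite (BC V U) in h3; lra.
Qed.

Ltac zmod := apply: (ip_sep HC) => ? ? ?;
  rewrite ?(ipDl HC, ipNl, ip0l)//; ring.

Lemma nab_comm U V W : nab U (nab V W) =
  nab V (nab U W) + riem U V W + nab (lie U V) W.
Proof. rewrite riemE; zmod. Qed.

(** The operators [nab U - nab (J U) J] commute with [J]: they are covariant
    derivatives along (1,0)-vectors acting on (1,0)-vectors. *)
Definition nab10 (U V : X) : X := nab U V - nab (J U) (J V).

Lemma nab10_J U V : nab10 U (J V) = J (nab10 U V).
Proof.
rewrite /nab10 (JJ HJ) nabNr [in RHS](JD HJ) JN !nabJ covJ_Jl (JD HJ) !(JJ HJ).
zmod.
Qed.

Lemma nab10_nab10 U V W : nab10 U (nab10 V W) =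
  nab U (nab V W) - nab U (nab (J V) (J W)) - nab (J U) (nab V (J W))
  - nab (J U) (nab (J V) W).
Proof.
rewrite /nab10 !(JD HJ, JN, nabDr HC, nabNr).
have -> : J (nab V W) = nab V (J W) - covJ V W by rewrite nabJ; zmod.
have -> : J (nab (J V) (J W)) = - nab (J V) W - covJ V W.
  by rewrite [nab (J V) (J W)]nabJ covJ_Jl (JD HJ) !(JJ HJ).
rewrite !(nabDr HC, nabNr); zmod.
Qed.

Definition riem10 (U V W : X) : X :=
  riem U V W - riem (J U) (J V) W - riem (J U) V (J W) - riem U (J V) (J W).

Lemma riem10E U V W : riem10 U V W =
  nab10 U (nab10 V W) - nab10 V (nab10 U W)
  - nab10 (lie U V - lie (J U) (J V)) W.
Proof.
rewrite !nab10_nab10 /nab10 /riem10.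
have -> : J (lie U V - lie (J U) (J V)) = lie U (J V) + lie (J U) V.
  have -> : lie U V - lie (J U) (J V) = - J (lie (J U) V) - J (lie U (J V)).
    by apply/eqP; rewrite -subr_eq0 -oppr_eq0 -(J_integrable HJ U V); apply/eqP; zmod.
  by rewrite !(JD HJ, JN, JJ HJ); zmod.
rewrite !riemE !(nabDl HC, nabNl); zmod.
Qed.

Lemma riem10_J U V W : riem10 U V (J W) = J (riem10 U V W).
Proof. by rewrite !riem10E !nab10_J !(JD HJ, JN). Qed.

(** The curvature of a Hermitian metric preserves (1,0)-vectors when it is
    evaluated on two (1,0)-vectors; (1,0)-vectors being isotropic, its component
    along a fourth one vanishes. *)
Lemma gray p U V : M p ->
  ip p (riem U V V) U - ip p (riem (J U) (J V) V) U - ip p (riem (J U) V (J V)) U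
  - ip p (riem U (J V) (J V)) U =
  ip p (riem U V (J V)) (J U) - ip p (riem (J U) (J V) (J V)) (J U)
  + ip p (riem (J U) V V) (J U) + ip p (riem U (J V) V) (J U).
Proof.
move=> Mp; have : ip p (riem10 U V V) U = ip p (riem10 U V (J V)) (J U).
  by rewrite riem10_J (J_ip HJ).
have riemNr A B C : riem A B (- C) = - riem A B C.
  by rewrite !riemE !nabNr; zmod.
rewrite /riem10 !(JJ HJ) !riemNr !(ipBl _ _ _ Mp) !(ipNl _ _ Mp) => e.
by rewrite e !opprK.
Qed.

Lemma nab_covJ_swap U V W :
  nab U (covJ V W) - covJ V (nab U W) - (nab V (covJ U W) - covJ U (nab V W)) =
  riem U V (J W) - J (riem U V W) + covJ (lie U V) W.
Proof.
rewrite !covJE !riemE !(nabDr HC, nabNr, JD HJ, JN); zmod.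
Qed.

Section ConstantCurvature.
Variable k : R.
Hypothesis curv : forall p U V W Z, M p ->
  ip p (riem U V W) Z = k * (ip p V W * ip p U Z - ip p U W * ip p V Z).

Lemma riem_JX U V : riem (J U) U (J V) = J (riem (J U) U V).
Proof.
apply: (ip_sep HC) => p W Mp; rewrite J_skew// !curv// !J_skew//.
rewrite !(JJ HJ) !ipNr//; ring.
Qed.

Section Field.
Variable x : X.
Variables (a D1 D2 b cz nz rx : X -> X).
Hypotheses (aE : forall V, a V = covJ x V) (D1E : forall V, D1 V = nab x V)
  (D2E : forall V, D2 V = nab (J x) V) (bE : forall V, b V = D1 (a V) - a (D1 V))
  (czE : forall V, cz V = covJ (lie (J x) x) V)
  (nzE : forall V, nz V = nab (lie (J x) x) V)
  (rxE : forall V, rx V = riem (J x) x V).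

Let D1D V W : D1 (V + W) = D1 V + D1 W. Proof. by rewrite !D1E (nabDr HC). Qed.
Let D2D V W : D2 (V + W) = D2 V + D2 W. Proof. by rewrite !D2E (nabDr HC). Qed.
Let D1N V : D1 (- V) = - D1 V. Proof. by rewrite !D1E nabNr. Qed.
Let D2N V : D2 (- V) = - D2 V. Proof. by rewrite !D2E nabNr. Qed.
Let nzD V W : nz (V + W) = nz V + nz W. Proof. by rewrite !nzE (nabDr HC). Qed.
Let nzN V : nz (- V) = - nz V. Proof. by rewrite !nzE nabNr. Qed.
Let aD V W : a (V + W) = a V + a W. Proof. by rewrite !aE covJDr. Qed.
Let aN V : a (- V) = - a V. Proof. by rewrite !aE covJNr. Qed.
Let czD V W : cz (V + W) = cz V + cz W. Proof. by rewrite !czE covJDr. Qed.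
Let czN V : cz (- V) = - cz V. Proof. by rewrite !czE covJNr. Qed.
Let rxD V W : rx (V + W) = rx V + rx W.
Proof. rewrite !rxE !riemE !(nabDr HC); zmod. Qed.
Let rxN V : rx (- V) = - rx V.
Proof. by apply: (additiveN (f := rx)) => A B; exact: rxD. Qed.
Let bD V W : b (V + W) = b V + b W.
Proof. rewrite !bE aD !D1D aD; zmod. Qed.
Let bN V : b (- V) = - b V.
Proof. by apply: (additiveN (f := b)) => A B; exact: bD. Qed.
Let aJ V : a (J V) = - J (a V). Proof. by rewrite !aE covJ_J. Qed.
Let D1J V : D1 (J V) = J (D1 V) + a V. Proof. by rewrite !D1E aE nabJ. Qed.
Let D2J V : D2 (J V) = J (D2 V) + J (a V).
Proof. by rewrite !D2E aE nabJ covJ_Jl. Qed.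
Let lin := (D1D, D2D, D1N, D2N, nzD, nzN, aD, aN, czD, czN, rxD, rxN, bD, bN,
  JD HJ, JN, aJ, JJ HJ).

Let D1a V : D1 (a V) = a (D1 V) + b V.
Proof. rewrite bE; zmod. Qed.

Let bJ V : b (J V) = - J (b V) - a (a V) - a (a V).
Proof. rewrite bE aJ D1N !D1J bE !lin; zmod. Qed.

Let D2D1 V : D2 (D1 V) = D1 (D2 V) + rx V + nz V.
Proof. by rewrite !D2E !D1E rxE nzE nab_comm. Qed.

Let D2a V : D2 (a V) = a (D2 V) + J (b V) + a (a V) + cz V.
Proof.
have := nab_covJ_swap (J x) x V; rewrite riem_JX subrr add0r !covJ_Jl.
rewrite -!aE -!D2E -!D1E -czE D1J D1a => <-; rewrite !lin; zmod.
Qed.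

Let D2b V : D2 (b V) = b (D2 V) + J (D1 (b V)) + a (b V) + a (b V) + b (a V)
  + D1 (cz V) + rx (a V) + nz (a V) - a (rx V) - a (nz V) - J (b (D1 V))
  - cz (D1 V).
Proof.
have -> : D2 (b V) = D2 (D1 (a V)) - D2 (a (D1 V)) by rewrite bE D2D D2N.
rewrite D2D1 !D2a D2D1 !(D1J, D1a, lin); zmod.
Qed.

(** Only the curvature and tensors of order at most one in [covJ] survive:
    the second derivatives of [a] along [x] and [J x] cancel, since [a] is
    holomorphic along the complex curve directions up to lower order. *)
Lemma laplace_covJ V : D1 (D1 (a V)) + D2 (D2 (a V)) =
  a (D1 (D1 V) + D2 (D2 V)) + b (D1 V) + b (D1 V) + J (b (D2 V)) + J (b (D2 V))
  + a (a (D2 V)) + a (a (D2 V)) + cz (D2 V) - J (cz (D1 V))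
  + J (a (b V)) + J (a (b V)) + J (b (a V)) + J (b (a V))
  + a (a (a V)) + a (a (a V)) + cz (a V) + a (cz V)
  + D2 (cz V) + J (D1 (cz V)) + J (rx (a V)) - J (a (rx V))
  + J (nz (a V)) - J (a (nz V)).
Proof.
rewrite !(D1a, D2a, D2J, D2b, lin); zmod.
Qed.

End Field.
Section Critical.
Variables (p : T) (Mp : M p) (x w z : X) (l : R).
Variables (a D1 D2 b cz nz rx : X -> X).
Hypotheses (aE : forall V, a V = covJ x V) (D1E : forall V, D1 V = nab x V)
  (D2E : forall V, D2 V = nab (J x) V) (bE : forall V, b V = D1 (a V) - a (D1 V))
  (czE : forall V, cz V = covJ (lie (J x) x) V)
  (nzE : forall V, nz V = nab (lie (J x) x) V)
  (rxE : forall V, rx V = riem (J x) x V).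
Hypotheses (wE : w = covJ x x) (z_lie : z = lie (J x) x).
Hypotheses (xx : ip p x x = 1) (ww : ip p w w = l)
  (nabx : forall U V, ip p (nab U x) V = 0)
  (nabw : forall U, ip p (nab U w) w = 0)
  (critx : forall U, ip p (covJ U x) w + ip p (covJ x U) w = 2 * l * ip p U x)
  (aw : forall V, ip p (covJ x w) V = - l * ip p x V).

Let skewJ U V : ip p (J U) V = - ip p U (J V). Proof. exact: J_skew. Qed.
Let skewA U V W : ip p (covJ U V) W = - ip p V (covJ U W).
Proof. exact: covJ_skew. Qed.
Let sym U V : ip p U V = ip p V U. Proof. exact: (ipC HC). Qed.
Let ipD U V W : ip p (U + V) W = ip p U W + ip p V W.
Proof. exact: (ipDl HC). Qed.
Let ipN U W : ip p (- U) W = - ip p U W. Proof. exact: ipNl. Qed.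
Let ip0 W : ip p 0 W = 0. Proof. exact: ip0l. Qed.

Let nab_orth U Y Z : (forall q, M q -> ip q Y Z = 0) ->
  ip p (nab U Y) Z = - ip p Y (nab U Z).
Proof.
move=> YZ0; have : forall q, M q -> ip q Y Z = ip q 0 Z.
  by move=> q Mq; rewrite YZ0// ip0l.
move=> /(nab_ip HC U)/(_ _ Mp); rewrite ip0.
have -> : nab U 0 = 0 by rewrite -[X in nab _ X](subrr x) (nabDr HC) nabNr subrr.
by rewrite ip0 => h; lra.
Qed.

Let wx q : M q -> ip q w x = 0.
Proof. by move=> Mq; have := covJ_skew x x x Mq; rewrite (ipC HC x)// -wE => h; lra. Qed.

Let wJx q : M q -> ip q w (J x) = 0.
Proof.
move=> Mq; have := covJ_skew x x (J x) Mq.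
rewrite covJ_J ipNr// opprK (ipC HC x)// J_skew// -wE => h; lra.
Qed.

Let xJx : ip p x (J x) = 0.
Proof. by have := skewJ x x; rewrite (sym (J x)) => h; lra. Qed.

Let wJw : ip p w (J w) = 0.
Proof. by have := skewJ w w; rewrite (sym (J w)) => h; lra. Qed.

Let covw U : ip p (covJ U x) w = l * ip p U x.
Proof.
by have := critx U; rewrite (skewA x U) (sym U) aw (sym x) => h; lra.
Qed.

Let Jcovw U : ip p (J (covJ U x)) w = l * ip p (J U) x.
Proof. by rewrite -covJ_Jl covw. Qed.

Let zw V : ip p (z + w) V = 0.
Proof.
rewrite z_lie lieE nabJ -wE; have -> : nab (J x) x - (J (nab x x) + w) + w =
  nab (J x) x - J (nab x x) by zmod.
by rewrite ipD ipN skewJ !nabx; lra.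
Qed.

Let zE V : ip p z V = - ip p w V.
Proof. by have := zw V; rewrite ipD => h; lra. Qed.

Let aJ V : a (J V) = - J (a V). Proof. by rewrite !aE covJ_J. Qed.

Let b_skew U V : ip p (b U) V = - ip p U (b V).
Proof.
rewrite !bE !(ipDr, ipNr)// !(ipD, ipN) !aE !D1E.
have /(nab_ip HC x)/(_ _ Mp) : forall q, M q -> ip q (covJ x U) V = ip q (- U) (covJ x V).
  by move=> q Mq; rewrite ipNl// covJ_skew.
rewrite nabNr !ipN; have := skewA x (nab x U) V; have := skewA x U (nab x V).
by move=> h1 h2 h3; lra.
Qed.

Let bJ V : b (J V) = - J (b V) - a (a V) - a (a V).
Proof.
rewrite !bE !D1E !aE covJ_J nabNr !nabJ !(covJDr, covJNr, JD HJ, JN, covJ_J); zmod.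
Qed.

Let bxJx : ip p (b x) (J x) = - l.
Proof.
have wa : a x = w by rewrite aE wE.
have := congr1 (fun U => ip p U x) (bJ x); rewrite wa !(ipD, ipN).
have := b_skew (J x) x; have := skewJ (b x) x; have := sym (J x) (b x).
have := skewA x w x; rewrite -wE ww -aE => h1 h2 h3 h4 h5; lra.
Qed.

Let awaw : ip p (a w) (a w) = l * l.
Proof. by rewrite !aE aw; have := skewA x x w; rewrite -wE ww => h; rewrite -[ip p x _]opprK -h; ring. Qed.

Let bwJw : ip p (b w) (J w) = - (l * l).
Proof.
have := congr1 (fun U => ip p U w) (bJ w); rewrite !(ipD, ipN).
have := b_skew (J w) w; have := skewJ (b w) w; have := sym (J w) (b w).
have := skewA x (a w) w; rewrite -!aE awaw => h1 h2 h3 h4 h5; lra.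
Qed.

Let cov0 U V W : ip p (covJ U (nab V x)) W = 0.
Proof. by rewrite skewA nabx oppr0. Qed.

Let J_cov0 U V W : ip p (J (covJ U (nab V x))) W = 0.
Proof. by rewrite skewJ cov0 oppr0. Qed.

Let cov_x U : ip p (covJ U x) x = 0.
Proof. by have := skewA U x x; rewrite (sym x) => h; lra. Qed.

Let a_cov U : ip p (covJ x (covJ U x)) w = 0.
Proof. by rewrite skewA sym aw (sym x) cov_x; lra. Qed.

Let wx0 : ip p w x = 0. Proof. exact: wx. Qed.
Let wJx0 : ip p w (J x) = 0. Proof. exact: wJx. Qed.
Let xJw : ip p x (J w) = 0.
Proof. by rewrite sym skewJ wJx0 oppr0. Qed.
Let ips := (xJw, skewJ, JJ HJ, ipN, fun U V => ipNr U V Mp, xx, ww, xJx, wJw, wx0, wJx0,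
  sym x w).

Let D2wx : ip p (nab (J x) w) x = 0.
Proof. by rewrite nab_orth// sym nabx oppr0. Qed.

Let D1wJx : ip p (nab x w) (J x) = - l.
Proof. by rewrite nab_orth// nabJ -wE ipDr// ww sym skewJ nabx; lra. Qed.

Let nabww : ip p (J (nab w w)) w = - (l * l).
Proof.
have := congr1 (fun U => ip p U w) (nab_covJ_swap (J w) x x).
have := congr1 (fun U => ip p (J U) w) (nab_covJ_swap x w x).
rewrite covJ_Jl nabJ !(JD HJ, JN, JJ HJ) !(ipD, ipN) -wE !cov0 !J_cov0 nabw a_cov.
rewrite !covw !Jcovw !lieE !(JD HJ, JN) nabJ !(ipD, ipN) -aE.
have -> : ip p (a w) x = - l by rewrite aE aw xx; lra.
rewrite ?nabx.
have -> : ip p (J (nab x w)) x = l by rewrite skewJ D1wJx opprK.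
have -> : ip p (J (nab w x)) x = 0 by rewrite skewJ nabx oppr0.
rewrite !skewJ !curv// !ips => h1 h2.
lra.
Qed.

Let nab_z U V : ip p (nab z U) V = - ip p (nab w U) V.
Proof.
have : ip p (nab (z + w) U) V = 0 by exact: (nab_point HC).
by rewrite (nabDl HC) ipD => h; lra.
Qed.

Let lie_z : ip p (lie (J x) z) x - ip p (lie x z) (J x) =
  ip p (nab x (nab x x) + nab (J x) (nab (J x) x)) x + k - l.
Proof.
have zJ : z = nab (J x) x - J (nab x x) - w by rewrite z_lie lieE nabJ wE; zmod.
have h := nab_comm (J x) x x; rewrite -z_lie in h.
have h1 : ip p (nab z (J x)) x = 0.
  by rewrite nabJ ipD skewJ nabx cov_x; lra.
rewrite !lieE !(ipD, ipN) h1 nabx {1 2}zJ !(nabDr HC, nabNr) !nabJ.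
rewrite h !(JD HJ) !(ipD, ipN) !covJ_Jl !J_cov0 !cov0 D2wx D1wJx !skewJ !(JJ HJ).
rewrite nabx !curv// !ips; lra.
Qed.

Let cz_terms : ip p (nab (J x) (covJ z x)) w + ip p (J (nab x (covJ z x))) w
  + ip p (J (nab z w)) w = 2 * k * l + 3 * (l * l) +
  l * (ip p (nab x (nab x x) + nab (J x) (nab (J x) x)) x + k - l).
Proof.
have h1 := congr1 (fun U => ip p U w) (nab_covJ_swap (J x) z x).
have h2 := congr1 (fun U => ip p (J U) w) (nab_covJ_swap x z x).
move: (congr1 ( *%R l) lie_z) nabww h1 h2.
rewrite covJ_Jl nabJ !(JD HJ, JN, JJ HJ) !(ipD, ipN) -wE !cov0 !J_cov0.
rewrite !covw !Jcovw !skewJ !curv// !ips !nab_z.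
have -> : ip p (covJ z w) w = 0 by have := skewA z w w; rewrite sym => h; lra.
rewrite !zE !ips => h1 h2 h3 h4.
lra.
Qed.

(** The zeroth-order terms of [laplace_covJ] balance each other out, and the
    curvature contributes [2 * k * l]. *)
Lemma laplace_covJ_crit :
  ip p (nab x (nab x w) + nab (J x) (nab (J x) w)) w =
  2 * l * ip p (nab x (nab x x) + nab (J x) (nab (J x) x)) x + 2 * k * l.
Proof.
have wa : a x = w by rewrite aE wE.
have := congr1 (fun U => ip p U w) (laplace_covJ aE D1E D2E bE czE nzE rxE x).
rewrite ipD !wa.
have b0 V W : (forall U, ip p V U = 0) -> ip p (b V) W = 0.
  by move=> V0; rewrite b_skew V0 oppr0.
have Jb0 V W : (forall U, ip p V U = 0) -> ip p (J (b V)) W = 0.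
  by move=> V0; rewrite skewJ b0 ?oppr0.
have e1 : ip p (b (D1 x)) w = 0 by apply: b0 => U; rewrite D1E nabx.
have e2 : ip p (J (b (D2 x))) w = 0 by apply: Jb0 => U; rewrite D2E nabx.
have e3 : ip p (J (a (b x))) w = - (l * l).
  have := skewA x (b x) (J w); rewrite -!aE => h.
  have : ip p (b x) (a (J w)) = - ip p (b x) (J (a w)).
    by rewrite !aE covJ_J ipNr.
  have := skewJ (b x) (a w); have := ipC HC (J (b x)) (a w) Mp.
  have xJb : ip p x (J (b x)) = l by rewrite sym skewJ bxJx opprK.
  rewrite [X in ip p X (J (b x))]aE aw xJb => h1 h2 h3.
  by rewrite skewJ; lra.
have e4 : ip p (J (b w)) w = l * l by rewrite skewJ bwJw opprK.
have e5 : ip p (a (a w)) w = - (l * l).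
  by have := skewA x (a w) w; rewrite -!aE awaw.
have e6 : ip p (cz w) w = 0.
  by have := skewA (lie (J x) x) w w; rewrite -!czE sym => h; lra.
have e7 : ip p (a (cz x)) w = 0 by rewrite aE czE a_cov.
have e8 : ip p (J (a (nz x))) w = 0 by rewrite aE nzE J_cov0.
have e9 : ip p (a (D1 (D1 x) + D2 (D2 x))) w = l * ip p (D1 (D1 x) + D2 (D2 x)) x.
  by rewrite aE skewA sym aw sym; lra.
have e10 : ip p (J (rx w)) w = 0.
  by rewrite skewJ rxE curv// !ips; lra.
have e11 : ip p (J (a (rx x))) w = k * l.
  have := skewJ (a (rx x)) w; have := skewA x (rx x) (J w).
  have := skewJ x (rx x); have := sym (rx x) (J (a w)).
  have := skewJ (a w) (rx x); have := aw (J (rx x)).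
  rewrite -!aE !aJ !ipNr//; have := sym (rx x) (J x).
  rewrite rxE curv// !ips => h1 h2 h3 h4 h5 h6 h7; nra.
have e12 : ip p (a (a (D2 x))) w = 0.
  by rewrite aE skewA sym aw sym aE skewA D2E nabx; ring.
have e13 : ip p (cz (D2 x)) w = 0 by rewrite czE D2E cov0.
have e14 : ip p (J (cz (D1 x))) w = 0 by rewrite czE D1E J_cov0.
move: cz_terms; rewrite -!D1E -!D2E z_lie -!czE -!nzE => h15 h16.
move: h16 h15; rewrite !(ipD, ipN) e9 ipD => h16 h15; lra.
Qed.


End Critical.
(** If [covJ U U = 0] then [covJ] is totally skew, and [J] can be moved between
    any two slots at the cost of a sign; moving it around three slots gives
    [covJ = 0]. *)
Lemma nearly_kahler_kahler : (forall U, covJ U U = 0) -> forall U V, covJ U V = 0.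
Proof.
move=> c0 U V; apply: (ip_sep HC) => p W Mp; rewrite ip0l//.
have cC A B : covJ A B = - covJ B A.
  have := c0 (A + B); rewrite covJDl !covJDr !c0 add0r addr0 => /eqP.
  by rewrite addr_eq0 => /eqP.
pose t A B C := ip p (covJ A B) C.
have t12 A B C : t A B C = - t B A C by rewrite /t cC ipNl.
have t23 A B C : t A B C = - t A C B by rewrite /t covJ_skew// (ipC HC).
have tJ A B C : t (J A) B C = - t A (J B) C.
  by rewrite /t covJ_Jl covJ_J ipNl// opprK.
have h1 A B C : t (J A) B C = - t A B (J C).
  by have := t23 (J A) B C; have := tJ A C B; have := t23 A B (J C); lra.
have h2 A B C : t A (J B) C = - t A B (J C).
  by have := t12 A (J B) C; have := h1 B A C; have := t12 A B (J C); lra.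
have h A B C : t (J A) B C = 0.
  by have := tJ A B C; have := h1 A B C; have := h2 A B C => e1 e2 e3; lra.
have -> : U = J (- J U) by rewrite JN (JJ HJ) opprK.
exact: h.
Qed.

Lemma kahler_flat : (forall U V, covJ U V = 0) -> forall p U V, M p ->
  ip p U V = 0 -> ip p U (J V) = 0 -> k * (ip p U U * ip p V V) = 0.
Proof.
move=> c0 p U V Mp UV UJV.
have := nab_covJ_swap U V V; rewrite !c0 addr0.
have nab0 A : nab A 0 = 0 by rewrite -[X in nab _ X](subrr U) (nabDr HC) nabNr subrr.
rewrite !nab0 !subr0 => /(congr1 (fun A => ip p A (J U))).
rewrite ip0l// ipBl// J_skew// !curv// (JJ HJ) !ipNr// (ipC HC V U)// UV UJV.
by have := J_skew V V Mp; rewrite (ipC HC (J V))// => h1 h2; nra.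
Qed.

End ConstantCurvature.
End Hermitian.

(** An algebraic curvature tensor is determined by its sectional curvatures. *)
Lemma curvature_like_eq0 (R : realFieldType) (X : zmodType)
    (S : X -> X -> X -> X -> R) :
  (forall x x' y z t, S (x + x') y z t = S x y z t + S x' y z t) ->
  (forall x y z t, S x y z t = - S y x z t) ->
  (forall x y z t, S x y z t = - S x y t z) ->
  (forall x y z t, S x y z t + S y z x t + S z x y t = 0) ->
  (forall x y, S x y y x = 0) ->
  forall x y z t, S x y z t = 0.
Proof.
move=> SD S12 S34 B S0.
have pair x y z t : S x y z t = S z t x y.
  have := B x y z t; have := B y z t x; have := B z t x y; have := B t x y z.
  rewrite (S12 z x) (S34 y z t) (S34 z t y) (S12 t y) (S34 y t z) (S12 t x z).
  rewrite (S34 x t z) (S34 x z t) (S12 t x y) (S34 x y t) => *; lra.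
have SD2 x y y' z t : S x (y + y') z t = S x y z t + S x y' z t.
  by rewrite S12 SD !(S12 x) opprD.
have SD3 x y z z' t : S x y (z + z') t = S x y z t + S x y z' t.
  by rewrite pair SD !(pair x y).
have S1 x y z : S x y z x = 0.
  have := S0 x (y + z); rewrite SD2 !SD3 !S0 add0r addr0.
  have := pair x y z x; have := S12 z x x y; have := S34 x z x y => h1 h2 h3 h4.
  lra.
have SD4 x y z t t' : S x y z (t + t') = S x y z t + S x y z t'.
  by rewrite S34 SD3 opprD -!S34.
have S14 x y z t : S x y z t = - S t y z x.
  by have := S1 (x + t) y z; rewrite SD !SD4 !S1 => h; lra.
have cyc x y z t : S y z x t = S x y z t.
  by rewrite (S14 x) (S34 t) opprK (S14 t) (S12 z) opprK.
move=> x y z t; have := B x y z t; have := cyc x y z t; have := cyc y z x t.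
by move=> *; lra.
Qed.

Section LeviCivita.
Variables (R : realType) (V : normedModType R) (M : set V) (F : frame M).
Local Notation vf := (vfield F).
Variable g : V -> V -> V -> R.
Implicit Types (X Y Z U W : vf) (f : V -> R^o).

Definition ip (p : V) X Y : R := g p (X p) (Y p).

Record levi_civita_field (nab : vf -> vf -> vf) : Prop := {
  lc_addl : forall X Y Z, nab (X + Y) Z = nab X Z + nab Y Z;
  lc_addr : forall X Y Z, nab X (Y + Z) = nab X Y + nab X Z;
  lc_scalel : forall f X Y, smooth M f -> nab (fscale f X) Y = fscale f (nab X Y);
  lc_leibniz : forall f X Y, smooth M f ->
    nab X (fscale f Y) = fscale (der X f) Y + fscale f (nab X Y);
  lc_torsion : forall X Y, nab X Y - nab Y X = vbracket X Y;
  lc_metric : forall X Y Z p, M p ->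
    der X (fun q => ip q Y Z) p = ip p (nab X Y) Z + ip p Y (nab X Z) }.

Hypothesis (HG : riemannian_metric M g).

Lemma tangentP X p : M p -> tangent M p (X p).
Proof. by move=> Mp; exact: (vfieldP X).2. Qed.

Lemma ipD p X Y Z : M p -> ip p (X + Y) Z = ip p X Z + ip p Y Z.
Proof.
move=> Mp; have := metric_linear HG 1 Mp (tangentP X Mp) (tangentP Y Mp) (tangentP Z Mp).
by rewrite scale1r mul1r.
Qed.

Lemma ip_sym p X Y : M p -> ip p X Y = ip p Y X.
Proof. by move=> Mp; rewrite /ip (Defs.metric_sym HG Mp (tangentP X Mp) (tangentP Y Mp)). Qed.

Lemma metric0l p v : M p -> tangent M p v -> g p 0 v = 0.
Proof.
move=> Mp Tv; have T0 := tangent0 Mp.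
by have := metric_linear HG 1 Mp T0 T0 Tv; rewrite scaler0 addr0 => h; lra.
Qed.

Lemma metricZ p a u v : M p -> tangent M p u -> tangent M p v ->
  g p (a *: u) v = a * g p u v.
Proof.
move=> Mp Tu Tv; have := metric_linear HG a Mp Tu (tangent0 Mp) Tv.
by rewrite addr0 metric0l// addr0.
Qed.

Lemma metric_sum n p (a : 'I_n -> R) (u : 'I_n -> V) v : M p ->
  (forall i, tangent M p (u i)) -> tangent M p v ->
  g p (\sum_i a i *: u i) v = \sum_i a i * g p (u i) v.
Proof.
move=> Mp Tu Tv; elim: n a u Tu => [|n IH] a u Tu.
  by rewrite !big_ord0 metric0l.
rewrite !big_ord_recl (metric_linear HG _ Mp)// ?IH//.
by apply: (frame_tangent_sum F) => // i; exact: (frame_tangentZ F).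
Qed.

Lemma ip_scale p f X Y : smooth M f -> M p -> ip p (fscale f X) Y = f p * ip p X Y.
Proof.
move=> sf Mp; rewrite /ip fscaleE//; apply: metricZ => //; exact: tangentP.
Qed.

Lemma ip_smooth X Y : smooth M (fun p => ip p X Y : R^o).
Proof. exact: (metric_smooth HG (vfieldP X) (vfieldP Y)). Qed.

Lemma metric_eq0 p v : M p -> tangent M p v -> g p v v = 0 -> v = 0.
Proof.
move=> Mp Tv gv; apply/eqP; apply/negPn/negP => v0.
by have := metric_pos HG Mp Tv v0; rewrite gv ltxx.
Qed.

Lemma metric_ge0 p v : M p -> tangent M p v -> 0 <= g p v v.
Proof.
move=> Mp Tv; have [->|v0] := eqVneq v 0; first by rewrite metric0l//; exact: tangent0.
exact: ltW (metric_pos HG Mp Tv v0).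
Qed.

Lemma ip_point p X : M p -> (forall Y, ip p X Y = 0) -> X p = 0.
Proof. by move=> Mp X0; apply: (metric_eq0 Mp (tangentP X Mp)); exact: X0. Qed.

Lemma ip_separates X Y : (forall p W, M p -> ip p X W = ip p Y W) -> X = Y.
Proof.
move=> XY; apply: vfield_eq => p Mp; apply/eqP; rewrite -subr_eq0; apply/eqP.
rewrite -[LHS]/((X - Y) p); apply: ip_point => // Z.
rewrite ipD// XY// -ipD// subrr /ip vfield0E metric0l//; exact: tangentP.
Qed.

Variable nab : vf -> vf -> vf.
Hypothesis (HL : levi_civita_field nab).

(** A field vanishing at a point is a combination of fields with coefficients
    vanishing there. *)
Lemma vanishing_tensor (T : vf -> R) p X :
  (forall Y Z, T (Y + Z) = T Y + T Z) ->
  (forall f Y, smooth M f -> T (fscale f Y) = f p * T Y) ->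
  X p = 0 -> T X = 0.
Proof.
move=> TD TZ Xp; rewrite {1}(vfield_decomp X).
have T0 : T 0 = 0 by apply: (addrI (T 0)); rewrite -TD !addr0.
rewrite (big_morph T TD T0); apply: big1 => i _.
by rewrite TZ ?/coord/= ?Xp ?linear0 ?mul0r//; exact: coord_smooth.
Qed.

Lemma nab_pointwise p X Y Z : M p -> X p = 0 -> ip p (nab X Y) Z = 0.
Proof.
move=> Mp; apply: (vanishing_tensor (T := fun X => ip p (nab X Y) Z)).
  by move=> A B; rewrite (lc_addl HL) ipD.
by move=> f A sf; rewrite (lc_scalel HL)// ip_scale.
Qed.

Lemma lc_metric_connection : metric_connection M ip nab.
Proof.
split.
- by move=> p U X W Mp; rewrite ipD.
- by move=> p U W Mp; exact: ip_sym.
- exact: ip_separates.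
- exact: lc_addl.
- exact: lc_addr.
- by move=> p U X W Mp U0; apply: nab_pointwise => //; exact: ip_point.
- move=> U Y Z Y' Z' YZ p Mp; rewrite -!(lc_metric HL)//.
  by rewrite (der_eq U YZ)//; exact: ip_smooth.
Qed.

Local Notation riem := (riem nab).
Local Notation HC := lc_metric_connection.

Lemma lie_bracket X Y : lie nab X Y = vbracket X Y.
Proof. by rewrite lieE (lc_torsion HL). Qed.

Lemma smooth_mul f f' : smooth M f -> smooth M f' -> smooth M (fun q => f q * f' q).
Proof. exact: smooth_scale. Qed.

Lemma riem_addl X Y Z W : riem (X + Y) Z W = riem X Z W + riem Y Z W.
Proof.
apply: ip_separates => p U Mp; rewrite !riemE !lieE.
rewrite !(lc_addl HL, lc_addr HL, nabNl HC, nabNr HC) !(ipD, ipNl HC)//; ring.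
Qed.

Lemma riem_skewl X Y Z : riem X Y Z = - riem Y X Z.
Proof.
apply: ip_separates => p U Mp; rewrite !riemE !lieE (ipNl HC)//.
rewrite !(lc_addl HL, nabNl HC) !(ipD, ipNl HC)//; ring.
Qed.

Lemma ip_riem_scale p f X Y Z W : smooth M f -> M p ->
  ip p (riem (fscale f X) Y Z) W = f p * ip p (riem X Y Z) W.
Proof.
move=> sf Mp; have sd := der_smooth Y sf.
rewrite !riemE !lieE (lc_scalel HL)// (lc_scalel HL X Y)// !(lc_leibniz HL)//.
rewrite (lc_scalel HL X Z)// (lc_leibniz HL Y)//.
rewrite !(lc_addl HL) !(nabNl HC) (lc_addl HL) !(lc_scalel HL)//.
by rewrite !(ipD, ipNl HC, ip_scale)//; ring.
Qed.

Lemma riem_skewr p X Y Z W : M p -> ip p (riem X Y Z) W = - ip p (riem X Y W) Z.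
Proof.
move=> Mp.
have sip A B : smooth M (fun q => ip q A B : R^o) by exact: ip_smooth.
have dd A B : der A (der B (fun q => ip q Z W)) p =
    ip p (nab A (nab B Z)) W + ip p (nab B Z) (nab A W) +
    (ip p (nab A Z) (nab B W) + ip p Z (nab A (nab B W))).
  have -> : der A (der B (fun q => ip q Z W)) =
      der A (fun q => ip q (nab B Z) W + ip q Z (nab B W)).
    apply: der_eq; last exact: der_smooth.
    by move=> q Mq; exact: (lc_metric HL).
  by rewrite (derD A (sip _ _) (sip _ _) Mp) !(lc_metric HL).
have := der_bracket X Y (sip Z W) Mp.
rewrite !dd -lie_bracket (lc_metric HL)// !riemE !(ipD, ipNl HC)//.
rewrite !(ip_sym Z)// => h; lra.
Qed.

Lemma riem_bianchi X Y Z : riem X Y Z + riem Y Z X + riem Z X Y = 0.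
Proof.
have j := jacobi X Y Z; rewrite -!lie_bracket in j.
apply: ip_separates => p W Mp; have := congr1 (fun A => ip p A W) j.
rewrite !riemE !lieE !(lc_addl HL, lc_addr HL) !(ipD, nabNl HC, nabNr HC, ipNl HC)//.
by move=> h; rewrite -[RHS]h; ring.
Qed.

(** Polarization of the sectional curvatures. *)
Lemma constant_curvature_riem k :
  (forall X Y p, M p -> (forall a b : R, a *: X p + b *: Y p = 0 -> a = 0 /\ b = 0) ->
    ip p (riem X Y Y) X = k * (ip p X X * ip p Y Y - ip p X Y ^+ 2)) ->
  forall p U X W Z, M p -> ip p (riem U X W) Z =
    k * (ip p X W * ip p U Z - ip p U W * ip p X Z).
Proof.
move=> sec p U X W Z Mp.
pose S A B C D := ip p (riem A B C) D - k * (ip p B C * ip p A D - ip p A C * ip p B D).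
suff : S U X W Z = 0 by move=> /eqP; rewrite subr_eq0 => /eqP.
have sym A B : ip p A B = ip p B A by exact: ip_sym.
apply: (curvature_like_eq0 (S := S)); rewrite /S.
- by move=> *; rewrite riem_addl !ipD//; ring.
- by move=> *; rewrite riem_skewl (ipNl HC)//; ring.
- by move=> *; rewrite riem_skewr//; ring.
- move=> A B C D; have := congr1 (fun Y => ip p Y D) (riem_bianchi A B C).
  rewrite !ipD// (ip0l HC)// (sym C A) (sym C B) (sym B A) => h; lra.
move=> A B.
have [indep|] := pselect (forall a b : R, a *: A p + b *: B p = 0 -> a = 0 /\ b = 0).
  by rewrite sec// (sym B A); ring.
have dep (C D : vf) (c : R) : C p = c *: D p ->
    ip p (riem C D D) C - k * (ip p D D * ip p C C - ip p C D * ip p D C) = 0.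
  move=> CD; have CDip (E : vf) : ip p C E = c * ip p D E.
    by rewrite /ip CD metricZ//; exact: tangentP.
  have -> : ip p (riem C D D) C = 0.
    pose K := C + fscale (fun=> - c) D.
    have sc a : smooth M (fun=> a : R^o) by exact: smooth_fun_cst.
    have Kp : K p = 0 by rewrite /K vfieldDE fscaleE// CD -scalerDl subrr scale0r.
    have D0 : ip p (riem D D D) C = 0.
      by have := riem_skewl D D D => /(congr1 (fun Y => ip p Y C)); rewrite (ipNl HC)// => h; lra.
    have : ip p (riem K D D) C = 0.
      apply: (vanishing_tensor (T := fun K => ip p (riem K D D) C) (p := p)) => //.
        by move=> *; rewrite riem_addl ipD.
      by move=> *; exact: ip_riem_scale.
    by rewrite /K riem_addl ipD// ip_riem_scale// D0; lra.
  by rewrite !CDip (sym D C) !CDip; ring.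
have solve (C D : vf) (a b : R) : a != 0 -> a *: C p + b *: D p = 0 ->
    C p = - (b / a) *: D p.
  move=> a0 /eqP; rewrite addr_eq0 => /eqP aC; apply: (scalerI a0).
  by rewrite aC scalerA mulrN mulrC divfK// scaleNr.
move=> /existsNP[a /existsNP[b /not_implyP[ab /not_andP[/eqP a0|/eqP b0]]]].
  exact: dep (solve _ _ _ _ a0 ab).
rewrite addrC in ab; have := dep _ _ _ (solve _ _ _ _ b0 ab).
rewrite riem_skewl (ipNl HC)// riem_skewr// opprK (sym B A) => h; lra.
Qed.

End LeviCivita.

Section FromDefs.
Variables (R : realType) (V : normedModType R) (M : set V) (F : frame M).
Local Notation vf := (vfield F).
Variable g : V -> V -> V -> R.
Hypothesis HG : riemannian_metric M g.

Section Connection.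
Variable nabla : (V -> V) -> (V -> V) -> V -> V.
Hypothesis HL : levi_civita M g nabla.
Let HA := levi_civita_connection HL.

Definition nab_field (X Y : vf) : vf := mkvf F (nabla X Y).

Lemma nab_fieldE X Y p : M p -> nab_field X Y p = nabla X Y p.
Proof.
by move=> Mp; rewrite mkvfE//; apply: (connection_field HA); exact: vfieldP.
Qed.

Lemma smooth_off (f : V -> R^o) : (forall p, M p -> f p = 0) -> smooth M f.
Proof.
by move=> f0; apply: (eq_smooth (f := cst 0)); [move=> p /f0|exact: smooth_cst].
Qed.

(** A field vanishing on [M] is its own product with a function vanishing
    on [M]. *)
Lemma off_scale (D : V -> V) : (forall p, M p -> D p = 0) ->
  exists2 f : V -> R^o, (forall p, M p -> f p = 0) & D = fun p => f p *: D p.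
Proof.
move=> D0; exists (fun p => if `[< M p >] then 0 else 1).
  by move=> p Mp; rewrite asboolT.
by apply/funext => p; case: asboolP => [/D0 ->|_]; rewrite ?scaler0 ?scale1r.
Qed.

Lemma vector_field_sub X Y : vector_field M X -> vector_field M Y ->
  vector_field M (fun q => Y q - X q).
Proof.
move=> vX vY; apply: (vector_fieldD F) => //.
have -> : (fun q => - X q) = fun q => (-1 : R^o) *: X q.
  by apply/funext => q; rewrite scaleN1r.
by apply: (vector_field_scale F) => //; exact: smooth_fun_cst.
Qed.

Lemma connection_eqr X Y Y' p : vector_field M X -> vector_field M Y ->
  vector_field M Y' -> (forall q, M q -> Y q = Y' q) -> M p ->
  nabla X Y p = nabla X Y' p.
Proof.
move=> vX vY vY' YY' Mp; pose D q := Y' q - Y q.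
have vD : vector_field M D by exact: vector_field_sub.
have -> : Y' = fun q => Y q + D q by apply/funext => q; rewrite /D addrC subrK.
rewrite (connection_addr HA)//.
have D0 q : M q -> D q = 0 by move=> Mq; rewrite /D YY'// subrr.
have [f f0 ->] := off_scale D0; rewrite (connection_leibniz HA)//.
  by rewrite D0// f0// scaler0 scale0r !addr0.
exact: smooth_off.
Qed.

Lemma connection_eql X X' Y p : vector_field M X -> vector_field M X' ->
  vector_field M Y -> (forall q, M q -> X q = X' q) -> M p ->
  nabla X Y p = nabla X' Y p.
Proof.
move=> vX vX' vY XX' Mp; pose D q := X' q - X q.
have vD : vector_field M D by exact: vector_field_sub.
have -> : X' = fun q => X q + D q by apply/funext => q; rewrite /D addrC subrK.
rewrite (connection_addl HA)//.
have D0 q : M q -> D q = 0 by move=> Mq; rewrite /D XX'// subrr.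
have [f f0 ->] := off_scale D0; rewrite (connection_scalel HA)//.
  by rewrite f0// scale0r addr0.
exact: smooth_off.
Qed.

Lemma fscale_fun (f : V -> R^o) (X : vf) : smooth M f ->
  vfun (fscale f X) = fun q => f q *: X q.
Proof.
move=> sf; apply/funext => p; have [Mp|nMp] := pselect (M p).
  by rewrite fscaleE.
by rewrite !(vfield_off _ nMp) scaler0.
Qed.

Lemma levi_civita_fieldP : levi_civita_field g nab_field.
Proof.
split.
- move=> X Y Z; apply: vfield_eq => p Mp; rewrite vfieldDE !nab_fieldE//.
  by apply: (connection_addl HA) => //; exact: vfieldP.
- move=> X Y Z; apply: vfield_eq => p Mp; rewrite vfieldDE !nab_fieldE//.
  by apply: (connection_addr HA) => //; exact: vfieldP.
- move=> f X Y sf; apply: vfield_eq => p Mp; rewrite nab_fieldE// fscaleE//.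
  rewrite nab_fieldE// fscale_fun//.
  by apply: (connection_scalel HA) => //; exact: vfieldP.
- move=> f X Y sf; apply: vfield_eq => p Mp; rewrite vfieldDE !nab_fieldE//.
  rewrite !fscaleE ?nab_fieldE ?derE ?fscale_fun//; last exact: der_smooth.
  by apply: (connection_leibniz HA) => //; exact: vfieldP.
- move=> X Y; apply: vfield_eq => p Mp; rewrite vfieldDE vfieldNE !nab_fieldE//.
  by rewrite vbracketE// (levi_civita_torsion_free HL)//; exact: vfieldP.
- move=> X Y Z p Mp; rewrite derE// /ip !nab_fieldE//.
  by apply: (levi_civita_metric HL) => //; exact: vfieldP.
Qed.

Lemma riem_curvature (X Y Z : vf) p : M p ->
  riem nab_field X Y Z p = curvature M nabla X Y Z p.
Proof.
move=> Mp; rewrite riemE (lie_bracket levi_civita_fieldP) /curvature.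
rewrite !vfieldDE !vfieldNE !nab_fieldE//; congr (_ - _ - _).
- apply: connection_eqr => //; try exact: vfieldP.
    by apply: (connection_field HA); exact: vfieldP.
  by move=> q Mq; rewrite nab_fieldE.
- apply: connection_eqr => //; try exact: vfieldP.
    by apply: (connection_field HA); exact: vfieldP.
  by move=> q Mq; rewrite nab_fieldE.
- apply: connection_eql => //; try exact: vfieldP.
    by apply: (bracket_field F); exact: vfieldP.
  by move=> q Mq; rewrite vbracketE.
Qed.

End Connection.

Lemma constant_curvature_field k : constant_curvature M g k ->
  exists2 nab : vf -> vf -> vf, levi_civita_field g nab &
  forall p U X W Z, M p -> ip g p (riem nab U X W) Z =
    k * (ip g p X W * ip g p U Z - ip g p U W * ip g p X Z).
Proof.
move=> [nabla HL sec]; exists (nab_field nabla); first exact: levi_civita_fieldP.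
apply: (constant_curvature_riem HG (levi_civita_fieldP HL)) => X Y p Mp ind.
have := sec X Y p (vfieldP X) (vfieldP Y) Mp ind.
rewrite /sectional_curvature -(riem_curvature HL)// => sk.
have gram : ip g p X X * ip g p Y Y - ip g p X Y ^+ 2 != 0.
  have X0 : X p != 0.
    apply/eqP => X0; have [] := ind 1 0; first by rewrite X0 scaler0 scale0r addr0.
    by move=> /eqP; rewrite oner_eq0.
  set a := ip g p X X; set b := ip g p X Y.
  have a0 : 0 < a by apply: (metric_pos HG) => //; exact: tangentP.
  pose Z := a *: Y - b *: X.
  have Z0 : Z p != 0.
    apply/eqP => Z0; have [] := ind (- b) a.
      by rewrite scaleNr addrC; exact: Z0.
    by move=> _ /eqP; rewrite gt_eqF.
  have Zpos : 0 < ip g p Z Z by apply: (metric_pos HG) => //; exact: tangentP.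
  have ipZ (c : R) (A B : vf) : ip g p (c *: A) B = c * ip g p A B.
    by apply: (metricZ HG) => //; exact: tangentP.
  have sym (A B : vf) : ip g p A B = ip g p B A by exact: (ip_sym HG).
  have HC := lc_metric_connection HG (levi_civita_fieldP HL).
  have ZE : ip g p Z Z = a * (a * ip g p Y Y - b ^+ 2).
    rewrite /Z (ipDl HC)// (ipNl HC)// !ipZ !(sym _ (_ - _)).
    rewrite !(ipDl HC)// !(ipNl HC)// !ipZ (sym Y X) -/a -/b; ring.
  by apply/eqP => gr; move: Zpos; rewrite ZE gr mulr0 ltxx.
by rewrite -sk /ip divfK.
Qed.

Section AlmostComplex.
Variable J : V -> V -> V.
Hypotheses (HJ : almost_complex M J) (Horth : orthogonal_structure M g J)
  (Hint : integrable_structure M J).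
Variable nab : vf -> vf -> vf.
Hypothesis HL : levi_civita_field g nab.

Definition J_field (X : vf) : vf := mkvf F (fun p => J p (X p)).

Lemma J_vector_field X : vector_field M X -> vector_field M (fun p => J p (X p)).
Proof.
move=> vX; split; first exact: (almost_complex_smooth HJ).
by move=> p Mp; apply: (almost_complex_tangent HJ) => //; exact: vX.2.
Qed.

Lemma J_fieldE X p : M p -> J_field X p = J p (X p).
Proof. by move=> Mp; rewrite mkvfE//; apply: J_vector_field; exact: vfieldP. Qed.

Lemma bracket_eq X X' Y Y' p : vector_field M X -> vector_field M X' ->
  vector_field M Y -> vector_field M Y' ->
  (forall q, M q -> X q = X' q) -> (forall q, M q -> Y q = Y' q) -> M p ->
  bracket M X Y p = bracket M X' Y' p.
Proof.
move=> vX vX' vY vY' XX' YY' Mp; rewrite /bracket -XX'// -YY'//.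
rewrite (eq_mdiff YY' vY.1 Mp (vX.2 _ Mp)).
by rewrite (eq_mdiff XX' vX.1 Mp (vY.2 _ Mp)).
Qed.

Lemma hermitian_field : hermitian M (ip g) nab J_field.
Proof.
split.
- move=> X Y; apply: vfield_eq => p Mp; rewrite vfieldDE !J_fieldE// vfieldDE.
  have := almost_complex_linear HJ 1 Mp (tangentP X Mp) (tangentP Y Mp).
  by rewrite !scale1r.
- move=> X; apply: vfield_eq => p Mp; rewrite vfieldNE !J_fieldE//.
  by apply: (almost_complex_square HJ) => //; exact: tangentP.
- by move=> p X Y Mp; rewrite /ip !J_fieldE//; apply: Horth => //; exact: tangentP.
- move=> X Y; apply: vfield_eq => p Mp; rewrite !(lie_bracket HL).
  rewrite !vfieldDE !vfieldNE !J_fieldE// !vbracketE// vfield0E.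
  rewrite -[RHS](Hint (vfieldP X) (vfieldP Y) Mp) /nijenhuis.
  have JvE (Z : vf) q : M q -> J_field Z q = J q (Z q) by move=> Mq; exact: J_fieldE.
  have vJ (Z : vf) : vector_field M (fun q => J q (Z q)).
    by apply: J_vector_field; exact: vfieldP.
  have vZ (Z : vf) := vfieldP Z.
  rewrite (bracket_eq (vZ _) (vJ X) (vZ _) (vJ Y) (JvE X) (JvE Y) Mp).
  rewrite (bracket_eq (vZ _) (vJ X) (vZ Y) (vZ Y) (JvE X) _ Mp)//.
  by rewrite (bracket_eq (vZ X) (vZ X) (vZ _) (vJ Y) _ (JvE Y) Mp).
Qed.

End AlmostComplex.
End FromDefs.

Section Sphere.
Variables (R : realType) (m : nat).
Local Notation V := 'rV[R]_m.+1.
Local Notation S := (sphere R m).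
Implicit Types u v p : V.

Definition dotr u v : R := \sum_i u 0 i * v 0 i.

Definition coordf i u : R^o := u 0 i.

Lemma coordf_is_linear i : linear (coordf i).
Proof. by move=> a u v; rewrite /coordf !mxE. Qed.

HB.instance Definition _ i :=
  GRing.isLinear.Build R V R^o _ (coordf i) (coordf_is_linear i).

Definition coordl i : {linear V -> R^o} := coordf i.

Lemma coordl_continuous i : continuous (coordl i).
Proof. by move=> u; exact: coord_continuous. Qed.

Lemma dotrC u v : dotr u v = dotr v u.
Proof. by apply: eq_bigr => i _; rewrite mulrC. Qed.

Lemma dotrDl a u v w : dotr (a *: u + v) w = a * dotr u w + dotr v w.
Proof.
rewrite /dotr mulr_sumr -big_split/=; apply: eq_bigr => i _.
by rewrite !mxE mulrDl mulrA.
Qed.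

Lemma dotrZl a u w : dotr (a *: u) w = a * dotr u w.
Proof. by rewrite /dotr mulr_sumr; apply: eq_bigr => i _; rewrite mxE mulrA. Qed.

Lemma sphereP p : S p <-> dotr p p = 1.
Proof. by rewrite /dotr; under eq_bigr => i _ do rewrite -expr2. Qed.

Lemma dotr_eq0 u : dotr u u = 0 -> u = 0.
Proof.
move=> /eqP; rewrite psumr_eq0 => [/allP u0|i _]; last by rewrite -expr2 sqr_ge0.
apply/rowP => i; rewrite mxE; apply/eqP; rewrite -sqrf_eq0 expr2.
by have := u0 i; rewrite mem_index_enum => /(_ isT).
Qed.

Lemma dotr_smooth (M : set V) (X Y : V -> V) : smooth M X -> smooth M Y ->
  smooth M (fun q => dotr (X q) (Y q) : R^o).
Proof.
move=> sX sY; rewrite /dotr.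
have sc i (Z : V -> V) : smooth M Z -> smooth M (fun q => Z q 0 i : R^o).
  by move=> sZ; apply: (smooth_comp_lin (l := coordl i)) => //; exact: coordl_continuous.
apply: smooth_sum => i.
by apply: (smooth_scale (g := fun q => Y q 0 i : R^o)); exact: sc.
Qed.

Lemma mdiff_dotr (M : set V) (X Y : V -> V) p v : smooth M X -> smooth M Y ->
  M p -> tangent M p v -> mdiff M (fun q => dotr (X q) (Y q) : R^o) p v =
  dotr (mdiff M X p v) (Y p) + dotr (X p) (mdiff M Y p v).
Proof.
move=> sX sY Mp Tv; rewrite /dotr -big_split/=.
have sc i (Z : V -> V) : smooth M Z -> smooth M (fun q => Z q 0 i : R^o).
  by move=> sZ; apply: (smooth_comp_lin (l := coordl i)) => //; exact: coordl_continuous.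
have dc i (Z : V -> V) : smooth M Z -> mdiff M (fun q => Z q 0 i : R^o) p v =
    mdiff M Z p v 0 i.
  move=> sZ; exact: (mdiff_comp_lin (l := coordl i) Mp Tv (@coordl_continuous i) sZ).
rewrite (mdiff_sum Mp Tv) => [|i].
  apply: eq_bigr => i _.
  rewrite (mdiff_scale (g := fun q => Y q 0 i : R^o) Mp Tv (sc i _ sX) (sc i _ sY)).
  by rewrite !dc.
by apply: (smooth_scale (g := fun q => Y q 0 i : R^o)); exact: sc.
Qed.

Definition great_circle (k : R) u v : R^o -> V :=
  fun t => cos (k * t) *: u + sin (k * t) *: v.

Lemma great_circle_derive k u v t : differentiable (great_circle k u v) t /\
  forall r, 'D_r (great_circle k u v) t =
            great_circle k ((r * k) *: v) (- (r * k) *: u) t.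
Proof.
have dk : is_derive (t : R) 1 ( *%R k) k.
  by apply: is_derive_eq; rewrite /GRing.scale/= mulr1.
pose C (t : R^o) : R^o := cos (k * t); pose D (t : R^o) : R^o := sin (k * t).
have dC : is_derive t 1 C (- sin (k * t) * k).
  exact: (@is_derive1_comp _ cos ( *%R k)).
have dD : is_derive t 1 D (cos (k * t) * k).
  exact: (@is_derive1_comp _ sin ( *%R k)).
have dC1 : differentiable C t by case: dC => dC _; exact/derivable1_diffP.
have dD1 : differentiable D t by case: dD => dD _; exact/derivable1_diffP.
have sC := scale_differentiable dC1 (differentiable_cst u t).
have sD := scale_differentiable dD1 (differentiable_cst v t).
have dE : differentiable (great_circle k u v) t by exact: differentiableD sC.1 sD.1.
split=> // r.
have dr (W : normedModType R) (h : R^o -> W) : differentiable h t ->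
    'D_r h t = r *: 'D_1 h t.
  by move=> dh; rewrite !deriveE// -linearZ/= [r *: _]mulr1.
have -> : 'D_r (great_circle k u v) t = 'D_r C t *: u + 'D_r D t *: v.
  have -> : great_circle k u v = (fun y => C y *: cst u y) + (fun y => D y *: cst v y).
    by [].
  rewrite deriveD; first by rewrite sC.2 sD.2 !derive_cst !scaler0 !addr0.
    by apply: diff_derivable; exact: sC.1.
  by apply: diff_derivable; exact: sD.1.
rewrite (dr _ _ dC1) (dr _ _ dD1).
have -> : 'D_1 C t = - sin (k * t) * k by case: dC.
have -> : 'D_1 D t = cos (k * t) * k by case: dD.
rewrite /great_circle !scalerA addrC; congr (_ *: _ + _ *: _);
  rewrite /GRing.scale/=; ring.
Qed.

Lemma great_circle_smooth k u v : smooth_on setT (great_circle k u v).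
Proof.
apply: (smooth_on_coind (P := fun h => exists u v, h = great_circle k u v)).
- exact: openT.
- move=> _ [a [b ->]]; split=> [t _|r]; first exact: (great_circle_derive k a b t).1.
  eexists; first by do 2 eexists; reflexivity.
  by move=> t _; exact: (great_circle_derive k a b t).2.
- by exists u, v.
Qed.

Definition speed v : R := Num.sqrt (dotr v v).
Definition geodesic p v : R^o -> V := great_circle (speed v) p ((speed v)^-1 *: v).

Lemma speed_sqr v : speed v * speed v = dotr v v.
Proof.
by rewrite -expr2 sqr_sqrtr//; apply: sumr_ge0 => i _; rewrite -expr2 sqr_ge0.
Qed.

Lemma speedK v : speed v *: ((speed v)^-1 *: v) = v.
Proof.
rewrite scalerA; have [k0|k0] := eqVneq (speed v) 0; last by rewrite divff// scale1r.
by rewrite k0 mul0r scale0r; apply/esym/dotr_eq0; rewrite -speed_sqr k0 mulr0.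
Qed.

Lemma geodesic_sphere p v t : S p -> dotr p v = 0 -> S (geodesic p v t).
Proof.
move=> Sp pv; apply/sphereP; rewrite /geodesic /great_circle.
have E a b : dotr (a *: p + b *: v) (a *: p + b *: v) =
    a ^+ 2 + b ^+ 2 * (speed v * speed v).
  rewrite dotrDl dotrZl (dotrC p) (dotrC v) !dotrDl !dotrZl ((sphereP p).1 Sp).
  by rewrite (dotrC v p) pv speed_sqr; ring.
rewrite scalerA E; have [k0|k0] := eqVneq (speed v) 0.
  by rewrite k0 !mul0r cos0 mulr0 addr0 expr1n.
rewrite exprMn exprVn -expr2 mulfVK ?expf_neq0//; exact: cos2Dsin2.
Qed.

Lemma great_circle0 k u v : great_circle k u v 0 = u.
Proof. by rewrite /great_circle mulr0 cos0 sin0 scale1r scale0r addr0. Qed.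

Lemma great_circle_velocity k u v : derive1 (great_circle k u v) 0 = k *: v.
Proof.
by rewrite derive1E (great_circle_derive _ _ _ _).2 great_circle0 mul1r.
Qed.

Lemma sphere_tangent p v : S p -> tangent S p v <-> dotr p v = 0.
Proof.
move=> Sp; split=> [Tv|pv].
  have cid : continuous (idfun : V -> V) by move=> x; exact: cvg_id.
  have sid : smooth S (idfun : V -> V) by exact: smooth_lin.
  have d := mdiff_dotr sid sid Sp Tv.
  have N1 q : S q -> dotr q q = (cst 1 : V -> R^o) q by move=> /sphereP.
  have := eq_mdiff N1 (dotr_smooth sid sid) Sp Tv.
  by rewrite d (mdiff_lin Tv cid) (mdiff_cst Tv)/= (dotrC v) => h; lra.
exists (geodesic p v); split.
- exact: great_circle_smooth.
- by move=> t; exact: geodesic_sphere.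
- exact: great_circle0.
- by rewrite great_circle_velocity speedK.
Qed.

Lemma sphere_self_smooth : smooth S (idfun : V -> V).
Proof. by apply: smooth_lin => x; exact: cvg_id. Qed.

Definition sphere_fE (i : 'I_m.+1) (p : V) : V := delta_mx 0 i - p 0 i *: p.

Lemma dotr_delta u i : dotr u (delta_mx 0 i) = u 0 i.
Proof.
rewrite /dotr (bigD1 i)//= mxE !eqxx mulr1 big1 ?addr0// => j ji.
by rewrite mxE (negbTE ji) mulr0.
Qed.

Lemma dotrNr u v : dotr u (- v) = - dotr u v.
Proof. by rewrite dotrC -scaleN1r dotrZl mulN1r dotrC. Qed.

Lemma dotrDr u v w : dotr w (u + v) = dotr w u + dotr w v.
Proof.
by rewrite /dotr -big_split/=; apply: eq_bigr => i _; rewrite mxE mulrDr.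
Qed.

Lemma sphere_fE_field i : vector_field S (sphere_fE i).
Proof.
split=> [|p Sp].
  have -> : sphere_fE i = fun p => delta_mx 0 i + (- coordf i p : R^o) *: p.
    by apply/funext => p; rewrite /sphere_fE scaleNr.
  apply: smoothD; first exact: smooth_cst.
  apply: (smooth_scale (f := fun p => - coordf i p : R^o)); last exact: sphere_self_smooth.
  have -> : (fun p => - coordf i p : R^o) = fun p => (-1 : R^o) *: (coordl i p : R^o).
    by apply/funext => p; rewrite scaleN1r.
  apply: (smooth_scale (f := fun=> -1 : R^o)); first exact: smooth_cst.
  by apply: smooth_lin; exact: coordl_continuous.
apply/(sphere_tangent _ Sp); rewrite /sphere_fE dotrDr dotrNr dotr_delta dotrC dotrZl.
by rewrite ((sphereP p).1 Sp) mulr1 subrr.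
Qed.

Lemma sphere_basis (v : V) : v = \sum_i coordl i v *: delta_mx 0 i.
Proof. exact: row_sum_delta. Qed.

Lemma sphere_span p v : S p -> tangent S p v ->
  v = \sum_i coordl i v *: sphere_fE i p.
Proof.
move=> Sp /(sphere_tangent v Sp) pv; rewrite /sphere_fE.
under eq_bigr => i _ do rewrite scalerBr scalerA.
rewrite sumrB -sphere_basis -scaler_suml.
have -> : \sum_i coordl i v * p 0 i = dotr v p by [].
by rewrite dotrC pv scale0r subr0.
Qed.

Lemma sphere_tangentP p a u v : S p -> tangent S p u -> tangent S p v ->
  tangent S p (a *: u + v).
Proof.
move=> Sp /(sphere_tangent _ Sp) pu /(sphere_tangent _ Sp) pv.
by apply/(sphere_tangent _ Sp); rewrite dotrC dotrDl !(dotrC _ p) pu pv mulr0 addr0.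
Qed.

(** Differentiate [dotr q (X q) = 0]; the resulting term [dotr Y X] is symmetric
    and drops out of the bracket. *)
Lemma sphere_bracket X Y p : vector_field S X -> vector_field S Y -> S p ->
  tangent S p (bracket S X Y p).
Proof.
have key Z v : vector_field S Z -> S p -> tangent S p v ->
    dotr p (mdiff S Z p v) = - dotr v (Z p).
  move=> vZ Sp Tv.
  have d := mdiff_dotr sphere_self_smooth vZ.1 Sp Tv.
  have Z0 q : S q -> dotr (idfun q) (Z q) = (cst 0 : V -> R^o) q.
    by move=> Sq; apply/(sphere_tangent _ Sq); exact: vZ.2.
  have := eq_mdiff Z0 (dotr_smooth sphere_self_smooth vZ.1) Sp Tv.
  rewrite d (mdiff_lin Tv) ?(mdiff_cst Tv)/=; last by move=> x; exact: cvg_id.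
  by move=> h; lra.
move=> vX vY Sp; apply/(sphere_tangent _ Sp); rewrite dotrDr dotrNr.
rewrite (key Y _ vY Sp (vX.2 _ Sp)) (key X _ vX Sp (vY.2 _ Sp)) dotrC; lra.
Qed.

Definition sphere_frame : frame S := @Frame R V S m.+1 (delta_mx 0) coordl
  sphere_fE coordl_continuous sphere_basis sphere_fE_field sphere_span
  sphere_tangentP
  (fun i j p Sp => sphere_bracket (sphere_fE_field i) (sphere_fE_field j) Sp).

End Sphere.

Section SphereDimension.
Variables (R : realType) (m : nat) (h : 'rV[R]_m.+1 -> 'rV[R]_m.+1 -> 'rV[R]_m.+1 -> R).
Local Notation V := 'rV[R]_m.+1.
Local Notation S := (sphere R m).
Local Notation F := (sphere_frame R m).
Hypothesis HG : riemannian_metric S h.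

(** Together with the base point, which is orthogonal to the tangent space,
    the vectors [v i] are linearly independent in a space of dimension
    [m.+1]. *)
Lemma sphere_orthogonal_family p n (v : 'I_n -> V) : S p ->
  (forall i, tangent S p (v i)) -> (forall i, v i != 0) ->
  (forall i j, i != j -> h p (v i) (v j) = 0) -> (n <= m)%N.
Proof.
move=> Sp Tv v0 orth.
pose A : 'M[R]_(1 + n, m.+1) := col_mx p (\matrix_i v i).
suff /eqP rA : row_free A by have := rank_leq_col A; rewrite rA add1n ltnS.
rewrite -kermx_eq0; apply/rowV0P => u /sub_kermxP uA.
have [a [b ub]] : exists a b, u = row_mx (a : 'rV_1) b.
  by exists (lsubmx u), (rsubmx u); rewrite hsubmxK.
move: uA; rewrite ub mul_row_col.
have -> : a *m p = a 0 0 *: p.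
  by apply/rowP => j; rewrite !mxE big_ord1.
have -> : b *m \matrix_i v i = \sum_i b 0 i *: v i.
  apply/rowP => j; rewrite !mxE summxE; apply: eq_bigr => i _.
  by rewrite !mxE.
move=> uA.
have Ts : tangent S p (\sum_i b 0 i *: v i).
  by apply: (frame_tangent_sum F) => // i; exact: (frame_tangentZ F).
have a0 : a 0 0 = 0.
  have := congr1 (fun w => dotr w p) uA; rewrite dotrDl ((sphereP p).1 Sp).
  rewrite (dotrC _ p) ((sphere_tangent _ Sp).1 Ts) addr0 mulr1 => ->.
  by rewrite /dotr big1// => i _; rewrite mxE mul0r.
move: uA; rewrite a0 scale0r add0r => sb.
have b0 j : b 0 j = 0.
  have := congr1 (fun w => h p w (v j)) sb.
  rewrite (metric0l HG)// (metric_sum F HG)// (bigD1 j)//= big1 => [|i ij].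
    rewrite addr0 => /eqP; rewrite mulf_eq0 => /orP[/eqP//|].
    by rewrite gt_eqF//; exact: (metric_pos HG).
  by rewrite orth// mulr0.
apply/matrixP => i j; rewrite !mxE; case: splitP => k _.
  by rewrite !ord1 a0.
by rewrite ord1 b0.
Qed.

(** A linear system of [n.+1] equations in [m.+1] unknowns. *)
Lemma sphere_orthogonal_vector p n (v : 'I_n -> V) : (n < m)%N -> S p ->
  (forall i, tangent S p (v i)) ->
  exists w, [/\ tangent S p w, w != 0 & forall i, h p (v i) w = 0].
Proof.
move=> nm Sp Tv; have TE j : tangent S p (sphere_fE j p) := (sphere_fE_field R j).2 p Sp.
pose A : 'M[R]_(m.+1, 1 + n) :=
  row_mx (p^T) (\matrix_(j, i) h p (sphere_fE j p) (v i)).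
have : kermx A != 0.
  rewrite -mxrank_eq0 mxrank_ker subn_eq0 -ltnNge.
  by apply: leq_ltn_trans (rank_leq_col A) _; rewrite add1n ltnS.
case/rowV0Pn => w /sub_kermxP; rewrite mul_mx_row => wA w0.
have [wp wv] : w *m (p^T) = 0 /\ w *m (\matrix_(j, i) h p (sphere_fE j p) (v i)) = 0.
  by apply/eq_row_mx; rewrite wA row_mx0.
have pw : dotr p w = 0.
  have := congr1 (fun B : 'M[R]_(1, 1) => B 0 0) wp; rewrite !mxE => wp0.
  by rewrite -[RHS]wp0 dotrC; apply: eq_bigr => i _; rewrite mxE.
have Tw : tangent S p w by apply/(sphere_tangent _ Sp).
exists w; split=> // i; rewrite (Defs.metric_sym HG Sp (Tv i) Tw).
rewrite {1}(sphere_span Sp Tw) (metric_sum F HG)//.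
have := congr1 (fun B : 'M[R]_(1, n) => B 0 i) wv; rewrite !mxE => wi.
by rewrite -[RHS]wi; apply: eq_bigr => j _; rewrite mxE.
Qed.

End SphereDimension.

Section AffineMaps.
Variables (R : realType) (V V' : normedModType R) (M : set V) (M' : set V').
Variables (c : V) (l : {linear V' -> V}).
Implicit Types W : normedModType R.
Hypotheses (cl : continuous l) (M'M : forall x, M' x -> M (c + l x)).

Lemma local_extension_affine W (f F : V -> W) p :
  local_extension M f (c + l p) F ->
  local_extension M' (fun x => f (c + l x)) p (fun x => F (c + l x)).
Proof.
move=> [U [Up sF FE]]; exists [set x | U (c + l x)]; split=> //.
  exact: smooth_on_comp_affine.
by move=> q Uq Mq; rewrite FE//; exact: M'M.
Qed.

Lemma smooth_affine W (f : V -> W) : smooth M f -> smooth M' (fun x => f (c + l x)).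
Proof.
move=> sf p Mp; have [F FE] := sf _ (M'M Mp).
by exists (fun x => F (c + l x)); exact: local_extension_affine.
Qed.

Lemma tangent_affine p v : tangent M' p v -> tangent M (c + l p) (l v).
Proof.
move=> [k [sk Mk k0 k1]]; exists (fun t => c + l (k t)).
have sl : smooth_on setT (l \o k) by exact: smooth_on_comp_lin.
split=> [|t||].
- by apply: (smooth_onDD (f := cst c) _ sl); apply: smooth_on_cst; exact: openT.
- exact: M'M.
- by rewrite k0.
have dk : differentiable k 0 by exact: smooth_on_diff sk I.
have dlk : differentiable (l \o k) 0 by exact: smooth_on_diff sl I.
rewrite -[fun t => _]/(cst c + l \o k) derive1E deriveD; last exact: diff_derivable.
  rewrite derive_cst add0r deriveE// diff_comp//; last exact: linear_differentiable.
  by rewrite /= diff_lin//= -deriveE// -derive1E k1.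
exact: diff_derivable (differentiable_cst _ _).
Qed.

Lemma mdiff_affine W (f : V -> W) p v : smooth M f -> M' p -> tangent M' p v ->
  mdiff M' (fun x => f (c + l x)) p v = mdiff M f (c + l p) (l v).
Proof.
move=> sf Mp Tv; have [F FE] := sf _ (M'M Mp).
rewrite (mdiffE Tv (local_extension_affine FE)) (mdiffE (tangent_affine Tv) FE).
have dF := local_extension_diff FE.
by have [_ ->] := derive_comp_affine v cl dF.
Qed.

End AffineMaps.

Section ProductFrame.
Variables (R : realType) (V1 V2 : normedModType R) (M1 : set V1) (M2 : set V2).
Variables (F1 : frame M1) (F2 : frame M2).
Implicit Types W : normedModType R.
Local Notation V := (V1 * V2)%type.
Local Notation M := (M1 `*` M2).

Lemma fst_linear : linear (fst : V -> V1). Proof. by []. Qed.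
Lemma snd_linear : linear (snd : V -> V2). Proof. by []. Qed.
Lemma inl_linear : linear (fun x : V1 => (x, 0) : V).
Proof. by move=> a x y; congr pair; rewrite /= scaler0 addr0. Qed.
Lemma inr_linear : linear (fun x : V2 => (0, x) : V).
Proof. by move=> a x y; congr pair; rewrite /= scaler0 addr0. Qed.

Definition fstl : {linear V -> V1} :=
  HB.pack (fst : V -> V1) (GRing.isLinear.Build R V V1 _ _ fst_linear).
Definition sndl : {linear V -> V2} :=
  HB.pack (snd : V -> V2) (GRing.isLinear.Build R V V2 _ _ snd_linear).
Definition inll : {linear V1 -> V} := HB.pack (fun x : V1 => (x, 0) : V)
  (GRing.isLinear.Build R V1 V _ _ inl_linear).
Definition inrl : {linear V2 -> V} := HB.pack (fun x : V2 => (0, x) : V)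
  (GRing.isLinear.Build R V2 V _ _ inr_linear).

Lemma fstl_continuous : continuous fstl. Proof. by move=> x; exact: cvg_fst. Qed.
Lemma sndl_continuous : continuous sndl. Proof. by move=> x; exact: cvg_snd. Qed.
Lemma inrl_continuous : continuous inrl.
Proof. by move=> x; apply: cvg_pair; [exact: cvg_cst|exact: cvg_id]. Qed.

Lemma prod_tangent p v :
  tangent M p v <-> tangent M1 p.1 v.1 /\ tangent M2 p.2 v.2.
Proof.
split=> [Tv|[[c1 [s1 Mc1 c10 d1]] [c2 [s2 Mc2 c20 d2]]]].
  split.
    have := @tangent_affine _ _ _ M1 M 0 fstl fstl_continuous _ _ _ Tv.
    by rewrite add0r; apply=> x [Mx _]; rewrite add0r.
  have := @tangent_affine _ _ _ M2 M 0 sndl sndl_continuous _ _ _ Tv.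
  by rewrite add0r; apply=> x [_ Mx]; rewrite add0r.
exists (fun t => (c1 t, c2 t)); split=> [|t||].
- exact: smooth_on_pair.
- by split; [exact: Mc1|exact: Mc2].
- by rewrite c10 c20; case: (p).
have dc1 : differentiable c1 0 by exact: smooth_on_diff s1 I.
have dc2 : differentiable c2 0 by exact: smooth_on_diff s2 I.
rewrite derive1E deriveE; last exact: differentiable_pair.
rewrite diff_pair//= -!deriveE// -!derive1E d1 d2; by case: (v).
Qed.

Lemma smooth_fst W (f : V1 -> W) : smooth M1 f -> smooth M (fun p => f p.1).
Proof.
move=> sf; have h x : M x -> M1 (0 + fstl x) by rewrite add0r => -[].
apply: eq_smooth (smooth_affine fstl_continuous h sf) => p Mp.
by rewrite add0r.
Qed.

Lemma smooth_snd W (f : V2 -> W) : smooth M2 f -> smooth M (fun p => f p.2).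
Proof.
move=> sf; have h x : M x -> M2 (0 + sndl x) by rewrite add0r => -[].
apply: eq_smooth (smooth_affine sndl_continuous h sf) => p Mp.
by rewrite add0r.
Qed.

Lemma mdiff_fst W (f : V1 -> W) p v : smooth M1 f -> M p -> tangent M p v ->
  mdiff M (fun p => f p.1) p v = mdiff M1 f p.1 v.1.
Proof.
move=> sf Mp Tv; have h x : M x -> M1 (0 + fstl x) by rewrite add0r => -[].
have E q : M q -> f (0 + fstl q) = f q.1 by rewrite add0r.
rewrite -(eq_mdiff E (smooth_affine fstl_continuous h sf) Mp Tv).
by rewrite (mdiff_affine fstl_continuous h)// add0r.
Qed.

Lemma mdiff_snd W (f : V2 -> W) p v : smooth M2 f -> M p -> tangent M p v ->
  mdiff M (fun p => f p.2) p v = mdiff M2 f p.2 v.2.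
Proof.
move=> sf Mp Tv; have h x : M x -> M2 (0 + sndl x) by rewrite add0r => -[].
have E q : M q -> f (0 + sndl q) = f q.2 by rewrite add0r.
rewrite -(eq_mdiff E (smooth_affine sndl_continuous h sf) Mp Tv).
by rewrite (mdiff_affine sndl_continuous h)// add0r.
Qed.

(** The horizontal and vertical fields over fields of the factors. *)
Definition lift1 (X : V1 -> V1) : V -> V := fun p => (X p.1, 0).
Definition lift2 (X : V2 -> V2) : V -> V := fun p => (0, X p.2).

Lemma lift1_field X : vector_field M1 X -> vector_field M (lift1 X).
Proof.
move=> [sX TX]; split.
  by apply: smooth_pair; [exact: smooth_fst|exact: smooth_cst].
move=> p [Mp1 Mp2]; apply/prod_tangent; split; first exact: TX.
exact: tangent0.
Qed.

Lemma lift2_field X : vector_field M2 X -> vector_field M (lift2 X).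
Proof.
move=> [sX TX]; split.
  by apply: smooth_pair; [exact: smooth_cst|exact: smooth_snd].
move=> p [Mp1 Mp2]; apply/prod_tangent; split; last exact: TX.
exact: tangent0.
Qed.

Lemma mdiff_lift1 X p v : vector_field M1 X -> M p -> tangent M p v ->
  mdiff M (lift1 X) p v = (mdiff M1 X p.1 v.1, 0).
Proof.
move=> [sX TX] Mp Tv; rewrite (mdiff_pair Mp Tv); last exact: smooth_cst.
  by rewrite mdiff_fst// (mdiff_cst Tv).
exact: smooth_fst.
Qed.

Lemma mdiff_lift2 X p v : vector_field M2 X -> M p -> tangent M p v ->
  mdiff M (lift2 X) p v = (0, mdiff M2 X p.2 v.2).
Proof.
move=> [sX TX] Mp Tv; rewrite (mdiff_pair Mp Tv); first last.
- exact: smooth_snd.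
- exact: smooth_cst.
by rewrite mdiff_snd// (mdiff_cst Tv).
Qed.

Lemma mdiff_dir0 (W W' : normedModType R) (N : set W) (f : W -> W') p :
  mdiff N f p 0 = 0.
Proof. exact: derive0. Qed.

Lemma bracket_lift11 X Y p : vector_field M1 X -> vector_field M1 Y -> M p ->
  bracket M (lift1 X) (lift1 Y) p = (bracket M1 X Y p.1, 0).
Proof.
move=> vX vY Mp; rewrite /bracket !mdiff_lift1//; try exact: (lift1_field _).2.
by congr pair; exact: subrr.
Qed.

Lemma bracket_lift22 X Y p : vector_field M2 X -> vector_field M2 Y -> M p ->
  bracket M (lift2 X) (lift2 Y) p = (0, bracket M2 X Y p.2).
Proof.
move=> vX vY Mp; rewrite /bracket !mdiff_lift2//; try exact: (lift2_field _).2.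
by congr pair; exact: subrr.
Qed.

Lemma bracket_lift12 X Y p : vector_field M1 X -> vector_field M2 Y -> M p ->
  bracket M (lift1 X) (lift2 Y) p = 0.
Proof.
move=> vX vY Mp; rewrite /bracket mdiff_lift1 ?mdiff_lift2//.
- by rewrite !mdiff_dir0; exact: subrr.
- exact: (lift1_field vX).2.
- exact: (lift2_field vY).2.
Qed.

Definition prod_fe (i : 'I_(fdim F1 + fdim F2)) : V :=
  match fintype.split i with inl a => (fe F1 a, 0) | inr b => (0, fe F2 b) end.
Definition prod_feps (i : 'I_(fdim F1 + fdim F2)) : {linear V -> R^o} :=
  match fintype.split i with
  | inl a => (feps F1 a \o fstl : {linear V -> R^o})
  | inr b => (feps F2 b \o sndl : {linear V -> R^o}) end.
Definition prod_fE (i : 'I_(fdim F1 + fdim F2)) : V -> V :=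
  match fintype.split i with
  | inl a => lift1 (fE F1 a) | inr b => lift2 (fE F2 b) end.

Lemma prod_feps_continuous i : continuous (prod_feps i).
Proof.
rewrite /prod_feps; case: fintype.split => a x.
  apply: continuous_comp; [exact: fstl_continuous|exact: feps_continuous].
apply: continuous_comp; [exact: sndl_continuous|exact: feps_continuous].
Qed.

Lemma prod_sum (a : 'I_(fdim F1 + fdim F2) -> V) :
  \sum_i a i = \sum_i a (lshift _ i) + \sum_i a (rshift _ i).
Proof. exact: big_split_ord. Qed.

Lemma pair_sum n1 n2 (a : 'I_n1 -> V1) (b : 'I_n2 -> V2) :
  \sum_i ((a i, 0) : V) + \sum_i ((0, b i) : V) = (\sum_i a i, \sum_i b i).
Proof.
have -> : \sum_i ((a i, 0) : V) = inll (\sum_i a i) by rewrite linear_sum.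
have -> : \sum_i ((0, b i) : V) = inrl (\sum_i b i) by rewrite linear_sum.
by congr pair; rewrite /= ?addr0 ?add0r.
Qed.

Lemma prod_basis v : v = \sum_i prod_feps i v *: prod_fe i.
Proof.
rewrite prod_sum /prod_feps /prod_fe.
under eq_bigr => i _ do rewrite (unsplitK (inl _ i)).
under [X in _ + X]eq_bigr => i _ do rewrite (unsplitK (inr _ i)).
case: v => v1 v2; rewrite {1}(fe_basis F1 v1) {1}(fe_basis F2 v2) -pair_sum.
by congr (_ + _); apply: eq_bigr => i _; congr pair; rewrite scaler0.
Qed.

Lemma prod_fE_field i : vector_field M (prod_fE i).
Proof.
rewrite /prod_fE; case: fintype.split => a.
  by apply: lift1_field; exact: fE_field.
by apply: lift2_field; exact: fE_field.
Qed.

Lemma prod_span p v : M p -> tangent M p v ->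
  v = \sum_i prod_feps i v *: prod_fE i p.
Proof.
move=> [Mp1 Mp2] /prod_tangent[T1 T2]; rewrite prod_sum /prod_feps /prod_fE.
under eq_bigr => i _ do rewrite (unsplitK (inl _ i)).
under [X in _ + X]eq_bigr => i _ do rewrite (unsplitK (inr _ i)).
case: v T1 T2 => v1 v2 /= T1 T2.
rewrite {1}(fE_span F1 Mp1 T1) {1}(fE_span F2 Mp2 T2) -pair_sum.
by congr (_ + _); apply: eq_bigr => i _; congr pair; rewrite scaler0.
Qed.

Lemma prod_tangentP p a u v : M p -> tangent M p u -> tangent M p v ->
  tangent M p (a *: u + v).
Proof.
move=> [Mp1 Mp2] /prod_tangent[u1 u2] /prod_tangent[v1 v2].
by apply/prod_tangent; split; apply: frame_tangent.
Qed.

Lemma prod_fE_bracket i j p : M p ->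
  tangent M p (bracket M (prod_fE i) (prod_fE j) p).
Proof.
move=> Mp; have [Mp1 Mp2] := Mp; rewrite /prod_fE.
have vE1 a := fE_field F1 a; have vE2 a := fE_field F2 a.
have T0 := tangent0 Mp.
case: (fintype.split i) (fintype.split j) => a [] b.
- rewrite bracket_lift11//; apply/prod_tangent; split; last exact: tangent0.
  exact: fE_bracket.
- by rewrite bracket_lift12.
- have -> : bracket M (lift2 (fE F2 a)) (lift1 (fE F1 b)) p =
      - bracket M (lift1 (fE F1 b)) (lift2 (fE F2 a)) p by rewrite /bracket opprB.
  by rewrite bracket_lift12// oppr0.
rewrite bracket_lift22//; apply/prod_tangent; split; first exact: tangent0.
exact: fE_bracket.
Qed.

Definition prod_frame : frame M := @Frame R V M _ prod_fe prod_feps prod_fE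
  prod_feps_continuous prod_basis prod_fE_field prod_span prod_tangentP
  prod_fE_bracket.

End ProductFrame.

Section Tensoriality.
Variables (R : realType) (V : normedModType R) (M : set V) (F : frame M).
Local Notation vf := (vfield F).
Implicit Types (X Y Z : vf) (f : V -> R^o).

Lemma tensor_eq0 (T : vf -> vf) :
  (forall X Y, T (X + Y) = T X + T Y) ->
  (forall f X, smooth M f -> T (fscale f X) = fscale f (T X)) ->
  (forall i, T (frame_field F i) = 0) -> forall X, T X = 0.
Proof.
move=> TD TZ TE X; rewrite (vfield_decomp X).
have T0 : T 0 = 0 by apply: (addrI (T 0)); rewrite -TD !addr0.
rewrite (big_morph T TD T0); apply: big1 => i _; have sc := coord_smooth X i.
by rewrite TZ// TE; apply: vfield_eq => p Mp; rewrite fscaleE// !vfield0E scaler0.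
Qed.

Lemma scalar_tensor_eq0 (T : vf -> R) p :
  (forall X Y, T (X + Y) = T X + T Y) ->
  (forall f X, smooth M f -> T (fscale f X) = f p * T X) ->
  (forall i, T (frame_field F i) = 0) -> forall X, T X = 0.
Proof.
move=> TD TZ TE X; rewrite (vfield_decomp X).
have T0 : T 0 = 0 by apply: (addrI (T 0)); rewrite -TD !addr0.
rewrite (big_morph T TD T0); apply: big1 => i _.
by rewrite TZ ?TE ?mulr0//; exact: coord_smooth.
Qed.

Lemma der_fscale f X f' p : smooth M f -> smooth M f' -> M p ->
  der (fscale f X) f' p = f p * der X f' p.
Proof.
move=> sf sf' Mp; rewrite !derE// fscaleE//.
have Tv : tangent M p (X p) by exact: (vfieldP X).2.
have := @mdiff_dir_sum _ _ _ F _ f' 1 p (fun=> f p) (fun=> X p) Mp sf' (fun=> Tv).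
by rewrite !big_ord1.
Qed.

Lemma vbracketC X Y : vbracket X Y = - vbracket Y X.
Proof.
by apply: vfield_eq => p Mp; rewrite vfieldNE !vbracketE// /bracket opprB.
Qed.

Lemma vbracket_leibniz f X Y : smooth M f ->
  vbracket X (fscale f Y) = fscale (der X f) Y + fscale f (vbracket X Y).
Proof.
move=> sf; apply: vfield_der_eq => f' p sf' Mp; have sX := der_smooth X sf.
rewrite (der_fieldD _ _ sf' Mp) !(der_fscale _ _ sf' Mp)//.
rewrite (der_bracket X _ sf' Mp) (der_bracket X Y sf' Mp).
rewrite (der_fscale _ sf (der_smooth X sf') Mp).
have -> : der X (der (fscale f Y) f') p = der X (fun q => f q * der Y f' q) p.
  congr (_ p); apply: der_eq; last exact: der_smooth.
  by move=> q Mq; rewrite der_fscale.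
by rewrite (derM X sf (der_smooth Y sf') Mp); ring.
Qed.

Lemma vbracketD X Y Z : vbracket X (Y + Z) = vbracket X Y + vbracket X Z.
Proof.
apply: vfield_der_eq => f p sf Mp.
rewrite (der_fieldD _ _ sf Mp) !(der_bracket _ _ sf Mp).
rewrite (der_fieldD _ _ (der_smooth X sf) Mp).
have -> : der X (der (Y + Z) f) p = der X (fun q => der Y f q + der Z f q) p.
  congr (_ p); apply: der_eq; last exact: der_smooth.
  by move=> q Mq; rewrite der_fieldD.
by rewrite (derD X (der_smooth Y sf) (der_smooth Z sf) Mp); ring.
Qed.

Lemma coordD X Y i p : coord (X + Y) i p = coord X i p + coord Y i p.
Proof. by rewrite -[LHS]/(feps F i ((X + Y) p)) vfieldDE linearD. Qed.

Lemma coord_fscale f X i p : smooth M f -> M p ->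
  coord (fscale f X) i p = f p * coord X i p.
Proof.
move=> sf Mp; rewrite -[LHS]/(feps F i (fscale f X p)) fscaleE//.
by rewrite linearZ.
Qed.

Variable G : 'I_(fdim F) -> 'I_(fdim F) -> vf.

(** The connection with [nab E_i E_j = G i j]. *)
Definition frame_nab X Y : vf :=
  \sum_j fscale (der X (coord Y j)) (frame_field F j) +
  \sum_j \sum_i fscale (fun p => coord Y j p * coord X i p) (G i j).

Lemma frame_nabE X Y p : M p -> frame_nab X Y p =
  \sum_j der X (coord Y j) p *: fE F j p +
  \sum_j \sum_i (coord Y j p * coord X i p) *: G i j p.
Proof.
move=> Mp; rewrite /frame_nab vfieldDE !vfield_sumE; congr (_ + _).
  apply: eq_bigr => j _; rewrite fscaleE ?frame_fieldE//.
  by apply: der_smooth; exact: coord_smooth.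
apply: eq_bigr => j _; rewrite vfield_sumE; apply: eq_bigr => i _.
by rewrite fscaleE//; apply: smooth_mul; exact: coord_smooth.
Qed.

Lemma frame_nab_addl X Y Z : frame_nab (X + Y) Z = frame_nab X Z + frame_nab Y Z.
Proof.
apply: vfield_eq => p Mp; rewrite vfieldDE !frame_nabE// addrACA.
congr (_ + _); rewrite -big_split; apply: eq_bigr => j _.
  by rewrite der_fieldD ?scalerDl//; exact: coord_smooth.
by rewrite -big_split; apply: eq_bigr => i _; rewrite coordD mulrDr scalerDl.
Qed.

Lemma frame_nab_addr X Y Z : frame_nab X (Y + Z) = frame_nab X Y + frame_nab X Z.
Proof.
apply: vfield_eq => p Mp; rewrite vfieldDE !frame_nabE// addrACA.
congr (_ + _); rewrite -big_split; apply: eq_bigr => j _.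
  rewrite /= -scalerDl -(derD X (coord_smooth Y j) (coord_smooth Z j) Mp).
  congr (der X _ p *: _); apply/funext => q; exact: coordD.
by rewrite -big_split; apply: eq_bigr => i _; rewrite coordD mulrDl scalerDl.
Qed.

Lemma frame_nab_scalel f X Y : smooth M f ->
  frame_nab (fscale f X) Y = fscale f (frame_nab X Y).
Proof.
move=> sf; apply: vfield_eq => p Mp; rewrite fscaleE// !frame_nabE// scalerDr.
rewrite !scaler_sumr; congr (_ + _); apply: eq_bigr => j _.
  by rewrite der_fscale ?scalerA//; exact: coord_smooth.
rewrite scaler_sumr; apply: eq_bigr => i _.
by rewrite coord_fscale// scalerA; congr (_ *: _); ring.
Qed.

Lemma frame_nab_leibniz f X Y : smooth M f ->
  frame_nab X (fscale f Y) = fscale (der X f) Y + fscale f (frame_nab X Y).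
Proof.
move=> sf; apply: vfield_eq => p Mp; have sX := der_smooth X sf.
rewrite vfieldDE !fscaleE// !frame_nabE//.
rewrite {1}[Y p](fE_span F Mp ((vfieldP Y).2 _ Mp)) scalerDr addrA !scaler_sumr.
congr (_ + _).
  rewrite -big_split; apply: eq_bigr => j _; rewrite /= !scalerA -scalerDl.
  congr (_ *: _); rewrite -(derM X sf (coord_smooth Y j) Mp).
  congr (_ p); apply: der_eq; last exact: coord_smooth.
  by move=> q Mq; rewrite coord_fscale.
apply: eq_bigr => j _; rewrite scaler_sumr; apply: eq_bigr => i _.
by rewrite coord_fscale// scalerA mulrA.
Qed.

End Tensoriality.

Lemma lc_frame_nab (R : realType) (V : normedModType R) (M : set V) (F : frame M)
    g (nab : vfield F -> vfield F -> vfield F) X Y p :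
  levi_civita_field g nab -> M p -> nab X Y p =
  frame_nab (fun i j => nab (frame_field F i) (frame_field F j)) X Y p.
Proof.
move=> HL Mp; rewrite frame_nabE// {1}(vfield_decomp Y).
have nab0 Z : nab Z 0 = 0 by apply: (addrI (nab Z 0)); rewrite -(lc_addr HL) !addr0.
have nabl0 Z : nab 0 Z = 0 by apply: (addrI (nab 0 Z)); rewrite -(lc_addl HL) !addr0.
rewrite (big_morph _ (fun A B => lc_addr HL X A B) (nab0 X)) vfield_sumE -big_split.
apply: eq_bigr => j _; have sY := coord_smooth Y j.
rewrite (lc_leibniz HL)// vfieldDE !fscaleE//; last exact: der_smooth.
rewrite frame_fieldE//; congr (_ + _); rewrite {1}(vfield_decomp X).
rewrite (big_morph (fun Z => nab Z _) (fun A B => lc_addl HL A B _) (nabl0 _)).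
rewrite vfield_sumE scaler_sumr; apply: eq_bigr => i _.
by rewrite (lc_scalel HL) ?fscaleE ?scalerA//; exact: coord_smooth.
Qed.

Section ProductConnection.
Variables (R : realType) (V1 V2 : normedModType R) (M1 : set V1) (M2 : set V2).
Variables (F1 : frame M1) (F2 : frame M2).
Variables (g : V1 -> V1 -> V1 -> R) (h : V2 -> V2 -> V2 -> R).
Variables (nab1 : vfield F1 -> vfield F1 -> vfield F1).
Variables (nab2 : vfield F2 -> vfield F2 -> vfield F2).
Hypotheses (HG1 : riemannian_metric M1 g) (HG2 : riemannian_metric M2 h).
Hypotheses (HL1 : levi_civita_field g nab1) (HL2 : levi_civita_field h nab2).
Local Notation V := (V1 * V2)%type.
Local Notation M := (M1 `*` M2).
Local Notation F := (prod_frame F1 F2).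
Local Notation vf := (vfield F).
Local Notation gh := (product_metric g h).

Definition hor (X : vfield F1) : vf := mkvf F (lift1 X).
Definition ver (X : vfield F2) : vf := mkvf F (lift2 X).

Lemma horE X p : M p -> hor X p = (X p.1, 0).
Proof. by move=> Mp; rewrite mkvfE//; apply: lift1_field; exact: vfieldP. Qed.

Lemma verE X p : M p -> ver X p = (0, X p.2).
Proof. by move=> Mp; rewrite mkvfE//; apply: lift2_field; exact: vfieldP. Qed.

Lemma hor0 : hor 0 = 0.
Proof. by apply: vfield_eq => p Mp; rewrite horE. Qed.

Lemma ver0 : ver 0 = 0.
Proof. by apply: vfield_eq => p Mp; rewrite verE. Qed.

Lemma horB X Y : hor (X - Y) = hor X - hor Y.
Proof.
apply: vfield_eq => p Mp; rewrite vfieldDE vfieldNE !horE//.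
by congr pair; rewrite /= ?subrr// vfieldDE vfieldNE.
Qed.

Lemma verB X Y : ver (X - Y) = ver X - ver Y.
Proof.
apply: vfield_eq => p Mp; rewrite vfieldDE vfieldNE !verE//.
by congr pair; rewrite /= ?subrr// vfieldDE vfieldNE.
Qed.

Lemma frame_field_cases i : (exists a, frame_field F i = hor a) \/
  (exists b, frame_field F i = ver b).
Proof.
case E : (fintype.split (i : 'I_(fdim F1 + fdim F2))) => [a|b]; [left|right].
  exists (frame_field F1 a); apply: vfield_eq => p Mp; have [Mp1 Mp2] := Mp.
  by rewrite horE// !frame_fieldE//= /prod_fE E.
exists (frame_field F2 b); apply: vfield_eq => p Mp; have [Mp1 Mp2] := Mp.
by rewrite verE// !frame_fieldE//= /prod_fE E.
Qed.

Lemma der_hor_fst X (f : V1 -> R^o) p : smooth M1 f -> M p ->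
  der (hor X) (fun q => f q.1) p = der X f p.1.
Proof.
move=> sf Mp; have [Mp1 Mp2] := Mp.
have TX : tangent M p (hor X p) := (vfieldP (hor X)).2 p Mp.
rewrite (derE _ _ Mp) (mdiff_fst sf Mp TX).
by rewrite (derE _ _ Mp1) horE.
Qed.

Lemma der_ver_fst X (f : V1 -> R^o) p : smooth M1 f -> M p ->
  der (ver X) (fun q => f q.1) p = 0.
Proof.
move=> sf Mp; have [Mp1 Mp2] := Mp.
have TX : tangent M p (ver X p) := (vfieldP (ver X)).2 p Mp.
rewrite (derE _ _ Mp) (mdiff_fst sf Mp TX).
by rewrite verE// mdiff_dir0.
Qed.

Lemma der_ver_snd X (f : V2 -> R^o) p : smooth M2 f -> M p ->
  der (ver X) (fun q => f q.2) p = der X f p.2.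
Proof.
move=> sf Mp; have [Mp1 Mp2] := Mp.
have TX : tangent M p (ver X p) := (vfieldP (ver X)).2 p Mp.
rewrite (derE _ _ Mp) (mdiff_snd sf Mp TX).
by rewrite (derE _ _ Mp2) verE.
Qed.

Lemma der_hor_snd X (f : V2 -> R^o) p : smooth M2 f -> M p ->
  der (hor X) (fun q => f q.2) p = 0.
Proof.
move=> sf Mp; have [Mp1 Mp2] := Mp.
have TX : tangent M p (hor X p) := (vfieldP (hor X)).2 p Mp.
rewrite (derE _ _ Mp) (mdiff_snd sf Mp TX).
by rewrite horE// mdiff_dir0.
Qed.

Lemma coord_prod (X : vf) i p : coord X i p =
  match fintype.split i with
  | inl a => feps F1 a (X p).1 | inr b => feps F2 b (X p).2 end.
Proof. by rewrite /coord/= /prod_feps; case: fintype.split. Qed.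

Definition prod_G (i j : 'I_(fdim F)) : vf :=
  match fintype.split i, fintype.split j with
  | inl a, inl b => hor (nab1 (frame_field F1 a) (frame_field F1 b))
  | inr a, inr b => ver (nab2 (frame_field F2 a) (frame_field F2 b))
  | _, _ => 0 end.

Definition prod_nab : vf -> vf -> vf := locked_with tensor_key (frame_nab prod_G).

Lemma prod_nab_addl X Y Z : prod_nab (X + Y) Z = prod_nab X Z + prod_nab Y Z.
Proof. by rewrite /prod_nab locked_withE; exact: frame_nab_addl. Qed.

Lemma prod_nab_addr X Y Z : prod_nab X (Y + Z) = prod_nab X Y + prod_nab X Z.
Proof. by rewrite /prod_nab locked_withE; exact: frame_nab_addr. Qed.

Lemma prod_nab_scalel f X Y : smooth M f ->
  prod_nab (fscale f X) Y = fscale f (prod_nab X Y).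
Proof. by rewrite /prod_nab locked_withE; exact: frame_nab_scalel. Qed.

Lemma prod_nab_leibniz f X Y : smooth M f ->
  prod_nab X (fscale f Y) = fscale (der X f) Y + fscale f (prod_nab X Y).
Proof. by rewrite /prod_nab locked_withE; exact: frame_nab_leibniz. Qed.

Lemma der_coord_prod (X Y : vf) i p : M p -> der X (coord Y i) p =
  match fintype.split i with
  | inl a => der X (fun q => feps F1 a (Y q).1) p
  | inr b => der X (fun q => feps F2 b (Y q).2) p end.
Proof.
move=> Mp; case E : (fintype.split i) => [a|b]; congr (der _ _ p);
  by apply/funext => q; rewrite coord_prod E.
Qed.

Lemma der_off X (f : V -> R^o) p : (forall q, M q -> f q = 0) -> M p ->
  der (X : vf) f p = 0.
Proof.
move=> f0 Mp; rewrite -(@der_eq _ _ _ _ _ (fun=> 0) f) ?der_cst//.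
  by move=> q /f0.
exact: smooth_fun_cst.
Qed.

Lemma prod_nabE (X Y : vf) p : M p -> prod_nab X Y p =
  (\sum_a der X (fun q => feps F1 a (Y q).1) p *: fE F1 a p.1 +
   \sum_b \sum_a (feps F1 b (Y p).1 * feps F1 a (X p).1) *:
     nab1 (frame_field F1 a) (frame_field F1 b) p.1,
   \sum_a der X (fun q => feps F2 a (Y q).2) p *: fE F2 a p.2 +
   \sum_b \sum_a (feps F2 b (Y p).2 * feps F2 a (X p).2) *:
     nab2 (frame_field F2 a) (frame_field F2 b) p.2).
Proof.
move=> Mp; rewrite /prod_nab locked_withE frame_nabE//.
have -> : forall a b a' b', (a + a', b + b') = (a, b) + (a', b') :> V by [].
congr (_ + _).
  rewrite prod_sum -pair_sum; congr (_ + _); apply: eq_bigr => a _.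
    rewrite der_coord_prod// (unsplitK (inl _ a)) /= /prod_fE (unsplitK (inl _ a)).
    by congr pair; rewrite scaler0.
  rewrite der_coord_prod// (unsplitK (inr _ a)) /= /prod_fE (unsplitK (inr _ a)).
  by congr pair; rewrite scaler0.
rewrite prod_sum -pair_sum; congr (_ + _); apply: eq_bigr => b _.
  rewrite prod_sum [X in _ + X]big1 ?addr0.
    have -> : (\sum_a (feps F1 b (Y p).1 * feps F1 a (X p).1) *:
      nab1 (frame_field F1 a) (frame_field F1 b) p.1, 0) = inll V1 V2
      (\sum_a (feps F1 b (Y p).1 * feps F1 a (X p).1) *:
      nab1 (frame_field F1 a) (frame_field F1 b) p.1) by [].
    rewrite linear_sum; apply: eq_bigr => a _; rewrite !coord_prod /prod_G.
    rewrite !(unsplitK (inl _ _)) horE//.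
    by congr pair; rewrite scaler0.
  move=> a _; rewrite /prod_G (unsplitK (inl _ _)) (unsplitK (inr _ _)).
  by rewrite vfield0E scaler0.
rewrite prod_sum [X in X + _]big1 ?add0r.
  have -> : (0, \sum_a (feps F2 b (Y p).2 * feps F2 a (X p).2) *:
    nab2 (frame_field F2 a) (frame_field F2 b) p.2) = inrl V1 V2
    (\sum_a (feps F2 b (Y p).2 * feps F2 a (X p).2) *:
    nab2 (frame_field F2 a) (frame_field F2 b) p.2) by [].
  rewrite linear_sum; apply: eq_bigr => a _; rewrite !coord_prod /prod_G.
  rewrite !(unsplitK (inr _ _)) verE//.
  by congr pair; rewrite scaler0.
move=> a _; rewrite /prod_G (unsplitK (inl _ _)) (unsplitK (inr _ _)).
by rewrite vfield0E scaler0.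
Qed.

Lemma nab_hor_hor X Y : prod_nab (hor X) (hor Y) = hor (nab1 X Y).
Proof.
apply: vfield_eq => p Mp; have [Mp1 Mp2] := Mp.
rewrite (prod_nabE _ _ Mp) (horE (nab1 X Y) Mp).
rewrite (lc_frame_nab _ _ HL1 Mp1) (frame_nabE _ _ _ Mp1).
congr pair; last first.
  rewrite !big1 ?addr0// => b _.
    by rewrite big1// => a _; rewrite !horE//= !linear0 mul0r scale0r.
  rewrite der_off ?scale0r// => q Mq.
  by rewrite horE//= linear0.
congr (_ + _); apply: eq_bigr => b _.
  rewrite -(der_hor_fst X (coord_smooth Y b) Mp).
  congr (_ *: _); congr (_ p); apply: der_eq => [q Mq|]; first by rewrite horE.
  have := coord_smooth (hor Y) (lshift _ b : 'I_(fdim F)).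
  apply: eq_smooth => q Mq; rewrite coord_prod.
  by rewrite (unsplitK (inl _ b)).
by apply: eq_bigr => a _; rewrite !horE.
Qed.

Lemma nab_ver_ver X Y : prod_nab (ver X) (ver Y) = ver (nab2 X Y).
Proof.
apply: vfield_eq => p Mp; have [Mp1 Mp2] := Mp.
rewrite (prod_nabE _ _ Mp) (verE (nab2 X Y) Mp).
rewrite (lc_frame_nab _ _ HL2 Mp2) (frame_nabE _ _ _ Mp2).
congr pair.
  rewrite !big1 ?addr0// => b _.
    by rewrite big1// => a _; rewrite !verE//= !linear0 mul0r scale0r.
  rewrite der_off ?scale0r// => q Mq.
  by rewrite verE//= linear0.
congr (_ + _); apply: eq_bigr => b _.
  rewrite -(der_ver_snd X (coord_smooth Y b) Mp).
  congr (_ *: _); congr (_ p); apply: der_eq => [q Mq|]; first by rewrite verE.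
  have := coord_smooth (ver Y) (rshift _ b : 'I_(fdim F)).
  apply: eq_smooth => q Mq; rewrite coord_prod.
  by rewrite (unsplitK (inr _ b)).
by apply: eq_bigr => a _; rewrite !verE.
Qed.

Lemma nab_hor_ver X Y : prod_nab (hor X) (ver Y) = 0.
Proof.
apply: vfield_eq => p Mp; have [Mp1 Mp2] := Mp.
rewrite (prod_nabE _ _ Mp) vfield0E; congr pair.
  rewrite big1 ?add0r => [|b _].
    apply: big1 => b _; apply: big1 => a _.
    by rewrite (_ : (ver Y p).1 = 0) ?linear0 ?mul0r ?scale0r// verE.
  rewrite der_off ?scale0r// => q Mq.
  by rewrite verE//= linear0.
  rewrite big1 ?add0r => [|b _].
    apply: big1 => b _; apply: big1 => a _.
    by rewrite (_ : (hor X p).2 = 0) ?linear0 ?mulr0 ?scale0r// horE.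
  have -> : der (hor X) (fun q => feps F2 b (ver Y q).2) p =
      der (hor X) (fun q => coord Y b q.2) p.
    congr (_ p); apply: der_eq => [q Mq|]; first by rewrite verE.
    have := coord_smooth (ver Y) (rshift _ b : 'I_(fdim F)).
    apply: eq_smooth => q Mq; rewrite coord_prod.
    by rewrite (unsplitK (inr _ b)).
  by rewrite der_hor_snd ?scale0r//; exact: coord_smooth.
Qed.

Lemma nab_ver_hor X Y : prod_nab (ver X) (hor Y) = 0.
Proof.
apply: vfield_eq => p Mp; have [Mp1 Mp2] := Mp.
rewrite (prod_nabE _ _ Mp) vfield0E; congr pair.
  rewrite big1 ?add0r => [|b _].
    apply: big1 => b _; apply: big1 => a _.
    by rewrite (_ : (ver X p).1 = 0) ?linear0 ?mulr0 ?scale0r// verE.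
  have -> : der (ver X) (fun q => feps F1 b (hor Y q).1) p =
      der (ver X) (fun q => coord Y b q.1) p.
    congr (_ p); apply: der_eq => [q Mq|]; first by rewrite horE.
    have := coord_smooth (hor Y) (lshift _ b : 'I_(fdim F)).
    apply: eq_smooth => q Mq; rewrite coord_prod.
    by rewrite (unsplitK (inl _ b)).
  by rewrite der_ver_fst ?scale0r//; exact: coord_smooth.
  rewrite big1 ?add0r => [|b _].
    apply: big1 => b _; apply: big1 => a _.
    by rewrite (_ : (hor Y p).2 = 0) ?linear0 ?mul0r ?scale0r// horE.
  rewrite der_off ?scale0r// => q Mq.
  by rewrite horE//= linear0.
Qed.

End ProductConnection.

Section ProductMetric.
Variables (R : realType) (V1 V2 : normedModType R) (M1 : set V1) (M2 : set V2).
Variables (F1 : frame M1) (F2 : frame M2).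
Variables (g : V1 -> V1 -> V1 -> R) (h : V2 -> V2 -> V2 -> R).
Variables (nab1 : vfield F1 -> vfield F1 -> vfield F1).
Variables (nab2 : vfield F2 -> vfield F2 -> vfield F2).
Hypotheses (HG1 : riemannian_metric M1 g) (HG2 : riemannian_metric M2 h).
Hypotheses (HL1 : levi_civita_field g nab1) (HL2 : levi_civita_field h nab2).
Local Notation V := (V1 * V2)%type.
Local Notation M := (M1 `*` M2).
Local Notation F := (prod_frame F1 F2).
Local Notation vf := (vfield F).
Local Notation gh := (product_metric g h).
Local Notation prod_nab := (prod_nab nab1 nab2).
Local Notation hor := (@hor _ _ _ _ _ F1 F2).
Local Notation ver := (@ver _ _ _ _ _ F1 F2).

Lemma prod_tangent1 (X : vf) p : M p -> tangent M1 p.1 (X p).1.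
Proof. by move=> Mp; have /prod_tangent[] := (vfieldP X).2 p Mp. Qed.

Lemma prod_tangent2 (X : vf) p : M p -> tangent M2 p.2 (X p).2.
Proof. by move=> Mp; have /prod_tangent[] := (vfieldP X).2 p Mp. Qed.

Definition gpart (p : V) (X Y : vf) : R := g p.1 (X p).1 (Y p).1.
Definition hpart (p : V) (X Y : vf) : R := h p.2 (X p).2 (Y p).2.

Lemma gpart_smooth X Y : smooth M (fun p => gpart p X Y : R^o).
Proof.
apply: (eq_smooth (f := fun p => \sum_a \sum_b
  (feps F1 a (X p).1 * feps F1 b (Y p).1) *:
  (ip g p.1 (frame_field F1 a) (frame_field F1 b) : R^o))).
  move=> p Mp; have [Mp1 Mp2] := Mp; have T1 := prod_tangent1 X Mp.
  have T2 := prod_tangent1 Y Mp; rewrite /gpart.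
  have TE a : tangent M1 p.1 (fE F1 a p.1) by exact: (fE_field F1 a).2.
  have ex v w : tangent M1 p.1 v -> tangent M1 p.1 w ->
      g p.1 v w = \sum_a feps F1 a v * g p.1 (fE F1 a p.1) w.
    move=> Tv Tw; rewrite {1}(fE_span F1 Mp1 Tv).
    exact: (metric_sum F1 HG1 (fun a => feps F1 a v) Mp1 TE Tw).
  rewrite (ex _ _ T1 T2); apply: eq_bigr => a _.
  rewrite (Defs.metric_sym HG1 Mp1 (TE a) T2) (ex _ _ T2 (TE a)) mulr_sumr.
  apply: eq_bigr => b _; rewrite /ip !frame_fieldE//.
  by rewrite (Defs.metric_sym HG1 Mp1 (TE a) (TE b)) mulrA.
apply: smooth_sum => a; apply: smooth_sum => b.
apply: (smooth_scale (f := fun p => feps F1 a (X p).1 * feps F1 b (Y p).1 : R^o)).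
  have sc (Z : vf) c : smooth M (fun p => feps F1 c (Z p).1 : R^o).
    have := coord_smooth Z (lshift _ c : 'I_(fdim F)).
    by apply: eq_smooth => q Mq; rewrite coord_prod (unsplitK (inl _ c)).
  exact: smooth_mul.
exact: (smooth_fst (ip_smooth HG1 _ _)).
Qed.

Lemma hpart_smooth X Y : smooth M (fun p => hpart p X Y : R^o).
Proof.
apply: (eq_smooth (f := fun p => \sum_a \sum_b
  (feps F2 a (X p).2 * feps F2 b (Y p).2) *:
  (ip h p.2 (frame_field F2 a) (frame_field F2 b) : R^o))).
  move=> p Mp; have [Mp1 Mp2] := Mp; have T1 := prod_tangent2 X Mp.
  have T2 := prod_tangent2 Y Mp; rewrite /hpart.
  have TE a : tangent M2 p.2 (fE F2 a p.2) by exact: (fE_field F2 a).2.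
  have ex v w : tangent M2 p.2 v -> tangent M2 p.2 w ->
      h p.2 v w = \sum_a feps F2 a v * h p.2 (fE F2 a p.2) w.
    move=> Tv Tw; rewrite {1}(fE_span F2 Mp2 Tv).
    exact: (metric_sum F2 HG2 (fun a => feps F2 a v) Mp2 TE Tw).
  rewrite (ex _ _ T1 T2); apply: eq_bigr => a _.
  rewrite (Defs.metric_sym HG2 Mp2 (TE a) T2) (ex _ _ T2 (TE a)) mulr_sumr.
  apply: eq_bigr => b _; rewrite /ip !frame_fieldE//.
  by rewrite (Defs.metric_sym HG2 Mp2 (TE a) (TE b)) mulrA.
apply: smooth_sum => a; apply: smooth_sum => b.
apply: (smooth_scale (f := fun p => feps F2 a (X p).2 * feps F2 b (Y p).2 : R^o)).
  have sc (Z : vf) c : smooth M (fun p => feps F2 c (Z p).2 : R^o).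
    have := coord_smooth Z (rshift _ c : 'I_(fdim F)).
    by apply: eq_smooth => q Mq; rewrite coord_prod (unsplitK (inr _ c)).
  exact: smooth_mul.
exact: (smooth_snd (ip_smooth HG2 _ _)).
Qed.

Lemma prod_riemannian : riemannian_metric M gh.
Proof.
split.
- move=> p u v w a [Mp1 Mp2] /prod_tangent[u1 u2] /prod_tangent[v1 v2].
  move=> /prod_tangent[w1 w2]; rewrite /product_metric.
  by rewrite (metric_linear HG1)// (metric_linear HG2)//; ring.
- move=> p u v [Mp1 Mp2] /prod_tangent[u1 u2] /prod_tangent[v1 v2].
  by rewrite /product_metric (Defs.metric_sym HG1 Mp1 u1 v1) (Defs.metric_sym HG2 Mp2 u2 v2).
- move=> p u [Mp1 Mp2] /prod_tangent[u1 u2] u0; rewrite /product_metric.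
  have := metric_ge0 HG1 Mp1 u1; have := metric_ge0 HG2 Mp2 u2 => h2 h1.
  have [u10|u10] := eqVneq u.1 0.
    have u20 : u.2 != 0.
      by apply/eqP => u20; move/eqP: u0; apply; rewrite [u]surjective_pairing u10 u20.
    by apply: ltr_wpDl => //; exact: (metric_pos HG2).
  by apply: ltr_pwDl => //; exact: (metric_pos HG1).
move=> X Y vX vY.
apply: (eq_smooth (f := fun p => gpart p (mkvf F X) (mkvf F Y) + hpart p (mkvf F X) (mkvf F Y) : R^o)).
  by move=> p Mp; rewrite /gpart /hpart !mkvfE.
apply: (smoothD (f := fun p => gpart p _ _ : R^o)); first exact: gpart_smooth.
exact: hpart_smooth.
Qed.


Lemma vbracket_hor X Y : vbracket (hor X) (hor Y) = hor (vbracket X Y).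
Proof.
apply: vfield_eq => p Mp; have [Mp1 Mp2] := Mp.
rewrite horE// !vbracketE//.
rewrite -(bracket_lift11 (vfieldP X) (vfieldP Y) Mp).
have hE (Z : vfield F1) q : M q -> hor Z q = lift1 Z q by move=> Mq; rewrite horE.
have lv (Z : vfield F1) : vector_field M (lift1 Z).
  by apply: lift1_field; exact: vfieldP.
exact: (bracket_eq (vfieldP _) (lv X) (vfieldP _) (lv Y) (hE X) (hE Y) Mp).
Qed.

Lemma vbracket_ver X Y : vbracket (ver X) (ver Y) = ver (vbracket X Y).
Proof.
apply: vfield_eq => p Mp; have [Mp1 Mp2] := Mp.
rewrite verE// !vbracketE//.
rewrite -(bracket_lift22 (vfieldP X) (vfieldP Y) Mp).
have hE (Z : vfield F2) q : M q -> ver Z q = lift2 Z q by move=> Mq; rewrite verE.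
have lv (Z : vfield F2) : vector_field M (lift2 Z).
  by apply: lift2_field; exact: vfieldP.
exact: (bracket_eq (vfieldP _) (lv X) (vfieldP _) (lv Y) (hE X) (hE Y) Mp).
Qed.

Lemma vbracket_hor_ver X Y : vbracket (hor X) (ver Y) = 0.
Proof.
apply: vfield_eq => p Mp; rewrite vbracketE// vfield0E.
rewrite -(bracket_lift12 (vfieldP X) (vfieldP Y) Mp).
have hE (Z : vfield F1) q : M q -> hor Z q = lift1 Z q by move=> Mq; rewrite horE.
have vE (Z : vfield F2) q : M q -> ver Z q = lift2 Z q by move=> Mq; rewrite verE.
apply: (bracket_eq (vfieldP _) _ (vfieldP _) _ (hE X) (vE Y) Mp).
  by apply: lift1_field; exact: vfieldP.
by apply: lift2_field; exact: vfieldP.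
Qed.

Lemma zmod_torsionC (U : zmodType) (a b c : U) : a - b - c = - (b - a - - c).
Proof. by rewrite [RHS]opprB opprB addrC. Qed.

Lemma zmod_torsionD (U : zmodType) (a b c a' b' c' : U) :
  a + a' - (b + b') - (c + c') = a - b - c + (a' - b' - c').
Proof. by rewrite (opprD b) (addrACA a) (opprD c) (addrACA (a - b)). Qed.

Lemma zmod_torsionZ (U : zmodType) (d a b c : U) : d + a - b - (d + c) = a - b - c.
Proof. by rewrite -(addrA d) (addrC d) (addrC d c) opprD addrA addrAC addrK. Qed.

Lemma prod_torsion X Y : prod_nab X Y - prod_nab Y X = vbracket X Y.
Proof.
pose T X Y := prod_nab X Y - prod_nab Y X - vbracket X Y.
suff : T X Y = 0 by move=> /eqP; rewrite subr_eq0 => /eqP.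
have TC A B : T A B = - T B A.
  by rewrite /T (vbracketC B A); exact: zmod_torsionC.
have TD A B C : T A (B + C) = T A B + T A C.
  by rewrite /T vbracketD prod_nab_addr prod_nab_addl; exact: zmod_torsionD.
have TZ f A B : smooth M f -> T A (fscale f B) = fscale f (T A B).
  move=> sf; rewrite /T vbracket_leibniz// prod_nab_leibniz// prod_nab_scalel//.
  apply: vfield_eq => p Mp; rewrite fscaleE// 2!vfieldDE !vfieldNE !vfieldDE !vfieldNE.
  have sd := der_smooth A sf; rewrite !fscaleE// 2!scalerBr.
  exact: zmod_torsionZ.
have red : (forall i j, T (frame_field F i) (frame_field F j) = 0) -> T X Y = 0.
  move=> T0; apply: (tensor_eq0 (T := T X)) => [A B|f A sf|i]; first exact: TD.
    exact: TZ.
  rewrite TC -[RHS]oppr0; congr (- _).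
  by apply: (tensor_eq0 (T := T _)) => [A B|f A sf|j]; [exact: TD|exact: TZ|].
apply: red => i j; rewrite /T.
case: (frame_field_cases i) => -[a ->];
  case: (frame_field_cases j) => -[b ->].
- rewrite !(nab_hor_hor _ HL1) vbracket_hor -!horB -(lc_torsion HL1) subrr.
  exact: hor0.
- by rewrite nab_hor_ver nab_ver_hor vbracket_hor_ver !subr0.
- by rewrite nab_hor_ver nab_ver_hor vbracketC vbracket_hor_ver !oppr0 !addr0.
rewrite !(nab_ver_ver _ HL2) vbracket_ver -!verB -(lc_torsion HL2) subrr.
exact: ver0.
Qed.

Lemma ip_prod p (X Y : vf) : ip gh p X Y = gpart p X Y + hpart p X Y.
Proof. by []. Qed.

Lemma gpart_hor p X Y : M p -> gpart p (hor X) (hor Y) = ip g p.1 X Y.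
Proof. by move=> Mp; rewrite /gpart !horE. Qed.

Lemma hpart_ver p X Y : M p -> hpart p (ver X) (ver Y) = ip h p.2 X Y.
Proof. by move=> Mp; rewrite /hpart !verE. Qed.

Lemma gpart_ver p X (Y : vf) : M p -> gpart p (ver X) Y = 0.
Proof.
move=> Mp; have [Mp1 Mp2] := Mp; rewrite /gpart verE//.
exact: (metric0l HG1 Mp1 (prod_tangent1 Y Mp)).
Qed.

Lemma hpart_hor p X (Y : vf) : M p -> hpart p (hor X) Y = 0.
Proof.
move=> Mp; have [Mp1 Mp2] := Mp; rewrite /hpart horE//.
exact: (metric0l HG2 Mp2 (prod_tangent2 Y Mp)).
Qed.

Lemma gpart_sym p X Y : M p -> gpart p X Y = gpart p Y X.
Proof.
move=> Mp; have [Mp1 Mp2] := Mp.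
exact: (Defs.metric_sym HG1 Mp1 (prod_tangent1 X Mp) (prod_tangent1 Y Mp)).
Qed.

Lemma hpart_sym p X Y : M p -> hpart p X Y = hpart p Y X.
Proof.
move=> Mp; have [Mp1 Mp2] := Mp.
exact: (Defs.metric_sym HG2 Mp2 (prod_tangent2 X Mp) (prod_tangent2 Y Mp)).
Qed.

Lemma gpartD p X Y Z : M p -> gpart p (X + Y) Z = gpart p X Z + gpart p Y Z.
Proof.
move=> Mp; have [Mp1 Mp2] := Mp; rewrite /gpart.
have := metric_linear HG1 1 Mp1 (prod_tangent1 X Mp) (prod_tangent1 Y Mp) (prod_tangent1 Z Mp).
by rewrite scale1r mul1r.
Qed.

Lemma hpartD p X Y Z : M p -> hpart p (X + Y) Z = hpart p X Z + hpart p Y Z.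
Proof.
move=> Mp; have [Mp1 Mp2] := Mp; rewrite /hpart.
have := metric_linear HG2 1 Mp2 (prod_tangent2 X Mp) (prod_tangent2 Y Mp) (prod_tangent2 Z Mp).
by rewrite scale1r mul1r.
Qed.

Lemma gpart_scale p f X Y : smooth M f -> M p ->
  gpart p (fscale f X) Y = f p * gpart p X Y.
Proof.
move=> sf Mp; have [Mp1 Mp2] := Mp; rewrite /gpart fscaleE//.
exact: (metricZ HG1 (f p) Mp1 (prod_tangent1 X Mp) (prod_tangent1 Y Mp)).
Qed.

Lemma hpart_scale p f X Y : smooth M f -> M p ->
  hpart p (fscale f X) Y = f p * hpart p X Y.
Proof.
move=> sf Mp; have [Mp1 Mp2] := Mp; rewrite /hpart fscaleE//.
exact: (metricZ HG2 (f p) Mp2 (prod_tangent2 X Mp) (prod_tangent2 Y Mp)).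
Qed.

Let HG := prod_riemannian.

Lemma prod_metric_frame X Y Z p : M p ->
  (exists a, X = hor a) \/ (exists b, X = ver b) ->
  (exists a, Y = hor a) \/ (exists b, Y = ver b) ->
  (exists a, Z = hor a) \/ (exists b, Z = ver b) ->
  der X (fun q => ip gh q Y Z) p =
  ip gh p (prod_nab X Y) Z + ip gh p Y (prod_nab X Z).
Proof.
move=> Mp hX hY hZ; have [Mp1 Mp2] := Mp.
have vhor A B q : M q -> ip gh q (ver A) (hor B) = 0.
  move=> Mq; rewrite ip_prod gpart_ver// hpart_sym// hpart_hor//; lra.
have horv A B q : M q -> ip gh q (hor B) (ver A) = 0.
  by move=> Mq; rewrite (ip_sym HG)// vhor.
have i0 (A : vf) q : M q -> ip gh q 0 A = 0.
  by move=> Mq; rewrite /ip vfield0E; exact: (metric0l HG Mq (tangentP A Mq)).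
have i0r (A : vf) q : M q -> ip gh q A 0 = 0 by move=> Mq; rewrite (ip_sym HG)// i0.
have hh A B q : M q -> ip gh q (hor A) (hor B) = ip g q.1 A B.
  by move=> Mq; rewrite ip_prod gpart_hor// hpart_hor// addr0.
have vv A B q : M q -> ip gh q (ver A) (ver B) = ip h q.2 A B.
  by move=> Mq; rewrite ip_prod hpart_ver// gpart_ver// add0r.
have dhh (W : vf) A B : der W (fun q => ip gh q (hor A) (hor B)) p =
    der W (fun q => ip g q.1 A B) p.
  by rewrite (der_eq W (hh A B) (ip_smooth HG _ _)).
have dvv (W : vf) A B : der W (fun q => ip gh q (ver A) (ver B)) p =
    der W (fun q => ip h q.2 A B) p.
  by rewrite (der_eq W (vv A B) (ip_smooth HG _ _)).
case: hX => -[a ->]; case: hY => -[b ->]; case: hZ => -[c ->].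
- rewrite dhh (der_hor_fst F2 a (ip_smooth HG1 b c) Mp) !(nab_hor_hor _ HL1) !hh//.
  exact: (lc_metric HL1).
- rewrite (der_off _ (horv c b) Mp) (nab_hor_hor _ HL1) nab_hor_ver.
  by rewrite horv// i0r// addr0.
- rewrite (der_off _ (vhor b c) Mp) (nab_hor_hor _ HL1) nab_hor_ver.
  by rewrite vhor// i0// addr0.
- rewrite dvv (der_hor_snd F2 a (ip_smooth HG2 b c) Mp) !nab_hor_ver.
  by rewrite i0// i0r// addr0.
- rewrite dhh (der_ver_fst F1 a (ip_smooth HG1 b c) Mp) !nab_ver_hor.
  by rewrite i0// i0r// addr0.
- rewrite (der_off _ (horv c b) Mp) (nab_ver_ver _ HL2) nab_ver_hor.
  by rewrite horv// i0// addr0.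
- rewrite (der_off _ (vhor b c) Mp) (nab_ver_ver _ HL2) nab_ver_hor.
  by rewrite vhor// i0r// addr0.
rewrite dvv (der_ver_snd F1 a (ip_smooth HG2 b c) Mp) !(nab_ver_ver _ HL2) !vv//.
exact: (lc_metric HL2).
Qed.

Lemma prod_metric X Y Z p : M p -> der X (fun q => ip gh q Y Z) p =
  ip gh p (prod_nab X Y) Z + ip gh p Y (prod_nab X Z).
Proof.
move=> Mp; pose S X Y Z := der X (fun q => ip gh q Y Z) p -
  (ip gh p (prod_nab X Y) Z + ip gh p Y (prod_nab X Z)).
suff : S X Y Z = 0 by move=> /eqP; rewrite subr_eq0 => /eqP.
have sip (A B : vf) : smooth M (fun q => ip gh q A B : R^o) by exact: (ip_smooth HG).
have iD (A B C : vf) : ip gh p (A + B) C = ip gh p A C + ip gh p B C by exact: (ipD HG).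
have iDr (A B C : vf) : ip gh p C (A + B) = ip gh p C A + ip gh p C B.
  by rewrite !(ip_sym HG C) ?iD.
have iS f (A B : vf) : smooth M f -> ip gh p (fscale f A) B = f p * ip gh p A B.
  by move=> sf; exact: (ip_scale HG).
have iSr f (A B : vf) : smooth M f -> ip gh p B (fscale f A) = f p * ip gh p B A.
  by move=> sf; rewrite !(ip_sym HG B) ?iS.
have SC A B C : S A B C = S A C B.
  rewrite /S; have -> : der A (fun q => ip gh q B C) p = der A (fun q => ip gh q C B) p.
    by rewrite (der_eq A (fun q Mq => ip_sym HG B C Mq) (sip _ _)).
  by rewrite (ip_sym HG _ C)// (ip_sym HG B)//; ring.
have SDr A B B' C : S A (B + B') C = S A B C + S A B' C.
  rewrite /S; have -> : der A (fun q => ip gh q (B + B') C) p =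
      der A (fun q => ip gh q B C + ip gh q B' C) p.
    by rewrite (der_eq A (fun q Mq => ipD HG B B' C Mq) (sip _ _)).
  by rewrite (derD A (sip B C) (sip B' C) Mp) prod_nab_addr !(iD, iDr); ring.
have SZr f A B C : smooth M f -> S A (fscale f B) C = f p * S A B C.
  move=> sf; have sd := der_smooth A sf.
  rewrite /S; have -> : der A (fun q => ip gh q (fscale f B) C) p =
      der A (fun q => f q * ip gh q B C) p.
    by rewrite (der_eq A (fun q Mq => ip_scale HG B C sf Mq) (sip _ _)).
  rewrite (derM A sf (sip B C) Mp) prod_nab_leibniz// !(iD, iDr) !iS//; ring.
have red : (forall i j k, S (frame_field F i) (frame_field F j) (frame_field F k) = 0) ->
    S X Y Z = 0.
  move=> S0; apply: (scalar_tensor_eq0 (T := fun A => S A Y Z) (p := p)).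
  - move=> A B; rewrite /S (der_fieldD _ _ (sip Y Z) Mp) !prod_nab_addl !(iD, iDr); ring.
  - move=> f A sf; rewrite /S (der_fscale _ sf (sip Y Z) Mp) !prod_nab_scalel// iS// iSr//; ring.
  move=> i; apply: (scalar_tensor_eq0 (T := fun A => S _ A Z) (p := p)) => //.
  - by move=> *; exact: SZr.
  move=> j; rewrite SC; apply: (scalar_tensor_eq0 (T := fun A => S _ A _) (p := p)) => //.
  by move=> *; exact: SZr.
apply: red => i j k; rewrite /S prod_metric_frame ?subrr//; exact: frame_field_cases.
Qed.

Lemma prod_levi_civita : levi_civita_field gh prod_nab.
Proof.
split=> [X Y Z|X Y Z|f X Y sf|f X Y sf|X Y|X Y Z p Mp].
- exact: prod_nab_addl.
- exact: prod_nab_addr.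
- exact: prod_nab_scalel.
- exact: prod_nab_leibniz.
- exact: prod_torsion.
- exact: prod_metric.
Qed.

Section Curvature.
Variables k1 k2 : R.
Hypotheses (curv1 : forall p U X W Z, M1 p -> ip g p (riem nab1 U X W) Z =
    k1 * (ip g p X W * ip g p U Z - ip g p U W * ip g p X Z))
  (curv2 : forall p U X W Z, M2 p -> ip h p (riem nab2 U X W) Z =
    k2 * (ip h p X W * ip h p U Z - ip h p U W * ip h p X Z)).
Let HL := prod_levi_civita.
Let HC := lc_metric_connection HG HL.
Local Notation Rm := (riem prod_nab).

Let nab0 X : prod_nab X 0 = 0.
Proof. by apply: (addrI (prod_nab X 0)); rewrite -prod_nab_addr !addr0. Qed.

Let nab0l X : prod_nab 0 X = 0.
Proof. by apply: (addrI (prod_nab 0 X)); rewrite -prod_nab_addl !addr0. Qed.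

Let lie_hor_hor X Y : lie prod_nab (hor X) (hor Y) = hor (lie nab1 X Y).
Proof. by rewrite !lieE !(nab_hor_hor _ HL1) horB. Qed.

Let lie_ver_ver X Y : lie prod_nab (ver X) (ver Y) = ver (lie nab2 X Y).
Proof. by rewrite !lieE !(nab_ver_ver _ HL2) verB. Qed.

Let lie_hor_ver X Y : lie prod_nab (hor X) (ver Y) = 0.
Proof. by rewrite lieE nab_hor_ver nab_ver_hor subrr. Qed.

Lemma riem_hor X Y Z : Rm (hor X) (hor Y) (hor Z) = hor (riem nab1 X Y Z).
Proof.
rewrite (riemE prod_nab) (riemE nab1) lie_hor_hor !(nab_hor_hor _ HL1).
by rewrite !horB.
Qed.

Lemma riem_ver X Y Z : Rm (ver X) (ver Y) (ver Z) = ver (riem nab2 X Y Z).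
Proof.
rewrite (riemE prod_nab) (riemE nab2) lie_ver_ver !(nab_ver_ver _ HL2).
by rewrite !verB.
Qed.

Lemma riem_hor_hor_ver X Y Z : Rm (hor X) (hor Y) (ver Z) = 0.
Proof. by rewrite riemE lie_hor_hor !nab_hor_ver !nab0 !subr0. Qed.

Lemma riem_ver_ver_hor X Y Z : Rm (ver X) (ver Y) (hor Z) = 0.
Proof. by rewrite riemE lie_ver_ver !nab_ver_hor !nab0 !subr0. Qed.

Lemma riem_hor_ver X Y (Z : vf) : (exists a, Z = hor a) \/ (exists b, Z = ver b) ->
  Rm (hor X) (ver Y) Z = 0.
Proof.
rewrite riemE lie_hor_ver nab0l => -[[a ->]|[a ->]].
  by rewrite (nab_hor_hor _ HL1) !nab_ver_hor nab0 !subr0.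
by rewrite (nab_ver_ver _ HL2) !nab_hor_ver nab0 !subr0.
Qed.

Definition prod_curvature p (U X W Z : vf) : R :=
  k1 * (gpart p X W * gpart p U Z - gpart p U W * gpart p X Z) +
  k2 * (hpart p X W * hpart p U Z - hpart p U W * hpart p X Z).

Lemma gpart_hor_field p X (Z : vf) : M p ->
  gpart p (hor X) Z = ip g p.1 X (field_of F1 (Z p).1).
Proof.
move=> Mp; have [Mp1 Mp2] := Mp.
by rewrite /gpart horE// /ip (field_ofE F1 Mp1 (prod_tangent1 Z Mp)).
Qed.

Lemma hpart_ver_field p X (Z : vf) : M p ->
  hpart p (ver X) Z = ip h p.2 X (field_of F2 (Z p).2).
Proof.
move=> Mp; have [Mp1 Mp2] := Mp.
by rewrite /hpart verE// /ip (field_ofE F2 Mp2 (prod_tangent2 Z Mp)).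
Qed.

Lemma prod_curvature_frame p U X W Z : M p ->
  (exists a, U = hor a) \/ (exists b, U = ver b) ->
  (exists a, X = hor a) \/ (exists b, X = ver b) ->
  (exists a, W = hor a) \/ (exists b, W = ver b) ->
  ip gh p (Rm U X W) Z = prod_curvature p U X W Z.
Proof.
move=> Mp hU hX hW; have [Mp1 Mp2] := Mp.
have i0 : ip gh p 0 Z = 0.
  by rewrite /ip vfield0E; exact: (metric0l HG Mp (tangentP Z Mp)).
have gv a (A : vf) : gpart p A (ver a) = 0 by rewrite gpart_sym// gpart_ver.
have hh a (A : vf) : hpart p A (hor a) = 0 by rewrite hpart_sym// hpart_hor.
rewrite /prod_curvature.
case: hU => -[a ->]; case: hX => -[b ->].
- case: hW => -[c ->].
    rewrite riem_hor ip_prod !hpart_hor// !(gpart_hor_field _ Z Mp) curv1//.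
    by rewrite !gpart_hor//; ring.
  by rewrite riem_hor_hor_ver i0 !gv !hpart_hor//; ring.
- rewrite riem_hor_ver// i0 !gpart_ver// !hpart_hor//; ring.
- rewrite (riem_skewl HG HL) riem_hor_ver// oppr0 i0 !gpart_ver// !hpart_hor//; ring.
case: hW => -[c ->].
  by rewrite riem_ver_ver_hor i0 !hh !gpart_ver//; ring.
rewrite riem_ver ip_prod !gpart_ver// !(hpart_ver_field _ Z Mp) curv2//.
by rewrite !hpart_ver//; ring.
Qed.

(** Both sides are tensorial, so that it suffices to compare them on lifts. *)
Lemma prod_riem p U X W Z : M p ->
  ip gh p (Rm U X W) Z = prod_curvature p U X W Z.
Proof.
move=> Mp; pose S U X W := ip gh p (Rm U X W) Z - prod_curvature p U X W Z.
suff : S U X W = 0 by move=> /eqP; rewrite subr_eq0 => /eqP.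
have iD (A B C : vf) : ip gh p (A + B) C = ip gh p A C + ip gh p B C by exact: (ipD HG).
have gDr (A B C : vf) : gpart p C (A + B) = gpart p C A + gpart p C B.
  by rewrite !(gpart_sym C)// gpartD.
have hDr (A B C : vf) : hpart p C (A + B) = hpart p C A + hpart p C B.
  by rewrite !(hpart_sym C)// hpartD.
have gSr f (A B : vf) : smooth M f -> gpart p B (fscale f A) = f p * gpart p B A.
  by move=> sf; rewrite !(gpart_sym B)// gpart_scale.
have hSr f (A B : vf) : smooth M f -> hpart p B (fscale f A) = f p * hpart p B A.
  by move=> sf; rewrite !(hpart_sym B)// hpart_scale.
have SC A B C : S A B C = - S B A C.
  rewrite /S (riem_skewl HG HL A B) (ipNl HC)// /prod_curvature; ring.
have SDl A A' B C : S (A + A') B C = S A B C + S A' B C.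
  rewrite /S (riem_addl HG HL) iD /prod_curvature !gpartD// !hpartD//; ring.
have SZl f A B C : smooth M f -> S (fscale f A) B C = f p * S A B C.
  move=> sf; rewrite /S (ip_riem_scale HG HL _ _ _ _ sf Mp) /prod_curvature.
  by rewrite !gpart_scale// !hpart_scale//; ring.
have SDr A B C C' : S A B (C + C') = S A B C + S A B C'.
  rewrite /S !(riem_skewr HG HL _ _ _ Z Mp) (ipDr HC)// /prod_curvature.
  by rewrite !gDr !hDr; ring.
have SZr f A B C : smooth M f -> S A B (fscale f C) = f p * S A B C.
  move=> sf; rewrite /S !(riem_skewr HG HL _ _ _ Z Mp) (ip_sym HG _ (fscale _ _))//.
  rewrite (ip_scale HG)// (ip_sym HG C)// /prod_curvature.
  by rewrite !gSr// !hSr//; ring.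
have S0 i j l : S (frame_field F i) (frame_field F j) (frame_field F l) = 0.
  rewrite /S prod_curvature_frame ?subrr//; exact: frame_field_cases.
apply: (scalar_tensor_eq0 (T := fun A => S A X W) (p := p)).
- by move=> *; exact: SDl.
- by move=> *; exact: SZl.
move=> i; rewrite SC; apply/eqP; rewrite oppr_eq0; apply/eqP.
apply: (scalar_tensor_eq0 (T := fun A => S A (frame_field F i) W) (p := p)).
- by move=> *; exact: SDl.
- by move=> *; exact: SZl.
move=> j; apply: (scalar_tensor_eq0
  (T := fun A => S (frame_field F j) (frame_field F i) A) (p := p)).
- by move=> *; exact: SDr.
- by move=> *; exact: SZr.
by move=> l; exact: S0.
Qed.

End Curvature.
End ProductMetric.

Section Splitting.
Variables (R : realType) (V2 : normedModType R) (M2 : set V2) (F2 : frame M2).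
Local Notation V1 := 'rV[R]_3.
Local Notation M1 := (sphere R 2).
Local Notation F1 := (sphere_frame R 2).
Local Notation V := (V1 * V2)%type.
Local Notation M := (M1 `*` M2).
Local Notation F := (prod_frame F1 F2).
Local Notation vf := (vfield F).
Variables (g : V1 -> V1 -> V1 -> R) (h : V2 -> V2 -> V2 -> R) (k1 k2 : R).
Hypotheses (HG1 : riemannian_metric M1 g) (HG2 : riemannian_metric M2 h).
Local Notation gh := (product_metric g h).

Section OrthonormalBasis.
Variables (p e1 e2 : V1).
Hypotheses (Sp : M1 p) (T1 : tangent M1 p e1) (T2 : tangent M1 p e2).
Hypotheses (g11 : g p e1 e1 = 1) (g22 : g p e2 e2 = 1) (g12 : g p e1 e2 = 0).

Lemma orthonormal_basis u : tangent M1 p u ->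
  u = g p u e1 *: e1 + g p u e2 *: e2.
Proof.
move=> Tu; pose w := u - (g p u e1 *: e1 + g p u e2 *: e2).
have TZ a v : tangent M1 p v -> tangent M1 p (a *: v) by exact: (frame_tangentZ F1).
have TD a b : tangent M1 p a -> tangent M1 p b -> tangent M1 p (a + b).
  exact: (frame_tangentD F1).
have Tw : tangent M1 p w.
  by apply: (TD) => //; rewrite -scaleN1r; apply: (TZ); apply: (TD); exact: TZ.
have wE v : tangent M1 p v ->
    g p w v = g p u v - g p u e1 * g p e1 v - g p u e2 * g p e2 v.
  move=> Tv; rewrite /w -scaleN1r addrC (metric_linear HG1)//.
    rewrite (metric_linear HG1)// ?(metricZ HG1)//; try exact: TZ; ring.
  by apply: (TD); exact: TZ.
have w1 : g p w e1 = 0.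
  by rewrite wE// g11 (Defs.metric_sym HG1 Sp T2 T1) g12; ring.
have w2 : g p w e2 = 0 by rewrite wE// g22 g12; ring.
apply/eqP; rewrite -subr_eq0 -/w; apply/negPn/negP => w0.
pose v := fun i : 'I_3 => if val i is 0%N then e1 else if val i is 1%N then e2 else w.
have nz a : g p a a = 1 -> a != 0.
  move=> aa; apply/eqP => a0; move: aa; rewrite a0 (metric0l HG1 Sp (tangent0 Sp)).
  by move=> /esym/eqP; rewrite oner_eq0.
have := sphere_orthogonal_family HG1 Sp (v := v).
suff H : [/\ forall i, tangent M1 p (v i), forall i, v i != 0 &
    forall i j, i != j -> g p (v i) (v j) = 0].
  by case: H => a b c /(_ a b c).
have gsym := Defs.metric_sym HG1 Sp.
split.
- by move=> [[|[|[|?]]] ?].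
- by move=> [[|[|[|?]]] ?] //=; exact: nz.
move=> [[|[|[|?]]] ?] [[|[|[|?]]] ?] //= _; rewrite /v/= ?g12 ?w1 ?w2//.
- by rewrite gsym.
- by rewrite gsym ?g12.
by rewrite gsym.
Qed.

Lemma parseval u v : tangent M1 p u -> tangent M1 p v ->
  g p u v = g p u e1 * g p v e1 + g p u e2 * g p v e2.
Proof.
move=> Tu Tv; rewrite {1}(orthonormal_basis Tu).
have T := frame_tangentZ F1 (g p u e2) Sp T2.
rewrite (metric_linear HG1)// (metricZ HG1)//.
by rewrite (Defs.metric_sym HG1 Sp T1 Tv) (Defs.metric_sym HG1 Sp T2 Tv).
Qed.

End OrthonormalBasis.

Variables (nab1 : vfield F1 -> vfield F1 -> vfield F1).
Variables (nab2 : vfield F2 -> vfield F2 -> vfield F2).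
Hypotheses (HL1 : levi_civita_field g nab1) (HL2 : levi_civita_field h nab2).
Hypotheses (curv1 : forall p U X W Z, M1 p -> ip g p (riem nab1 U X W) Z =
    k1 * (ip g p X W * ip g p U Z - ip g p U W * ip g p X Z))
  (curv2 : forall p U X W Z, M2 p -> ip h p (riem nab2 U X W) Z =
    k2 * (ip h p X W * ip h p U Z - ip h p U W * ip h p X Z)).
Hypothesis k12 : 0 < k1 + k2.
Variable J : V -> V -> V.
Hypotheses (HJ : almost_complex M J) (Horth : orthogonal_structure M gh J)
  (Hint : integrable_structure M J).
Let HG := prod_riemannian F1 F2 HG1 HG2.
Let HL := prod_levi_civita HG1 HG2 HL1 HL2.
Let HC := lc_metric_connection HG HL.
Let HH := hermitian_field HJ Horth Hint HL.
Local Notation Jv := (@J_field R _ M F J).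

(** If [g p.1 ((Jv U) p).1 (V p).1 = c], both sides of [gray] are polynomials
    in [c], and their difference is [(k1 + k2) * (1 - c ^+ 2) ^+ 2]. *)
Lemma gray_product p (U W : vf) : M p ->
  gpart g p U U = 1 -> gpart g p W W = 1 -> gpart g p U W = 0 ->
  (U p).2 = 0 -> (W p).2 = 0 -> (Jv U p).2 = 0.
Proof.
move=> Mp UU WW UW U2 W2; have [Mp1 Mp2] := Mp.
have TP (A : vf) : tangent M1 p.1 (A p).1 := prod_tangent1 A Mp.
have TP2 (A : vf) : tangent M2 p.2 (A p).2 := prod_tangent2 A Mp.
have gsym (A B : vf) : gpart g p A B = gpart g p B A by exact: (gpart_sym HG1 A B Mp).
have hsym (A B : vf) : hpart h p A B = hpart h p B A by exact: (hpart_sym HG2 A B Mp).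
have hU (A : vf) : hpart h p U A = 0.
  by rewrite /hpart U2; exact: (metric0l HG2 Mp2 (TP2 A)).
have hW (A : vf) : hpart h p W A = 0.
  by rewrite /hpart W2; exact: (metric0l HG2 Mp2 (TP2 A)).
have ps (A B : vf) : gpart g p A B =
    gpart g p A U * gpart g p B U + gpart g p A W * gpart g p B W.
  exact: (parseval Mp1 (TP U) (TP W) UU WW UW (TP A) (TP B)).
have ipE (A B : vf) : ip gh p A B = gpart g p A B + hpart h p A B by [].
have Jip (A B : vf) : gpart g p (Jv A) (Jv B) + hpart h p (Jv A) (Jv B) =
    gpart g p A B + hpart h p A B by exact: (J_ip HH _ _ Mp).
have Jsk (A B : vf) : gpart g p (Jv A) B + hpart h p (Jv A) B =
    - (gpart g p A (Jv B) + hpart h p A (Jv B)) by exact: (J_skew HC HH _ _ Mp).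
pose c := gpart g p (Jv U) W.
have JUU : gpart g p (Jv U) U = 0.
  have := Jsk U U; rewrite hU hsym hU (gsym U); lra.
have JWW : gpart g p (Jv W) W = 0.
  have := Jsk W W; rewrite hW hsym hW (gsym W); lra.
have JWU : gpart g p (Jv W) U = - c.
  by have := Jsk W U; rewrite hW hsym hU (gsym W) -/c; lra.
have gJUJU : gpart g p (Jv U) (Jv U) = c ^+ 2 by rewrite ps JUU -/c; ring.
have gJWJW : gpart g p (Jv W) (Jv W) = c ^+ 2 by rewrite ps JWW JWU; ring.
have gJUJW : gpart g p (Jv U) (Jv W) = 0 by rewrite ps JWW JUU; ring.
have hJU : hpart h p (Jv U) (Jv U) = 1 - c ^+ 2.
  by have := Jip U U; rewrite gJUJU UU hU => e; lra.
have hJW : hpart h p (Jv W) (Jv W) = 1 - c ^+ 2.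
  by have := Jip W W; rewrite gJWJW WW hW => e; lra.
have hJUJW : hpart h p (Jv U) (Jv W) = 0.
  by have := Jip U W; rewrite gJUJW UW hU => e; lra.
have c1 : (k1 + k2) * (1 - c ^+ 2) ^+ 2 = 0.
  have := gray HC HH U W Mp.
  have RE (A B C D : vf) : ip gh p (riem (prod_nab nab1 nab2) A B C) D =
      prod_curvature g h k1 k2 p A B C D.
    exact: (prod_riem HG1 HG2 HL1 HL2 curv1 curv2 A B C D Mp).
  rewrite (RE U W W U) (RE (Jv U) (Jv W) W U) (RE (Jv U) W (Jv W) U).
  rewrite (RE U (Jv W) (Jv W) U) (RE U W (Jv W) (Jv U)).
  rewrite (RE (Jv U) (Jv W) (Jv W) (Jv U)) (RE (Jv U) W W (Jv U)).
  rewrite (RE U (Jv W) W (Jv U)) /prod_curvature.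
  have JUW : gpart g p (Jv U) W = c by [].
  rewrite !(hU, hW) !(hsym _ U) !(hsym _ W) !(hU, hW) hJU hJW (hsym (Jv W)) hJUJW.
  rewrite UU WW (gsym W U) UW gJUJU gJWJW (gsym (Jv W) (Jv U)) gJUJW.
  rewrite (gsym U (Jv U)) (gsym U (Jv W)) (gsym W (Jv W)) (gsym W (Jv U)).
  by rewrite JUU JWW JWU JUW => e; lra.
move/eqP: c1; rewrite mulf_eq0 (gt_eqF k12) sqrf_eq0 /= => /eqP c1.
apply: (metric_eq0 HG2 Mp2 (TP2 (Jv U))).
by rewrite -/(hpart h p (Jv U) (Jv U)) hJU.
Qed.


Let JZ p a u : M p -> tangent M p u -> J p (a *: u) = a *: J p u.
Proof.
move=> Mp Tu; have T0 := tangent0 Mp.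
have J0 : J p 0 = 0.
  have := almost_complex_linear HJ 1 Mp T0 T0.
  by rewrite !scale1r addr0 => e; apply: (addrI (J p 0)); rewrite -e addr0.
by have := almost_complex_linear HJ a Mp Tu T0; rewrite J0 !addr0.
Qed.

Lemma J_horizontal p e : M p -> tangent M1 p.1 e -> (J p (e, 0)).2 = 0.
Proof.
move=> Mp Te; have [Mp1 Mp2] := Mp.
have T0 : tangent M2 p.2 0 by exact: tangent0.
have Tpair f : tangent M1 p.1 f -> tangent M p (f, 0).
  by move=> Tf; apply/prod_tangent.
have Tz a f : tangent M1 p.1 f -> tangent M1 p.1 (a *: f).
  exact: (frame_tangentZ F1 a Mp1).
have unit f : tangent M1 p.1 f -> f != 0 -> exists2 a : R, a != 0 &
    g p.1 (a *: f) (a *: f) = 1.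
  move=> Tf f0; have ff := metric_pos HG1 Mp1 Tf f0.
  exists (Num.sqrt (g p.1 f f))^-1.
    by rewrite invr_eq0 sqrtr_eq0 -ltNge.
  rewrite (metricZ HG1)//; last exact: Tz.
  rewrite (Defs.metric_sym HG1)//; last exact: Tz.
  rewrite (metricZ HG1)// mulrA -expr2 exprVn sqr_sqrtr ?mulVf ?gt_eqF//.
  exact: ltW.
have [e0|e0] := eqVneq e 0.
  have : J p (0 *: (e, 0)) = 0 *: J p (e, 0) by apply: JZ => //; exact: Tpair.
  rewrite scale0r => J0; have -> : (e, 0) = 0 :> V by rewrite e0.
  by rewrite J0 scale0r.
have [f [Tf f0 /(_ ord0) ef]] :=
  sphere_orthogonal_vector HG1 (v := (fun=> e) : 'I_1 -> V1) isT Mp1 (fun=> Te).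
have [a a0 aa] := unit _ Te e0; have [b b0 bb] := unit _ Tf f0.
pose U := hor F2 (field_of F1 (a *: e)); pose W := hor F2 (field_of F1 (b *: f)).
have UE : U p = (a *: e, 0) by rewrite horE// field_ofE//; exact: Tz.
have WE : W p = (b *: f, 0) by rewrite horE// field_ofE//; exact: Tz.
have : (J_field (F := F) J U p).2 = 0.
  apply: (@gray_product p U W Mp); rewrite /gpart ?UE ?WE//.
  rewrite (metricZ HG1)//; last exact: Tz.
  rewrite (Defs.metric_sym HG1 Mp1 Te)//; last exact: Tz.
  rewrite (metricZ HG1)// (Defs.metric_sym HG1 Mp1 Tf Te) ef; ring.
rewrite (J_fieldE HJ)// UE.
have -> : (a *: e, 0) = a *: (e, 0) :> V by congr pair; rewrite /= scaler0.
rewrite (JZ a Mp (Tpair _ Te)) => /eqP.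
by rewrite scaler_eq0 (negbTE a0) => /eqP.
Qed.

Lemma J_vertical p v : M p -> tangent M2 p.2 v -> (J p (0, v)).1 = 0.
Proof.
move=> Mp Tv; have [Mp1 Mp2] := Mp.
have T0 : tangent M1 p.1 0 by exact: tangent0.
have T0' : tangent M2 p.2 0 by exact: tangent0.
have Tu : tangent M p (0, v) by apply/prod_tangent.
have TJu := almost_complex_tangent HJ Mp Tu.
set w := (J p (0, v)).1; have Tw : tangent M1 p.1 w by case/prod_tangent: TJu.
have Tw0 : tangent M p (w, 0) by apply/prod_tangent.
have TJw := almost_complex_tangent HJ Mp Tw0.
apply: (metric_eq0 HG1 Mp1 Tw).
have := Horth Mp TJu Tw0; rewrite (almost_complex_square HJ)//.
rewrite /product_metric /= J_horizontal// -/w oppr0.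
have TJu2 : tangent M2 p.2 (J p (0, v)).2 by case/prod_tangent: TJu.
have TJw1 : tangent M1 p.1 (J p (w, 0)).1 by case/prod_tangent: TJw.
have TNv : tangent M2 p.2 (- v).
  by rewrite -scaleN1r; exact: (frame_tangentZ F2).
have h0 u : tangent M2 p.2 u -> h p.2 u 0 = 0.
  by move=> Tu'; rewrite (Defs.metric_sym HG2)// (metric0l HG2).
by rewrite (metric0l HG1)// !h0// !addr0.
Qed.

End Splitting.

Section Slice.
Variables (R : realType) (V1 V2 : normedModType R) (M1 : set V1) (M2 : set V2).
Variables (F2 : frame M2).
Local Notation V := (V1 * V2)%type.
Local Notation M := (M1 `*` M2).
Variables (g : V1 -> V1 -> V1 -> R) (h : V2 -> V2 -> V2 -> R).
Hypotheses (HG1 : riemannian_metric M1 g).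
Variable J : V -> V -> V.
Hypotheses (HJ : almost_complex M J)
  (Horth : orthogonal_structure M (product_metric g h) J)
  (Hint : integrable_structure M J)
  (J_ver : forall p v, M p -> tangent M2 p.2 v -> (J p (0, v)).1 = 0).
Variables (p1 : V1).
Hypothesis Mp1 : M1 p1.

Definition slice_structure (y v : V2) : V2 := (J (p1, y) (0, v)).2.
Local Notation J2 := slice_structure.

Let Mpair y : M2 y -> M (p1, y). Proof. by []. Qed.

Let Tpair y v : M2 y -> tangent M2 y v -> tangent M (p1, y) (0, v).
Proof. by move=> My Tv; apply/prod_tangent; split=> //; exact: tangent0. Qed.

Lemma sliceE y v : M2 y -> tangent M2 y v -> J (p1, y) (0, v) = (0, J2 y v).
Proof.
by move=> My Tv; rewrite [LHS]surjective_pairing J_ver//; exact: Mpair.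
Qed.

Let embE (x : V2) : (p1, 0) + inrl V1 V2 x = (p1, x).
Proof. by congr pair; rewrite /= ?addr0 ?add0r. Qed.

Let embM x : M2 x -> M ((p1, 0) + inrl V1 V2 x).
Proof. by rewrite embE; exact: Mpair. Qed.

Lemma smooth_slice (W : normedModType R) (f : V -> W) :
  smooth M f -> smooth M2 (fun x => f (p1, x)).
Proof.
move=> sf.
apply: eq_smooth (smooth_affine (@inrl_continuous R V1 V2) embM sf) => x _.
by rewrite embE.
Qed.

Lemma mdiff_slice (W : normedModType R) (f : V -> W) y v : smooth M f -> M2 y ->
  tangent M2 y v -> mdiff M f (p1, y) (0, v) = mdiff M2 (fun x => f (p1, x)) y v.
Proof.
move=> sf My Tv.
have E x : M2 x -> f ((p1, 0) + inrl V1 V2 x) = f (p1, x) by rewrite embE.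
have si := smooth_affine (@inrl_continuous R V1 V2) embM sf.
rewrite -(eq_mdiff E si My Tv) (mdiff_affine (@inrl_continuous R V1 V2) embM sf My Tv).
by rewrite embE.
Qed.

Lemma smooth_snd_comp (W : normedModType R) (N : set W) (f : W -> V) :
  smooth N f -> smooth N (fun x => (f x).2).
Proof.
move=> sf; exact: (smooth_comp_lin (@sndl_continuous R V1 V2) sf).
Qed.

Lemma bracket_slice A B y : vector_field M A -> vector_field M B ->
  (forall p, M p -> (A p).1 = 0) -> (forall p, M p -> (B p).1 = 0) -> M2 y ->
  (bracket M A B (p1, y)).2 =
  bracket M2 (fun x => (A (p1, x)).2) (fun x => (B (p1, x)).2) y.
Proof.
move=> vA vB A0 B0 My; have Mp := Mpair My.
have key C D : vector_field M C -> vector_field M D -> (forall p, M p -> (C p).1 = 0) ->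
    (mdiff M D (p1, y) (C (p1, y))).2 =
    mdiff M2 (fun x => (D (p1, x)).2) y (C (p1, y)).2.
  move=> vC vD C0; have TC : tangent M2 y (C (p1, y)).2.
    by case/prod_tangent: (vC.2 _ Mp).
  have -> : C (p1, y) = (0, (C (p1, y)).2) by rewrite [LHS]surjective_pairing C0.
  rewrite (mdiff_slice vD.1 My TC).
  exact/esym/(mdiff_comp_lin My TC (@sndl_continuous R V1 V2) (smooth_slice vD.1)).
by rewrite /bracket -(key A B)// -(key B A).
Qed.

Lemma bracket_fst A B p : vector_field M A -> vector_field M B ->
  (forall p, M p -> (A p).1 = 0) -> (forall p, M p -> (B p).1 = 0) -> M p ->
  (bracket M A B p).1 = 0.
Proof.
move=> vA vB A0 B0 Mp.
have key C D : vector_field M C -> vector_field M D -> (forall p, M p -> (D p).1 = 0) ->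
    (mdiff M D p (C p)).1 = 0.
  move=> vC vD D0; have TC := vC.2 p Mp.
  have e := mdiff_comp_lin Mp TC (@fstl_continuous R V1 V2) vD.1.
  have sD := smooth_comp_lin (@fstl_continuous R V1 V2) vD.1.
  have e0 := eq_mdiff D0 sD Mp TC.
  by rewrite -[LHS]e -/(mdiff _ _ _ _) e0 (mdiff_cst TC).
by rewrite /bracket -[LHS]/(_ - _) !key// subrr.
Qed.

Lemma slice_almost_complex : almost_complex M2 J2.
Proof.
split.
- move=> y v My Tv.
  by case/prod_tangent: (almost_complex_tangent HJ (Mpair My) (Tpair My Tv)).
- move=> y u v a My Tu Tv; rewrite /J2.
  have -> : (0, a *: u + v) = a *: (0, u) + (0, v) :> V.
    by congr pair; rewrite /= scaler0 addr0.
  by rewrite (almost_complex_linear HJ)//; exact: Tpair.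
- move=> X vX; apply: smooth_snd_comp.
  have := almost_complex_smooth HJ (lift2_field M1 vX).
  by move=> /smooth_slice.
move=> y v My Tv.
have Tw : tangent M2 y (J2 y v).
  by case/prod_tangent: (almost_complex_tangent HJ (Mpair My) (Tpair My Tv)).
have := almost_complex_square HJ (Mpair My) (Tpair My Tv).
by rewrite !sliceE// => /(congr1 snd).
Qed.

Lemma slice_orthogonal : orthogonal_structure M2 h J2.
Proof.
move=> y u v My Tu Tv.
have := Horth (Mpair My) (Tpair My Tu) (Tpair My Tv).
rewrite !sliceE// /product_metric /= (metric0l HG1 Mp1 (tangent0 Mp1)).
by rewrite !add0r.
Qed.

Lemma slice_integrable : integrable_structure M2 J2.
Proof.
move=> X Y y vX vY My; have Mp := Mpair My.
have lX := lift2_field M1 vX; have lY := lift2_field M1 vY.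
have := Hint lX lY Mp => /(congr1 snd); rewrite /nijenhuis.
have vJ Z : vector_field M2 Z -> vector_field M (fun p => J p (lift2 Z p)).
  by move=> vZ; apply: (J_vector_field HJ); exact: lift2_field.
have J0 Z : vector_field M2 Z -> forall p, M p -> (J p (lift2 Z p)).1 = 0.
  by move=> vZ p Mp'; rewrite J_ver//; exact: vZ.2 _ Mp'.2.
have l0 Z p : M p -> (lift2 (V1 := V1) Z p).1 = 0 by [].
have JJ A B : vector_field M A -> vector_field M B ->
    (forall p, M p -> (A p).1 = 0) -> (forall p, M p -> (B p).1 = 0) ->
    (J (p1, y) (bracket M A B (p1, y))).2 =
    J2 y (bracket M2 (fun x => (A (p1, x)).2) (fun x => (B (p1, x)).2) y).
  move=> vA vB A0 B0; rewrite /J2 -(bracket_slice vA vB A0 B0 My).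
  by rewrite -(bracket_fst vA vB A0 B0 Mp) -surjective_pairing.
have snd3 (a b c d : V) : (a - b - c - d).2 = a.2 - b.2 - c.2 - d.2 by [].
rewrite snd3 (JJ _ _ (vJ _ vX) lY (J0 _ vX))// (JJ _ _ lX (vJ _ vY))//; last exact: J0.
rewrite (bracket_slice (vJ _ vX) (vJ _ vY) (J0 _ vX) (J0 _ vY) My).
by rewrite (bracket_slice lX lY _ _ My).
Qed.

End Slice.

Section SecondDerivativeTest.
Variable R : realType.

Lemma second_derivative_max (f f' : R -> R) (a : R) :
  (forall t : R, is_derive t 1 f (f' t)) -> is_derive (0 : R) 1 f' a ->
  (forall t, f t <= f 0) -> f' 0 = 0 /\ a <= 0.
Proof.
move=> df df' fmax.
have f'0 : f' 0 = 0.
  have i0 : (0 : R) \in `]-1, 1[ by rewrite in_itv/= ltrN10 ltr01.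
  have le11 : (-1 : R) <= 1 by rewrite (le_trans (lerN10 R) ler01).
  have fd t : derivable f t 1 by case: (df t).
  have [_ e1] := derive1_at_max le11 (fun t _ => fd t) i0 (fun t _ => fmax t).
  by have [_ e2] := df 0; rewrite -e2 e1.
split=> //; rewrite leNgt; apply/negP => a0.
have dlim : (fun t : R => t^-1 *: (f' (t *: 1 + 0) - f' 0)) @ 0^' --> a.
  by case: df' => dv Da; rewrite -Da; exact: dv.
have := cvgr_gt a dlim _ a0.
case=> e /= e0 near0; pose s := e / 2.
have s0 : 0 < s by rewrite divr_gt0.
have se : s < e by rewrite /s; lra.
have pos t : 0 < t -> t < e -> 0 < f' t.
  move=> t0 te; have := near0 t; rewrite /ball_/= sub0r normrN gtr0_norm// => /(_ te).
  move=> /(_ (lt0r_neq0 t0)); rewrite f'0 subr0 addr0 [t *: 1]mulr1.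
  by rewrite pmulr_rgt0// invr_gt0.
have cf : {within `[0, s], continuous f}.
  apply: continuous_subspaceT => t; apply: differentiable_continuous.
  by apply/derivable1_diffP; case: (df t).
have [c] := MVT s0 (fun t _ => df t) cf.
rewrite in_itv /= => /andP[c0 cs]; rewrite subr0 => e1.
have := mulr_gt0 (pos _ c0 (lt_trans cs se)) s0.
by rewrite -e1 subr_gt0 ltNge fmax.
Qed.

End SecondDerivativeTest.

Section SphereSecondDerivative.
Variables (R : realType) (m : nat).
Local Notation V := 'rV[R]_m.+1.
Local Notation S := (sphere R m).
Local Notation F := (sphere_frame R m).
Local Notation vf := (vfield F).
Implicit Types (p u v w : V) (f : V -> R^o).

Lemma great_circle_shift k u w s t : great_circle k u w (s + t) =
  great_circle k (great_circle k u w s)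
    (cos (k * s) *: w - sin (k * s) *: u) t.
Proof.
rewrite /great_circle mulrDr cosD sinD; apply/rowP => i; rewrite !mxE; ring.
Qed.

Section Rotation.
Variables (p v : V).
Hypotheses (Sp : S p) (pv : dotr p v = 0).

(** The integral curves are those of a rotation in the plane of [p] and [v];
    the one through [p] is a great circle. *)
Definition rotation q : V := dotr q p *: v - dotr q v *: p.

Lemma rotation_field : vector_field S rotation.
Proof.
split=> [|q Sq].
  have sid : smooth S (idfun : V -> V) := @sphere_self_smooth R m.
  have sd w : smooth S (fun q => dotr q w : R^o).
    by apply: (dotr_smooth sid); exact: smooth_cst.
  have -> : rotation = fun q => dotr q p *: v + (- dotr q v) *: p.
    by apply/funext => q; rewrite /rotation scaleNr.
  apply: smoothD; apply: smooth_scale (smooth_cst _) => //.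
  have -> : (fun q => - dotr q v : R^o) = fun q => (-1 : R^o) *: (dotr q v : R^o).
    by apply/funext => q; rewrite scaleN1r.
  by apply: (smooth_scale (f := fun=> -1 : R^o) (g := fun q => dotr q v : R^o)) => //; exact: smooth_cst.
apply/(sphere_tangent _ Sq); rewrite /rotation dotrDr dotrNr !(dotrC q) !dotrZl.
by rewrite (dotrC v q) (dotrC p q); ring.
Qed.

Lemma rotation_geodesic s : let k := speed v in let w := k^-1 *: v in
  k *: (cos (k * s) *: w - sin (k * s) *: p) = rotation (geodesic p v s).
Proof.
move=> k w; have kw : k *: w = v by exact: speedK.
have wv : dotr w v = k.
  rewrite /w dotrZl -speed_sqr -/k mulrA.
  have [->|k0] := eqVneq k 0; first by rewrite mulr0.
  by rewrite mulVf// mul1r.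
rewrite /rotation /geodesic /great_circle -/k -/w.
have wp : dotr w p = 0 by rewrite dotrZl (dotrC v) pv mulr0.
move: kw wv wp; rewrite -/k -/w; move: k w => k w kw wv wp.
rewrite !(dotrDl, dotrZl) ((sphereP p).1 Sp) pv wv wp !mulr0 mulr1 addr0 add0r.
by rewrite scalerBr !scalerA (mulrC k (cos _)) (mulrC k (sin _)) -[in RHS]kw scalerA.
Qed.

Lemma derive_along_geodesic f s : smooth S f ->
  is_derive (s : R) 1 (f \o geodesic p v) (mdiff S f (geodesic p v s) (rotation (geodesic p v s))).
Proof.
move=> sf; have Sg t := geodesic_sphere t Sp pv.
pose c := great_circle (speed v) (geodesic p v s)
  (cos (speed v * s) *: ((speed v)^-1 *: v) - sin (speed v * s) *: p).
have cE t : c t = geodesic p v (s + t) by rewrite /geodesic great_circle_shift.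
have [G GE] := sf _ (Sg s).
have Sc t : S (c t) by rewrite cE.
have c0 : c 0 = geodesic p v s by exact: great_circle0.
have Tr : tangent S (geodesic p v s) (rotation (geodesic p v s)).
  by apply: (rotation_field).2; exact: Sg.
have := tangent_chain GE (great_circle_smooth _ _ _) Sc c0.
rewrite great_circle_velocity rotation_geodesic -(mdiffE Tr GE) => dc.
have -> : f \o geodesic p v = (f \o c) \o (fun t : R => t - s).
  by apply/funext => t /=; rewrite cE addrC subrK.
have sh : is_derive s 1 (fun t : R => t - s) 1 by exact: is_derive_shift.
have dc' : is_derive (s - s) 1 (f \o c) (mdiff S f (geodesic p v s) (rotation (geodesic p v s))).
  by rewrite subrr.
by have := @is_derive1_comp _ (f \o c) (fun t => t - s) s _ _ dc' sh; rewrite mulr1.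
Qed.

End Rotation.

(** At a maximum [p] of [f] the second derivative of [f] along a field depends
    only on the value of the field at [p]; replace the field by a rotation. *)
Lemma sphere_second_derivative f (P : vf) p : smooth S f -> S p ->
  (forall q, S q -> f q <= f p) ->
  (forall U : vf, der U f p = 0) /\ der P (der P f) p <= 0.
Proof.
move=> sf Sp fmax.
have along v : dotr p v = 0 -> mdiff S f p v = 0 /\
    let Q := mkvf F (rotation p v) in der Q (der Q f) p <= 0.
  move=> pv; have vr := rotation_field p v.
  have Sg t := geodesic_sphere t Sp pv.
  have rv : rotation p v p = v.
    by rewrite /rotation ((sphereP p).1 Sp) pv scale1r scale0r subr0.
  have g0 : geodesic p v 0 = p by exact: great_circle0.
  set Q := mkvf F (rotation p v).
  have dQ f' t : smooth S f' -> is_derive (t : R) 1 (f' \o geodesic p v)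
      (der Q f' (geodesic p v t)).
    move=> sf'; rewrite derE// /Q mkvfE//; exact: derive_along_geodesic.
  have sQ := der_smooth Q sf.
  have := @second_derivative_max R (f \o geodesic p v) (der Q f \o geodesic p v)
    (der Q (der Q f) p) (fun t => dQ f t sf).
  have d2 := dQ _ 0 sQ; rewrite g0 in d2.
  move=> /(_ d2) H; have [|e1 e2] := H.
    by move=> t /=; rewrite g0; exact: fmax.
  have dv : der Q f p = mdiff S f p v by rewrite (derE Q f Sp) (mkvfE F vr Sp) rv.
  have e3 : der Q f (geodesic p v 0) = 0 := e1.
  by rewrite g0 dv in e3; split; [exact: e3|exact: e2].
have d0 (U : vf) : der U f p = 0.
  rewrite derE//; apply: (along _ _).1.
  by apply/(sphere_tangent _ Sp); exact: (vfieldP U).2.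
split=> //.
have TP : tangent S p (P p) by exact: (vfieldP P).2.
have pv := (sphere_tangent _ Sp).1 TP.
pose Q := mkvf F (rotation p (P p)).
have le0 : der Q (der Q f) p <= 0 by exact: (along _ pv).2.
have QP : (P - Q) p = 0.
  rewrite vfieldDE vfieldNE /Q mkvfE//; last exact: rotation_field.
  by rewrite /rotation ((sphereP p).1 Sp) pv scale1r scale0r subr0 subrr.
have eD : der P (der Q f) p = der Q (der Q f) p.
  have sQ := der_smooth Q sf.
  have PQ : P p = Q p by apply/eqP; rewrite -subr_eq0; apply/eqP.
  by rewrite (derE P (der Q f) Sp) (derE Q (der Q f) Sp) PQ.
have : der P (der (P - Q) f) p = 0.
  apply: (vanishing_tensor (T := fun Q => der P (der Q f) p) _ _ QP).
  - move=> A B; rewrite -(derD P (der_smooth A sf) (der_smooth B sf) Sp).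
    congr (_ p); apply: der_eq; last exact: der_smooth.
    by move=> q Sq; rewrite der_fieldD.
  move=> f' A sf'; have sA := der_smooth A sf.
  have e1 : der P (der (fscale f' A) f) p = der P (fun q => f' q * der A f q) p.
    congr (_ p); apply: der_eq; last exact: der_smooth.
    by move=> q Sq; exact: der_fscale.
  by rewrite e1 (derM P sf' sA Sp) (d0 A) mulr0 add0r.
have -> : der P (der (P - Q) f) p = der P (der P f) p - der P (der Q f) p.
  have sP := der_smooth P sf; have sQ := der_smooth Q sf.
  have sN : smooth S (fun q => - der Q f q).
    have -> : (fun q => - der Q f q : R^o) = fun q => (-1 : R^o) *: (der Q f q : R^o).
      by apply/funext => q; rewrite scaleN1r.
    by apply: smooth_scale => //; exact: smooth_fun_cst.
  rewrite -(derN P sQ Sp) -(derD P sP sN Sp); congr (_ p).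
  apply: der_eq; last exact: der_smooth.
  move=> q Sq; rewrite der_fieldD// !derE// vfieldNE.
  have := @mdiff_dir_sum _ _ _ F _ f 1 q (fun=> -1) (fun=> Q q) Sq sf
    (fun=> (vfieldP Q).2 _ Sq).
  by rewrite !big_ord1 !scaleN1r => ->.
by rewrite eD => h; lra.
Qed.

End SphereSecondDerivative.

Section FlatExtension.
Variables (R : realType) (V : normedModType R) (M : set V) (F : frame M).
Local Notation vf := (vfield F).
Variables (g : V -> V -> V -> R) (nab : vf -> vf -> vf).
Hypothesis HL : levi_civita_field g nab.

(** The constant-coefficient extension of [v] is corrected by fields vanishing
    at [p] with prescribed first derivatives. *)
Lemma flat_extension p v : M p -> tangent M p v ->
  exists2 X : vf, X p = v & forall U, nab U X p = 0.
Proof.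
move=> Mp Tv; pose Z := field_of F v.
pose a k j : R := feps F k (nab (frame_field F j) Z p).
pose f k (q : V) : R^o := \sum_j a k j *: (feps F j (q - p) : R^o).
have sl j : smooth M (fun q => feps F j (q - p) : R^o).
  have -> : (fun q => feps F j (q - p) : R^o) = fun q => feps F j q + (- feps F j p) : R^o.
    by apply/funext => q; rewrite linearB.
  apply: smoothD; last exact: smooth_fun_cst.
  by apply: smooth_lin; exact: feps_continuous.
have sf k : smooth M (f k).
  apply: smooth_sum => j; apply: (smooth_scale (f := fun=> a k j : R^o)) (sl j).
  exact: smooth_fun_cst.
have f0 k : f k p = 0.
  by rewrite /f big1// => j _; rewrite subrr linear0 scaler0.
have df k U : der U (f k) p = feps F k (nab U Z p).
  have TU : tangent M p (U p) := (vfieldP U).2 _ Mp.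
  rewrite (derE U (f k) Mp) /f (mdiff_sum Mp TU); last first.
    move=> j; apply: (smooth_scale (f := fun=> a k j : R^o)) (sl j).
    exact: smooth_fun_cst.
  have dj j : mdiff M (fun q => a k j *: (feps F j (q - p) : R^o)) p (U p) =
      a k j * feps F j (U p).
    have sc := smooth_fun_cst (M := M) (a k j).
    rewrite (mdiff_scale Mp TU sc (sl j)) (mdiff_cst TU) scale0r add0r.
    congr (_ *: _).
    have -> : (fun q => feps F j (q - p) : R^o) =
        fun q => feps F j q + (- feps F j p) : R^o.
      by apply/funext => q; rewrite linearB.
    have sj : smooth M (feps F j) by apply: smooth_lin; exact: feps_continuous.
    rewrite (mdiffD Mp TU sj (smooth_fun_cst _)) (mdiff_cst TU) addr0.
    by rewrite (mdiff_lin TU); last exact: feps_continuous.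
  under eq_bigr => j _ do rewrite dj.
  have nabU : nab U Z p = \sum_j feps F j (U p) *: nab (frame_field F j) Z p.
    have nabl0 : nab 0 Z = 0 by apply: (addrI (nab 0 Z)); rewrite -(lc_addl HL) !addr0.
    rewrite {1}(vfield_decomp U).
    rewrite (big_morph (fun W => nab W Z) (fun A B => lc_addl HL A B Z) nabl0).
    have e j : nab (fscale (coord U j) (frame_field F j)) Z p =
        feps F j (U p) *: nab (frame_field F j) Z p.
      have sj := coord_smooth U j.
      by rewrite (lc_scalel HL _ _ sj) fscaleE.
    by rewrite vfield_sumE; under eq_bigr => j _ do rewrite e.
  rewrite nabU (linear_sum (feps F k)) /=; congr bigop; apply/funext => j.
  by congr BigBody; rewrite linearZ /a [RHS]mulrC.
pose X : vf := Z - \sum_k fscale (f k) (frame_field F k).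
have nabN U A : nab U (- A) = - nab U A.
  apply/eqP; rewrite -addr_eq0 -(lc_addr HL) addNr; apply/eqP.
  by apply: (addrI (nab U 0)); rewrite -(lc_addr HL) !addr0.
have nab0 U : nab U 0 = 0 by apply: (addrI (nab U 0)); rewrite -(lc_addr HL) !addr0.
exists X.
  rewrite /X vfieldDE vfieldNE vfield_sumE big1 ?subr0 => [|k _].
    exact: field_ofE.
  by rewrite fscaleE// f0 scale0r.
move=> U; rewrite /X (lc_addr HL) nabN vfieldDE vfieldNE.
have TZ : tangent M p (nab U Z p) := (vfieldP (nab U Z)).2 _ Mp.
rewrite {1}[nab U Z p](fE_span F Mp TZ).
have -> : nab U (\sum_k fscale (f k) (frame_field F k)) =
    \sum_k nab U (fscale (f k) (frame_field F k)).
  exact: (big_morph (nab U) (fun A B => lc_addr HL U A B) (nab0 U)).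
rewrite vfield_sumE; have e k : nab U (fscale (f k) (frame_field F k)) p =
    feps F k (nab U Z p) *: fE F k p.
  rewrite (lc_leibniz HL _ _ (sf k)) vfieldDE fscaleE//; last exact: der_smooth.
  by rewrite fscaleE// df f0 scale0r addr0 frame_fieldE.
by under [X in _ - X]eq_bigr => k _ do rewrite e; exact: subrr.
Qed.

End FlatExtension.

Section UnitTangentBundle.
Variables (R : realType) (m : nat).
Local Notation V := 'rV[R]_m.+1.
Local Notation S := (sphere R m).
Local Notation F := (sphere_frame R m).
Local Notation vf := (vfield F).
Implicit Types (p u v w : V).

Lemma smooth_within_cvg (W : normedModType R) (f : V -> W) p : smooth S f -> S p ->
  f @ within S (nbhs p) --> f p.
Proof.
move=> sf Sp; have [G GE] := sf _ Sp; have dG := local_extension_diff GE.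
have cG : G @ within S (nbhs p) --> f p.
  apply: cvg_within_filter; rewrite -(local_extension_at Sp GE).
  exact: differentiable_continuous dG.
case: GE => U [Up [oU _] GE]; apply: cvg_trans cG; apply: near_eq_cvg.
have nU : nbhs p U by apply: open_nbhs_nbhs.
by apply: filterS nU => q Uq Sq; rewrite GE.
Qed.

Definition unit_tangent : set (V * V) :=
  (S `*` S) `&` [set z | dotr z.1 z.2 = 0].

Lemma cvg_sum_ord (T : Type) (G : set_system T) (FG : Filter G) n
    (f : 'I_n -> T -> R^o) (l : 'I_n -> R^o) :
  (forall i, f i @ G --> l i) -> (fun x => \sum_i f i x) @ G --> \sum_i l i.
Proof.
move=> fl; elim: n f l fl => [|n IH] f l fl.
  have -> : (fun x => \sum_(i < 0) f i x) = cst 0.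
    by apply/funext => x; rewrite big_ord0.
  by rewrite big_ord0; exact: cvg_cst.
have -> : (fun x => \sum_(i < n.+1) f i x) =
    (fun x => f ord0 x + \sum_(i < n) f (lift ord0 i) x).
  by apply/funext => x; rewrite big_ord_recl.
rewrite big_ord_recl; apply: cvgD; first exact: fl.
by apply: IH => i; exact: fl.
Qed.

Lemma dotr_continuous : continuous (fun z : V * V => dotr z.1 z.2 : R^o).
Proof.
move=> z; apply: cvg_sum_ord => i; apply: cvgM.
  by apply: (@continuous_comp _ _ _ fst (coordl R i)); [exact: cvg_fst|exact: coordl_continuous].
by apply: (@continuous_comp _ _ _ snd (coordl R i)); [exact: cvg_snd|exact: coordl_continuous].
Qed.

Lemma sphere_compact : compact S.
Proof.
apply: bounded_closed_compact.
  exists 1; split=> // M M1 p Sp; apply: le_trans (ltW M1).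
  rewrite [leLHS]/Num.norm /= mx_normrE; apply/bigmax_leP; split=> //= -[a i] _ /=.
  rewrite ord1 -(@ler_pXn2r _ 2)// ?nnegrE// expr1n -normrX ger0_norm ?sqr_ge0//.
  rewrite -[leRHS]((sphereP p).1 Sp) /dotr (bigD1 i)//= -expr2 lerDl.
  by apply: sumr_ge0 => j _; rewrite -expr2 sqr_ge0.
have -> : S = (fun p : V => dotr p p : R^o) @^-1` [set 1].
  by apply/seteqP; split=> p /sphereP.
apply: preimage_closed; last exact: closed_eq.
move=> p _; apply: (@cvg_sum_ord _ (nbhs p) _ m.+1 (fun i q => q 0 i * q 0 i)) => i.
by apply: cvgM; exact: (@coordl_continuous R m i p).
Qed.

Lemma unit_tangent_compact : compact unit_tangent.
Proof.
apply: compact_closedI; first by apply: compact_setX; exact: sphere_compact.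
rewrite -[X in closed X]/((fun z : V * V => dotr z.1 z.2 : R^o) @^-1` [set 0]).
apply: preimage_closed; last exact: closed_eq.
by move=> z _; exact: dotr_continuous.
Qed.

Variable h : V -> V -> V -> R.
Hypothesis HG : riemannian_metric S h.
Local Notation K := unit_tangent.

Definition continuous_on_bundle (f : V * V -> R^o) :=
  forall z, K z -> f @ within K (nbhs z) --> f z.
Local Notation good := continuous_on_bundle.

Lemma good_eq f f' : (forall z, K z -> f z = f' z) -> good f -> good f'.
Proof.
move=> ff' gf z Kz; rewrite -ff'//; apply: cvg_trans (gf z Kz).
have nz : nbhs z (fun y => K y -> f y = f' y).
  by apply: filterS (filterT (F := nbhs z)) => y _; exact: ff'.
by apply: near_eq_cvg; exact: nz.
Qed.

Lemma good_sum n (f : 'I_n -> V * V -> R^o) : (forall i, good (f i)) ->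
  good (fun z => \sum_i f i z).
Proof. by move=> gf z Kz; apply: cvg_sum_ord => i; exact: gf. Qed.

Lemma good_mul (f f' : V * V -> R^o) : good f -> good f' ->
  good (fun z => (f z : R) * f' z).
Proof. by move=> gf gf' z Kz; apply: cvgM; [exact: gf|exact: gf']. Qed.

Lemma good_coord i : good (fun z => z.2 0 i).
Proof.
move=> z _; apply: cvg_within_filter.
apply: (@continuous_comp _ _ _ snd (coordl R i)); first exact: cvg_snd.
exact: coordl_continuous.
Qed.

Lemma good_ip (X Y : vf) : good (fun z => ip h z.1 X Y).
Proof.
move=> z [[Sz1 Sz2] _].
apply: (cvg_comp _ _ _ (smooth_within_cvg (ip_smooth HG X Y) Sz1)).
move=> P; rewrite /within/= => nP.
have nz : nbhs z (fun y : V * V => S y.1 -> P y.1).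
  exact: (cvg_fst (F := nbhs z.1) (G := nbhs z.2) nP).
have : nbhs z (fun y : V * V => K y -> P y.1).
  by apply: filterS nz => y yP [[Sy1 _] _]; exact: yP.
by [].
Qed.

Section MaximalRatio.
Variable A : vf -> vf -> vf.
Hypotheses (ADl : forall X Y Z, A (X + Y) Z = A X Z + A Y Z)
  (ADr : forall X Y Z, A Z (X + Y) = A Z X + A Z Y)
  (Ascalel : forall f X Y, smooth S f -> A (fscale f X) Y = fscale f (A X Y))
  (Ascaler : forall f X Y, smooth S f -> A X (fscale f Y) = fscale f (A X Y)).

Lemma fscale_cst (a : R) (X : vf) : fscale (fun=> a : R^o) X = a *: X.
Proof.
by apply: vfield_eq => p Sp; rewrite fscaleE//; exact: smooth_fun_cst.
Qed.

Lemma ipZl p a (X Y : vf) : S p -> ip h p (a *: X) Y = a * ip h p X Y.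
Proof.
by move=> Sp; rewrite -fscale_cst (ip_scale HG)//; exact: smooth_fun_cst.
Qed.

Lemma ipZr p a (X Y : vf) : S p -> ip h p X (a *: Y) = a * ip h p X Y.
Proof. by move=> Sp; rewrite (ip_sym HG)// ipZl// (ip_sym HG). Qed.

Lemma ip_suml p n (X : 'I_n -> vf) (Y : vf) : S p ->
  ip h p (\sum_i X i) Y = \sum_i ip h p (X i) Y.
Proof.
move=> Sp; apply: (big_morph (fun X => ip h p X Y)) => [B C|]; first exact: (ipD HG).
by rewrite -[X in ip h p X Y](scale0r (0 : vf)) ipZl// mul0r.
Qed.

Let AZl a X Y : A (a *: X) Y = a *: A X Y.
Proof. by rewrite -!fscale_cst Ascalel//; exact: smooth_fun_cst. Qed.

Let AZr a X Y : A X (a *: Y) = a *: A X Y.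
Proof. by rewrite -!fscale_cst Ascaler//; exact: smooth_fun_cst. Qed.

Let A_suml n (X : 'I_n -> vf) Y : A (\sum_i X i) Y = \sum_i A (X i) Y.
Proof.
apply: (big_morph (fun X => A X Y)) => [B C|]; first exact: ADl.
by rewrite -[X in A X Y](scale0r (0 : vf)) AZl scale0r.
Qed.

Let A_sumr n (Y : 'I_n -> vf) X : A X (\sum_i Y i) = \sum_i A X (Y i).
Proof.
apply: (big_morph (A X)) => [B C|]; first exact: ADr.
by rewrite -[X in A _ X](scale0r (0 : vf)) AZr scale0r.
Qed.

Local Notation E := (frame_field F).

Lemma good_norm2 : good (fun z => ip h z.1 (field_of F z.2) (field_of F z.2)).
Proof.
have e : forall z, K z -> ip h z.1 (field_of F z.2) (field_of F z.2) =
    \sum_i \sum_j (z.2 0 i * z.2 0 j) * ip h z.1 (E i) (E j).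
  move=> z [[Sz _] _]; rewrite {1}/field_of ip_suml//; apply: eq_bigr => i _.
  rewrite ipZl// (ip_sym HG)// ip_suml// mulr_sumr; apply: eq_bigr => j _.
  by rewrite ipZl// (ip_sym HG)// mulrA.
apply: good_eq => [z Kz|]; first exact/esym/e.
apply: good_sum => i; apply: good_sum => j; apply: good_mul; last exact: good_ip.
by apply: good_mul; exact: good_coord.
Qed.

Lemma good_norm2_A : good (fun z =>
  ip h z.1 (A (field_of F z.2) (field_of F z.2)) (A (field_of F z.2) (field_of F z.2))).
Proof.
pose c (z : V * V) i j := z.2 0 i * z.2 0 j.
have AE z : A (field_of F z.2) (field_of F z.2) =
    \sum_i \sum_j c z i j *: A (E i) (E j).
  rewrite {1}/field_of A_suml; apply: eq_bigr => i _.
  rewrite AZl /field_of A_sumr scaler_sumr; apply: eq_bigr => j _.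
  by rewrite AZr scalerA.
have iE z X : K z -> ip h z.1 (A (field_of F z.2) (field_of F z.2)) X =
    \sum_i \sum_j c z i j * ip h z.1 (A (E i) (E j)) X.
  move=> [[Sz _] _]; rewrite AE ip_suml//; apply: eq_bigr => i _.
  by rewrite ip_suml//; apply: eq_bigr => j _; rewrite ipZl.
have gc i j : good (fun z => c z i j) by apply: good_mul; exact: good_coord.
have key X : good (fun z => ip h z.1 (A (field_of F z.2) (field_of F z.2)) X).
  apply: good_eq => [z Kz|]; first exact/esym/iE.
  apply: good_sum => i; apply: good_sum => j; apply: good_mul => //.
  exact: good_ip.
apply: good_eq => [z Kz|]; first exact/esym/iE.
apply: good_sum => i; apply: good_sum => j; apply: good_mul => //.
apply: good_eq (key (A (E i) (E j))) => z [[Sz _] _].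
exact: (ip_sym HG).
Qed.

Lemma A_point p (X X' : vf) : S p -> X p = X' p -> A X X p = A X' X' p.
Proof.
move=> Sp XX'; apply/eqP; rewrite -subr_eq0; apply/eqP.
rewrite -[LHS]/((A X X - A X' X') p); apply: (ip_point HG Sp) => W.
have sub (B C D D' : vf) : A B D - A C D' = A (B - C) D + A C (D - D').
  by rewrite ADl ADr -(scaleN1r C) AZl -(scaleN1r D') AZr !scaleN1r addrA subrK.
have XX0 : (X - X') p = 0 by rewrite vfieldDE vfieldNE XX' subrr.
rewrite sub (ipD HG)//.
rewrite (vanishing_tensor (T := fun Y => ip h p (A Y X) W) _ _ XX0); first last.
- by move=> f B sf; rewrite Ascalel// (ip_scale HG).
- by move=> B C; rewrite ADl (ipD HG).
rewrite (vanishing_tensor (T := fun Y => ip h p (A X' Y) W) _ _ XX0) ?addr0//.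
- by move=> B C; rewrite ADr (ipD HG).
- by move=> f B sf; rewrite Ascaler// (ip_scale HG).
Qed.

(** The ratio is homogeneous of degree 0, hence a continuous function on the
    compact bundle of (Euclidean) unit tangent vectors. *)
Lemma exists_max_ratio : (0 < m)%N -> exists l p X,
  [/\ S p, ip h p X X = 1, ip h p (A X X) (A X X) = l &
  forall (Y : vf) q, S q -> ip h q (A Y Y) (A Y Y) <= l * ip h q Y Y ^+ 2].
Proof.
move=> m0; pose U (z : V * V) := field_of F z.2.
have UE z : K z -> U z z.1 = z.2.
  by move=> [[Sz _] /= zz]; apply: field_ofE => //; apply/(sphere_tangent _ Sz).
have Kpos z : K z -> 0 < ip h z.1 (U z) (U z).
  move=> Kz; have [[Sz Sz2] _] := Kz; rewrite /ip UE//.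
  apply: (metric_pos HG) => //; first by rewrite -(UE _ Kz); exact: tangentP.
  apply/eqP => z0; move: Sz2 => /sphereP; rewrite z0 /dotr big1 => [|i _].
    by move=> /esym/eqP; rewrite oner_eq0.
  by rewrite mxE mul0r.
have normalize (v : V) : v != 0 -> exists2 r : R, 0 < r & S (r^-1 *: v).
  move=> v0; have vv : 0 < dotr v v.
    rewrite lt_neqAle -speed_sqr -expr2 sqr_ge0 andbT eq_sym.
    rewrite expr2 speed_sqr; apply/eqP => /dotr_eq0 v00.
    by rewrite v00 eqxx in v0.
  have k0 : 0 < speed v by rewrite /speed sqrtr_gt0.
  exists (speed v) => //; apply/sphereP; rewrite dotrZl dotrC dotrZl -speed_sqr.
  by rewrite mulKf ?mulVf ?gt_eqF.
have K0 : K !=set0.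
  pose p : V := delta_mx 0 0.
  have Sp : S p by apply/sphereP; rewrite dotr_delta mxE !eqxx.
  have [w [Tw w0 _]] := sphere_orthogonal_vector HG (v := (fun=> 0) : 'I_0 -> V) m0 Sp
    (fun=> tangent0 Sp).
  have [r r0 Sr] := normalize w w0.
  exists (p, r^-1 *: w); split; first by split.
  by rewrite /= dotrC dotrZl dotrC ((sphere_tangent _ Sp).1 Tw) mulr0.
pose f z := ip h z.1 (A (U z) (U z)) (A (U z) (U z)) / ip h z.1 (U z) (U z) ^+ 2.
have cf : {within K, continuous f}.
  apply/subspace_continuousP => z Kz; apply: cvgM; first exact: good_norm2_A.
  apply: cvgV; first by rewrite expf_neq0// gt_eqF// Kpos.
  by apply: cvgM; exact: good_norm2.
have [z0 /set_mem Kz0 zmax] := compact_EVT_max K0 unit_tangent_compact cf.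
have {zmax} fmax z : K z -> f z <= f z0 by move=> /mem_set; exact: zmax.
have [[Sz0 _] _] := Kz0.
have scaleA q a X : S q -> ip h q (A (a *: X) (a *: X)) (A (a *: X) (a *: X)) =
    a ^+ 4 * ip h q (A X X) (A X X).
  by move=> Sq; rewrite AZl AZr ipZl// ipZr// ipZl// ipZr//; ring.
have N0 := Kpos _ Kz0; set N := ip h z0.1 (U z0) (U z0) in N0.
pose k := Num.sqrt N.
have kk : k ^+ 2 = N by rewrite /k sqr_sqrtr// ltW.
have k0 : k != 0 by rewrite /k sqrtr_eq0 -ltNge.
exists (f z0), z0.1, (k^-1 *: U z0); split=> //.
- by rewrite ipZl// ipZr// mulrA -expr2 exprVn -/N kk mulVf// gt_eqF.
- rewrite scaleA// /f -/N -kk mulrC; congr (_ * _).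
  by rewrite -exprM exprVn.
move=> Y q Sq; have [Y0|Y0] := eqVneq (Y q) 0.
  have A0 : A Y Y q = 0.
    rewrite (A_point (X' := 0) Sq); last by rewrite Y0.
    by rewrite -(scale0r (0 : vf)) AZl !scale0r.
  rewrite /ip A0 Y0 !(metric0l HG)//; try exact: tangent0.
  by rewrite expr0n mulr0.
have [r r0 Sr] := normalize _ Y0.
pose z := (q, r^-1 *: Y q).
have Kz : K z.
  split; first by split.
  have /(sphere_tangent _ Sq) Yq : tangent S q (Y q) by exact: (vfieldP Y).2.
  by rewrite /= dotrC dotrZl dotrC Yq mulr0.
have YE : Y q = (r *: U z) q.
  by rewrite vfieldZE (UE _ Kz) scalerA divff ?scale1r// gt_eqF.
have AY : A Y Y q = A (r *: U z) (r *: U z) q by exact: A_point.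
have -> : ip h q (A Y Y) (A Y Y) = r ^+ 4 * ip h q (A (U z) (U z)) (A (U z) (U z)).
  by rewrite -scaleA// /ip AY.
have -> : ip h q Y Y = r ^+ 2 * ip h q (U z) (U z).
  by rewrite {1}/ip YE -[LHS]/(ip h q (r *: U z) (r *: U z)) ipZl// ipZr// mulrA.
have := fmax _ Kz; rewrite {1}/f ler_pdivrMr ?exprn_gt0 ?Kpos//= => le.
rewrite exprMn -exprM mulrCA ler_pM2l ?exprn_gt0//.
Qed.

End MaximalRatio.
End UnitTangentBundle.

Section CovariantDerivativeOfJ.
Variables (R : realType) (V : normedModType R) (M : set V) (F : frame M).
Local Notation vf := (vfield F).
Variables (h : V -> V -> V -> R) (nab : vf -> vf -> vf) (J : V -> V -> V).
Hypotheses (HL : levi_civita_field h nab) (HJ : almost_complex M J).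
Local Notation Jf := (@J_field R V M F J).
Local Notation covJ := (covJ nab Jf).

Lemma J_fscale f X : smooth M f -> Jf (fscale f X) = fscale f (Jf X).
Proof.
move=> sf; apply: vfield_eq => p Mp; rewrite fscaleE// !(J_fieldE HJ)// fscaleE//.
have T0 := tangent0 Mp; have TX := tangentP X Mp.
have J0 : J p 0 = 0.
  have := almost_complex_linear HJ 1 Mp T0 T0.
  by rewrite !scale1r addr0 => e; apply: (addrI (J p 0)); rewrite -e addr0.
by have := almost_complex_linear HJ (f p) Mp TX T0; rewrite J0 !addr0.
Qed.

Lemma J_fieldD X Y : Jf (X + Y) = Jf X + Jf Y.
Proof.
apply: vfield_eq => p Mp; rewrite vfieldDE !(J_fieldE HJ)// vfieldDE.
have := almost_complex_linear HJ 1 Mp (tangentP X Mp) (tangentP Y Mp).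
by rewrite !scale1r.
Qed.

Lemma covJ_scalel f X Y : smooth M f -> covJ (fscale f X) Y = fscale f (covJ X Y).
Proof.
move=> sf; rewrite !covJE !(lc_scalel HL)// J_fscale//.
apply: vfield_eq => p Mp; rewrite vfieldDE vfieldNE !fscaleE//.
by rewrite vfieldDE vfieldNE scalerBr.
Qed.

Lemma covJ_scaler f X Y : smooth M f -> covJ X (fscale f Y) = fscale f (covJ X Y).
Proof.
move=> sf; rewrite !covJE J_fscale// !(lc_leibniz HL)// J_fieldD !J_fscale//; last exact: der_smooth.
apply: vfield_eq => p Mp; have sd := der_smooth X sf.
rewrite fscaleE// !(vfieldDE, vfieldNE) !fscaleE// scalerBr.
by rewrite opprD addrACA subrr add0r.
Qed.

End CovariantDerivativeOfJ.

Lemma linear_coef_eq0 (R : realFieldType) (a b c d : R) :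
  (forall t, a * t + t ^+ 2 * (b + c * t + d * t ^+ 2) <= 0) -> a = 0.
Proof.
move=> le0; apply/eqP/negPn/negP => a0.
pose r := 1 + `|b| + `|c * a| + `|d * a ^+ 2|.
have r1 : 1 <= r.
  by rewrite /r; have := normr_ge0 b; have := normr_ge0 (c * a); have := normr_ge0 (d * a ^+ 2); lra.
have r0 : 0 < r by lra.
pose s := r^-1; have s0 : 0 < s by rewrite invr_gt0.
have s1 : s <= 1 by rewrite invf_le1.
have sr : s * r = 1 by rewrite mulVf// gt_eqF.
have := le0 (s * a).
have -> : a * (s * a) + (s * a) ^+ 2 * (b + c * (s * a) + d * (s * a) ^+ 2) =
  s * a ^+ 2 * (1 + s * (b + s * (c * a) + s ^+ 2 * (d * a ^+ 2))) by ring.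
have sa : 0 < s * a ^+ 2 by rewrite mulr_gt0// exprn_even_gt0.
rewrite (pmulr_rle0 _ sa).
apply/negP; rewrite -ltNge.
have lb (x y : R) : 0 <= y -> y <= 1 -> - `|x| <= y * x.
  move=> y0 y1; have : `|y * x| <= `|x|.
    by rewrite normrM ger0_norm// ler_piMl.
  by move=> h1; have := ler_norm (- (y * x)); rewrite normrN; lra.
have h1 := lb (c * a) s (ltW s0) s1.
have h2 : - `|d * a ^+ 2| <= s ^+ 2 * (d * a ^+ 2).
  by apply: lb; [exact: sqr_ge0|rewrite expr_le1// ltW].
have h3 := ler_norm (- b); rewrite normrN in h3.
have : s * - (r - 1) <= s * (b + s * (c * a) + s ^+ 2 * (d * a ^+ 2)).
  by rewrite ler_pM2l//; rewrite /r; lra.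
rewrite mulrN mulrBr sr mulr1; lra.
Qed.

Lemma second_derivatives_absurd (R : realFieldType) (k l a b c d m n : R) :
  0 < k * l -> a + b = 2 * l * (c + d) + 2 * k * l ->
  2 * (a + m) - 4 * l * c <= 0 -> 2 * (b + n) - 4 * l * d <= 0 ->
  0 <= m -> 0 <= n -> False.
Proof. by move=> kl e h1 h2 m0 n0; lra. Qed.

Section FourSphere.
Variables (R : realType) (h : 'rV[R]_5 -> 'rV[R]_5 -> 'rV[R]_5 -> R) (k : R).
Local Notation V := 'rV[R]_5.
Local Notation S := (sphere R 4).
Local Notation F := (sphere_frame R 4).
Local Notation vf := (vfield F).
Hypotheses (k0 : 0 < k) (HG : riemannian_metric S h).
Variable nab : vf -> vf -> vf.
Hypothesis HL : levi_civita_field h nab.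
Hypothesis curv : forall p U X W Z, S p -> ip h p (riem nab U X W) Z =
    k * (ip h p X W * ip h p U Z - ip h p U W * ip h p X Z).
Variable J : V -> V -> V.
Hypotheses (HJ : almost_complex S J) (Horth : orthogonal_structure S h J)
  (Hint : integrable_structure S J).
Local Notation Jf := (@J_field R V S F J).
Local Notation covJ := (covJ nab Jf).
Local Notation hip := (@ip R V S F h).
Let HC := lc_metric_connection HG HL.
Let HH := hermitian_field HJ Horth Hint HL.

Let ipDE p X Y Z : S p -> hip p (X + Y) Z = hip p X Z + hip p Y Z.
Proof. exact: (ipDl HC). Qed.
Let ipsym p X Y : S p -> hip p X Y = hip p Y X.
Proof. exact: (ipC HC). Qed.

(** Four pairwise orthogonal nonzero vectors span the tangent space. *)
Lemma tangent_basis4 p X W T : S p -> hip p X X != 0 -> hip p W W != 0 ->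
  hip p X W = 0 -> hip p (Jf X) W = 0 -> hip p T X = 0 -> hip p T (Jf X) = 0 ->
  hip p T W = 0 -> hip p T (Jf W) = 0 -> T p = 0.
Proof.
move=> Sp XX WW XW JXW TX TJX TW TJW; apply/eqP/negPn/negP => T0.
have Jsk A B : hip p (Jf A) B = - hip p A (Jf B) by exact: (J_skew HC HH).
have Jip A B : hip p (Jf A) (Jf B) = hip p A B by exact: (J_ip HH).
have JA A : hip p A (Jf A) = 0.
  by have := Jsk A A; rewrite (ipsym (Jf A))// => e; lra.
have XJW : hip p X (Jf W) = 0 by have := Jsk X W; rewrite JXW => e; lra.
pose v := fun i : 'I_5 => if val i is 0%N then X p else if val i is 1%N then Jf X p
  else if val i is 2%N then W p else if val i is 3%N then Jf W p else T p.
have nz A : hip p A A != 0 -> A p != 0.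
  move=> AA; apply/eqP => A0; move/eqP: AA; apply.
  by rewrite /ip A0; exact: (metric0l HG Sp (tangent0 Sp)).
have Tv i : tangent S p (v i).
  by case: i => -[|[|[|[|m]]]] i; rewrite /v/=; exact: tangentP.
have v0 i : v i != 0.
  by case: i => -[|[|[|[|m]]]] i; rewrite /v/= ?T0//; apply: nz; rewrite ?Jip.
have orth i j : i != j -> h p (v i) (v j) = 0.
  have lt i' j' : (val i' < val j')%N -> h p (v i') (v j') = 0.
    have JXJW : hip p (Jf X) (Jf W) = 0 by rewrite Jip.
    have XT : hip p X T = 0 by rewrite ipsym.
    have JXT : hip p (Jf X) T = 0 by rewrite ipsym.
    have WT : hip p W T = 0 by rewrite ipsym.
    have JWT : hip p (Jf W) T = 0 by rewrite ipsym.
    case: i' => -[|[|[|[|[|?]]]]] //= li; case: j' => -[|[|[|[|[|?]]]]] //= lj _;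
      rewrite /v/=; first [exact: JA | exact: XW | exact: XJW | exact: XT | exact: JXW
            | exact: JXJW | exact: JXT | exact: WT | exact: JWT].
  have [ij|ji|/val_inj ->] := ltngtP (val i) (val j); last by rewrite eqxx.
    by move=> _; exact: lt.
  by move=> _; rewrite (Defs.metric_sym HG)//; exact: lt.
by have := sphere_orthogonal_family HG Sp Tv v0 orth.
Qed.


Let ipZ p a X Y : S p -> hip p (a *: X) Y = a * hip p X Y.
Proof. exact: (ipZl HG). Qed.

Let covJZl a X Y : covJ (a *: X) Y = a *: covJ X Y.
Proof. by rewrite -!fscale_cst (covJ_scalel HL HJ)//; exact: smooth_fun_cst. Qed.

Let covJZr a X Y : covJ X (a *: Y) = a *: covJ X Y.
Proof. by rewrite -!fscale_cst (covJ_scaler HL HJ)//; exact: smooth_fun_cst. Qed.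

Let ip_expand p A B C (a b : R) : S p ->
  hip p (A + a *: B + b *: C) (A + a *: B + b *: C) =
  hip p A A + a * (2 * hip p B A) + a ^+ 2 * hip p B B + b * (2 * hip p C A) +
  a * b * (2 * hip p B C) + b ^+ 2 * hip p C C.
Proof.
move=> Sp; have e D : hip p (A + a *: B + b *: C) D =
    hip p A D + a * hip p B D + b * hip p C D by rewrite !ipDE// !ipZ.
rewrite e (ipsym A _ Sp) (ipsym B _ Sp) (ipsym C _ Sp) !e.
rewrite (ipsym A B Sp) (ipsym A C Sp) (ipsym C B Sp); ring.
Qed.

Let eq_opp_eq0 (a b : R) : a = b -> a = - b -> a = 0.
Proof. by move=> e1 e2; lra. Qed.

Section Maximum.
Variables (l : R) (p : V) (X : vf).
Hypotheses (l0 : 0 < l) (Sp : S p) (XX : hip p X X = 1)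
  (flat : forall U, nab U X p = 0).
Hypothesis max : forall Y q, S q -> hip q (covJ Y Y) (covJ Y Y) <= l * hip q Y Y ^+ 2.
Variable W : vf.
Hypothesis WE : W = covJ X X.
Hypothesis WW : hip p W W = l.

Let ip0 p' Y : S p' -> hip p' 0 Y = 0.
Proof. exact: (ip0l HC). Qed.

(** Stationarity in the fibre of the tangent bundle over [p]. *)
Lemma max_crit U : hip p (covJ U X) W + hip p (covJ X U) W = 2 * l * hip p U X.
Proof.
pose B := covJ U X + covJ X U; pose C := covJ U U.
have e t : hip p (covJ (X + t *: U) (X + t *: U)) (covJ (X + t *: U) (X + t *: U)) =
    l + t * (2 * hip p B W) + t ^+ 2 * (hip p B B + 2 * hip p C W) +
    t ^+ 3 * (2 * hip p B C) + t ^+ 4 * hip p C C.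
  have -> : covJ (X + t *: U) (X + t *: U) = W + t *: B + (t ^+ 2) *: C.
    rewrite (covJDl HC HH) !(covJDr HC HH) !covJZl !covJZr scalerA -expr2 /B scalerDr.
    by rewrite addrA -WE -/C; congr (_ + _); rewrite -addrA; congr (_ + _); rewrite addrC.
  by rewrite ip_expand// WW; ring.
have n t : hip p (X + t *: U) (X + t *: U) =
    1 + t * (2 * hip p U X) + t ^+ 2 * hip p U U.
  have := ip_expand X U 0 t 0 Sp; rewrite scale0r addr0 => ->; rewrite XX; ring.
have : 2 * hip p B W - 4 * l * hip p U X = 0.
  pose u := hip p U X; pose uu := hip p U U.
  apply: (@linear_coef_eq0 _ _
    (hip p B B + 2 * hip p C W - l * (4 * u ^+ 2 + 2 * uu))
    (2 * hip p B C - 4 * l * u * uu) (hip p C C - l * uu ^+ 2)) => t.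
  have := max (X + t *: U) Sp; rewrite e n -/u -/uu -subr_le0.
  by apply: le_trans; rewrite le_eqVlt; apply/orP; left; apply/eqP; ring.
by rewrite /B ipDE// => h1; lra.
Qed.

Let WX q : S q -> hip q W X = 0.
Proof. by move=> Sq; have := covJ_skew HC HH X X X Sq; rewrite (ipsym X)// -WE => e; lra. Qed.

Lemma max_covJ_W : (covJ X W + l *: X) p = 0.
Proof.
have Jsk A B : hip p (Jf A) B = - hip p A (Jf B) by exact: (J_skew HC HH).
have skew A B C : hip p (covJ A B) C = - hip p B (covJ A C) by exact: (covJ_skew HC HH).
have JA A : hip p A (Jf A) = 0.
  by have := Jsk A A; rewrite (ipsym (Jf A))// => e; lra.
have ipNr A B : hip p A (- B) = - hip p A B by exact: (ipNr HC).
have e1 : hip p W (Jf X) = hip p X (Jf W) by rewrite {1}WE skew (covJ_J HC HH) ipNr opprK -WE.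
have e2 : hip p W (Jf X) = - hip p X (Jf W) by rewrite ipsym// Jsk.
have WJX : hip p W (Jf X) = 0 by exact: eq_opp_eq0 e1 e2.
have XJW : hip p X (Jf W) = 0 by rewrite -e1.
apply: (@tangent_basis4 p X W (covJ X W + l *: X) Sp).
- by rewrite XX oner_eq0.
- by rewrite WW gt_eqF.
- by rewrite ipsym// WX.
- by rewrite ipsym.
- by rewrite ipDE// ipZ// skew -WE WW XX; ring.
- by rewrite ipDE// ipZ// skew (covJ_J HC HH) ipNr -WE !JA; ring.
- rewrite ipDE// ipZ// (ipsym X W)// WX// mulr0 addr0.
  by apply: eq_opp_eq0 erefl _; rewrite {1}skew ipsym.
rewrite ipDE// ipZ// XJW.
rewrite mulr0 addr0; apply: eq_opp_eq0 erefl _.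
by rewrite {1}skew (covJ_J HC HH) ipNr -(Jsk W (covJ X W)) (ipsym _ (covJ X W) Sp).
Qed.

Lemma max_aw Y : hip p (covJ X W) Y = - l * hip p X Y.
Proof.
have : hip p (covJ X W + l *: X) Y = 0.
  by rewrite /ip max_covJ_W; exact: (metric0l HG Sp (tangentP Y Sp)).
by rewrite ipDE// ipZ// => e; lra.
Qed.

Let f (q : V) : R^o := hip q W W + - l * (hip q X X * hip q X X).

Let sip A B : smooth S (fun q => hip q A B : R^o).
Proof. exact: (ip_smooth HG). Qed.

Let f_smooth : smooth S f.
Proof.
apply: (smoothD (f := fun q => hip q W W : R^o)) => //.
apply: smooth_mul; first exact: smooth_fun_cst.
by apply: smooth_mul.
Qed.

Lemma der_ip U Y q : S q -> der U (fun q => hip q Y Y) q = 2 * hip q (nab U Y) Y.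
Proof.
by move=> Sq; rewrite (lc_metric HL U Y Y Sq) (ipsym Y (nab U Y) Sq); ring.
Qed.

Lemma der_f U q : S q -> der U f q =
  2 * hip q (nab U W) W + - (4 * l) * (hip q X X * hip q (nab U X) X).
Proof.
move=> Sq; have sXX := smooth_mul (sip X X) (sip X X).
have sc := smooth_fun_cst (M := S) (- l : R^o).
rewrite (derD U (sip W W) (smooth_mul sc sXX) Sq) (derM U sc sXX Sq).
rewrite (der_cst U _ Sq) (derM U (sip X X) (sip X X) Sq) !(der_ip U _ Sq); ring.
Qed.

Lemma nab_flat U Y : hip p (nab U X) Y = 0.
Proof.
by rewrite /ip flat; exact: (metric0l HG Sp (tangentP Y Sp)).
Qed.

Lemma der2_f U : der U (der U f) p =
  2 * (hip p (nab U (nab U W)) W + hip p (nab U W) (nab U W))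
  - 4 * l * hip p (nab U (nab U X)) X.
Proof.
have s1 := sip (nab U W) W; have s2 := sip (nab U X) X.
have c2 := smooth_fun_cst (M := S) (2 : R^o).
have c4 := smooth_fun_cst (M := S) (- (4 * l) : R^o).
have s3 := smooth_mul (sip X X) s2.
have -> : der U (der U f) p = der U (fun q => 2 * hip q (nab U W) W +
    - (4 * l) * (hip q X X * hip q (nab U X) X)) p.
  by rewrite (der_eq U (fun q Sq => der_f U Sq) (der_smooth U f_smooth)).
rewrite (derD U (smooth_mul c2 s1) (smooth_mul c4 s3) Sp).
rewrite (derM U c2 s1 Sp) (derM U c4 s3 Sp) (derM U (sip X X) s2 Sp).
rewrite !(der_cst U _ Sp) !(lc_metric HL U _ _ Sp) !nab_flat XX; ring.
Qed.

Lemma maximum_absurd : False.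
Proof.
have f_max q : S q -> f q <= f p.
  move=> Sq; have -> : f p = 0 by rewrite /f WW XX; ring.
  by have := max X Sq; rewrite /f -WE expr2 => e; lra.
have [d0 _] := sphere_second_derivative X f_smooth Sp f_max.
have [_ d1] := sphere_second_derivative X f_smooth Sp f_max.
have [_ d2] := sphere_second_derivative (Jf X) f_smooth Sp f_max.
have nabw U : hip p (nab U W) W = 0.
  by have := d0 U; rewrite (der_f U Sp) nab_flat => e; lra.
have lap := laplace_covJ_crit HC HH curv Sp (fun _ => erefl) (fun _ => erefl)
  (fun _ => erefl) (fun _ => erefl) (fun _ => erefl) (fun _ => erefl)
  (fun _ => erefl) WE erefl XX WW nab_flat nabw max_crit max_aw.
rewrite !ipDE// in lap; rewrite (der2_f X) in d1; rewrite (der2_f (Jf X)) in d2.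
have n1 := metric_ge0 HG Sp (tangentP (nab X W) Sp).
have n2 := metric_ge0 HG Sp (tangentP (nab (Jf X) W) Sp).
rewrite -/(hip p (nab X W) (nab X W)) in n1.
rewrite -/(hip p (nab (Jf X) W) (nab (Jf X) W)) in n2.
exact: (second_derivatives_absurd (mulr_gt0 k0 l0) lap d1 d2 n1 n2).
Qed.

End Maximum.
Lemma four_sphere_absurd : False.
Proof.
have [l [p [X [Sp XX XXl max]]]] := exists_max_ratio HG (covJDl HC HH) (covJDr HC HH)
  (fun f A B sf => covJ_scalel HL HJ A B sf) (fun f A B sf => covJ_scaler HL HJ A B sf)
  (isT : (0 < 4)%N).
have l_ge0 : 0 <= l by rewrite -XXl; exact: (metric_ge0 HG Sp (tangentP _ Sp)).
have [l0|l_neq0] := eqVneq l 0.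
  have nk Y : covJ Y Y = 0.
    apply: vfield_eq => q Sq; rewrite vfield0E.
    apply: (metric_eq0 HG Sq (tangentP (covJ Y Y) Sq)); apply/eqP; rewrite eq_le.
    rewrite (metric_ge0 HG Sq (tangentP (covJ Y Y) Sq)) andbT.
    by have := max Y q Sq; rewrite l0 mul0r.
  have kahler := nearly_kahler_kahler HC HH nk.
  pose v (i : 'I_2) := if val i is 0%N then X p else Jf X p.
  have Tv i : tangent S p (v i) by rewrite /v; case: (val i) => [|_]; exact: tangentP.
  have [w [Tw w0 orth]] := sphere_orthogonal_vector HG (isT : (2 < 4)%N) Sp Tv.
  pose Y : vf := field_of F w; have YE : Y p = w by exact: field_ofE.
  have YX : hip p Y X = 0 by rewrite ipsym// /ip YE; exact: (orth ord0).
  have YJX : hip p Y (Jf X) = 0 by rewrite ipsym// /ip YE; exact: (orth ord_max).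
  have := kahler_flat HC HH curv kahler Sp YX YJX.
  have YY : 0 < hip p Y Y by rewrite /ip YE; exact: (metric_pos HG).
  by move=> /eqP; rewrite XX mulr1 gt_eqF// mulr_gt0.
have l_gt0 : 0 < l by rewrite lt_neqAle eq_sym l_neq0.
have [X' X'X flat] := flat_extension HL Sp (tangentP X Sp).
have AX : covJ X' X' p = covJ X X p.
  exact: (A_point HG (covJDl HC HH) (covJDr HC HH)
    (fun f A B sf => covJ_scalel HL HJ A B sf)
    (fun f A B sf => covJ_scaler HL HJ A B sf) Sp X'X).
have XX' : hip p X' X' = 1 by rewrite /ip X'X.
have WW' : hip p (covJ X' X') (covJ X' X') = l by rewrite /ip AX.
exact: (maximum_absurd l_gt0 Sp XX' flat max erefl WW').
Qed.

End FourSphere.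

Lemma four_sphere_not_integrable (R : realType) (k : R)
    (h : 'rV[R]_5 -> 'rV[R]_5 -> 'rV[R]_5 -> R) (J : 'rV[R]_5 -> 'rV[R]_5 -> 'rV[R]_5) :
  round_metric k h -> almost_complex (sphere R 4) J ->
  orthogonal_structure (sphere R 4) h J -> ~ integrable_structure (sphere R 4) J.
Proof.
move=> [k0 HG cc] HJ Horth Hint.
have [nab HL curv] := constant_curvature_field (sphere_frame R 4) HG cc.
exact: (four_sphere_absurd k0 HG HL curv HJ Horth Hint).
Qed.

Theorem corollaryB (R : realType) (alpha beta : R)
    (g : 'rV[R]_3 -> 'rV[R]_3 -> 'rV[R]_3 -> R)
    (h : 'rV[R]_5 -> 'rV[R]_5 -> 'rV[R]_5 -> R)
    (halpha : 0 < alpha) (hbeta : 0 < beta)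
    (hg : round_metric alpha g) (hh : round_metric beta h)
    (J : 'rV[R]_3 * 'rV[R]_5 -> 'rV[R]_3 * 'rV[R]_5 -> 'rV[R]_3 * 'rV[R]_5)
    (hJ : almost_complex (sphere R 2 `*` sphere R 4) J)
    (hJorth : orthogonal_structure (sphere R 2 `*` sphere R 4)
                (product_metric g h) J) :
  ~ integrable_structure (sphere R 2 `*` sphere R 4) J.
Proof.
move=> hJint; have [_ HG1 cc1] := hg; have [_ HG2 cc2] := hh.
have [nab1 HL1 curv1] := constant_curvature_field (sphere_frame R 2) HG1 cc1.
have [nab2 HL2 curv2] := constant_curvature_field (sphere_frame R 4) HG2 cc2.
have ab0 : 0 < alpha + beta by rewrite addr_gt0.
have J_ver := J_vertical HG1 HG2 HL1 HL2 curv1 curv2 ab0 hJ hJorth hJint.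
have Sp1 : sphere R 2 (delta_mx 0 0) by apply/sphereP; rewrite dotr_delta mxE !eqxx.
have ac := slice_almost_complex hJ J_ver Sp1.
have orth := slice_orthogonal HG1 hJorth J_ver Sp1.
have int := slice_integrable hJ hJint J_ver Sp1.
exact: (four_sphere_not_integrable hh ac orth int).
Qed.
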